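(* Let $(Y,X),(Y_1,X_1),(Y_2,X_2),\ldots$ be i.i.d. random vectors in $\mathbb{R}^r\times\mathbb{R}^d$ ($r,d\ge1$) such that $X$ has a marginal Lebesgue density $f$. Let $I$ be a compact subset of $\mathbb{R}^d$ and $J=I^\eta$ for some $0<\eta<1$. Let $K:\mathbb{R}^d\to\mathbb{R}$ be a kernel with support contained in $[-1/2,1/2]^d$, $\sup_{x}|K(x)|=:\kappa<\infty$ and $\int_{\mathbb{R}^d}K(s)\,ds=1$, such that the class $\mathcal{K}=\{K((x-\cdot)/h^{1/d}):h>0,\ x\in\mathbb{R}^d\}$ satisfies the uniform entropy condition and is pointwise measurable. Let $\Phi$ be a class of measurable functions $\varphi:\mathbb{R}^r\to\mathbb{R}$ with finite-valued measurable envelope function $F$, i.e. $F(y)\ge\sup_{\varphi\in\Phi}|\varphi(y)|$ for $y\in\mathbb{R}^r$, which satisfies the uniform entropy condition and is pointwise measurable. For each $\varphi\in\Phi$ let $c_\varphi,d_\varphi$ be continuous functions on $J$ such that the classes $\mathcal{C}=\{c_\varphi:\varphi\in\Phi\}$ and $\mathcal{D}=\{d_\varphi:\varphi\in\Phi\}$ are relatively compact with respect to the sup-norm topology. Assume that $f$ is continuous and strictly positive on $J$. Further assume that either (a) there exists $M>0$ such that $F(Y)\,\mathbf{1}\{X\in J\}\le M$ almost surely, or (b) for some $p>2$, $\alpha:=\sup_{z\in J}\mathbb{E}(F^p(Y)\,|\,X=z)<\infty$. Then for any $c>0$ and $0<h_0<(2\eta)^d$, with probability 1, $$\limsup_{n\to\infty}\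 \sup_{c(\log n/n)^\gamma\le h\le h_0}\frac{\sup_{\varphi\in\Phi}\|\omega_{\varphi,n,h}-\mathbb{E}\omega_{\varphi,n,h}\|_I}{\sqrt{nh(\log(1/h)\vee\log\log n)}}=:P(c)<\infty,$$ where $\gamma=1$ in case (a) and $\gamma=1-2/p$ in case (b), and $$\omega_{\varphi,n,h}(x)=\sum_{i=1}^n\big(c_\varphi(x)\varphi(Y_i)+d_\varphi(x)\big)K\Big(\frac{x-X_i}{h^{1/d}}\Big),\qquad x\in J.$$
   Context: $I^\eta$ is the closed $\eta$-neighborhood of $I$ with respect to the maximum norm $|x|_+=\max_{1\le i\le d}|x_i|$; $\|\psi\|_I=\sup_{x\in I}|\psi(x)|$; $a\vee b=\max(a,b)$. Kernels are measurable. Uniform entropy condition: for a class $\mathcal{G}$ of measurable functions on a measurable space with envelope $G$, let $N(\varepsilon,\mathcal{G})=\sup_QN(\varepsilon\sqrt{Q(G^2)},\mathcal{G},d_Q)$, the supremum being over all probability measures $Q$ with $0<Q(G^2)<\infty$, where $Q(G^2)=\int G^2\,dQ$, $d_Q$ is the $L_2(Q)$-metric, and $N(\delta,\mathcal{G},d_Q)$ is the minimal number of $d_Q$-balls of radius $\delta$ needed to cover $\mathcal{G}$. The condition is: for some $C>0$ and $\nu>0$, $N(\varepsilon,\mathcal{G})\le C\varepsilon^{-\nu}$ for all $0<\varepsilon<1$. For $\mathcal{K}$ the envelope is the constant $\kappa$; for $\Phi$ it is $F$. A class $\mathcal{G}$ of functions is pointwise measurable if there is a countable subclass $\mathcal{G}_0\subset\mathcal{G}$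 such that for every $g\in\mathcal{G}$ there is a sequence $\{g_m\}$ in $\mathcal{G}_0$ converging pointwise everywhere to $g$. *)

(* Defs.v *)
From HB Require Import structures.
From mathcomp Require Import all_boot all_order all_algebra.
From mathcomp Require Import all_classical all_reals all_analysis.
From mathcomp Require Import measurable_realfun.

Set Implicit Arguments.
Unset Strict Implicit.
Unset Printing Implicit Defensive.

Import Order.TTheory GRing.Theory Num.Theory.
Import numFieldNormedType.Exports.

Local Open Scope classical_set_scope.
Local Open Scope ring_scope.

(* R^n is 'rV[R]_n, whose library norm is the maximum norm. It is equipped with
   the product sigma-algebra, as the library does for n.-tuple; over the reals
   this is the Borel sigma-algebra. *)
Definition measure_rV_display : measure_display -> measure_display.
Proof. exact. Qed.

Section measurable_rV.
Context {d} {T : measurableType d}.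
Variable n : nat.

Let coors : 'I_n -> 'rV[T]_n -> T := fun i x => x ord0 i.

Let rV_set0 : g_sigma_preimage coors set0.
Proof. exact: sigma_algebra0. Qed.

Let rV_setC A : g_sigma_preimage coors A -> g_sigma_preimage coors (~` A).
Proof. exact: sigma_algebraC. Qed.

Let rV_bigcup (F : _^nat) : (forall i, g_sigma_preimage coors (F i)) ->
  g_sigma_preimage coors (\bigcup_i (F i)).
Proof. exact: sigma_algebra_bigcup. Qed.

HB.instance Definition _ := @isMeasurable.Build (measure_rV_display d)
  'rV[T]_n (g_sigma_preimage coors) rV_set0 rV_setC rV_bigcup.

End measurable_rV.

Lemma measurable_coord d (T : measurableType d) n (i : 'I_n) :
  measurable_fun [set: 'rV[T]_n] (fun x : 'rV[T]_n => x ord0 i).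
Proof.
move=> _ Y mY; rewrite setTI; apply: sub_sigma_algebra => /=.
rewrite -bigcup_seq/=; exists i => /=; first by rewrite mem_index_enum.
by exists Y => //; rewrite setTI.
Qed.

Lemma measurable_fun_rVP d1 d2 (T1 : measurableType d1) (T2 : measurableType d2)
    n (f : T1 -> 'rV[T2]_n) :
  (forall i, measurable_fun [set: T1] (fun x => f x ord0 i)) ->
  measurable_fun [set: T1] f.
Proof.
move=> mf.
suff : g_sigma_preimage (fun i x => f x ord0 i) `<=` measurable.
  move=> fS _ A mA; apply: fS.
  have -> : (fun i x => f x ord0 i) =
    (fun i : 'I_n => (fun x : 'rV[T2]_n => x ord0 i) \o f) by [].
  by rewrite g_sigma_preimage_comp; exists A.
apply: smallest_sub; first exact: sigma_algebra_measurable.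
rewrite -bigcup_seq/=; apply: bigcup_sub => i _ A [B mB <-].
exact: mf.
Qed.

Section rV_cons.
Context (R : realType) (n : nat).

Definition rV_cons (z : R * 'rV[R]_n) : 'rV[R]_n.+1 :=
  \row_j (if unlift ord0 j is Some k then z.2 ord0 k else z.1).

Definition rV_uncons (x : 'rV[R]_n.+1) : R * 'rV[R]_n :=
  (x ord0 ord0, \row_k x ord0 (lift ord0 k)).

Lemma rV_consK : cancel rV_cons rV_uncons.
Proof.
move=> [a v]; rewrite /rV_uncons /rV_cons !mxE unlift_none/=; congr pair.
by apply/rowP => k; rewrite !mxE liftK.
Qed.

Lemma measurable_rV_cons : measurable_fun [set: R * 'rV[R]_n] rV_cons.
Proof.
apply: measurable_fun_rVP => i; rewrite /rV_cons.
under eq_fun do rewrite mxE.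
case: unliftP => [k _|_]; last exact: measurable_fst.
exact: (measurableT_comp (measurable_coord k) measurable_snd).
Qed.

Lemma measurable_rV_uncons : measurable_fun [set: 'rV[R]_n.+1] rV_uncons.
Proof.
apply: measurable_fun_pair; first exact: measurable_coord.
apply: measurable_fun_rVP => i.
under eq_fun do rewrite mxE.
exact: measurable_coord.
Qed.

End rV_cons.

Section pushforward_rV_cons.
Local Open Scope ereal_scope.
Context (R : realType) (n : nat).
Variable mu : {sigma_finite_measure set 'rV[R]_n -> \bar R}.

Definition lebesgue_consn : set 'rV[R]_n.+1 -> \bar R :=
  fun A => (lebesgue_measure \x mu) (@rV_cons R n @^-1` A).

Let m_preimage (A : set 'rV[R]_n.+1) : measurable A ->
  measurable (@rV_cons R n @^-1` A).
Proof.
by move=> mA; rewrite -[X in measurable X]setTI; exact: measurable_rV_cons.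
Qed.

Let consn0 : lebesgue_consn set0 = 0.
Proof. by rewrite /lebesgue_consn preimage_set0 measure0. Qed.

Let consn_ge0 A : 0 <= lebesgue_consn A.
Proof. exact: measure_ge0. Qed.

Let consn_sigma_additive : semi_sigma_additive lebesgue_consn.
Proof.
move=> F mF tF mUF; rewrite /lebesgue_consn preimage_bigcup.
apply: measure_semi_sigma_additive.
- by move=> i; exact: m_preimage.
- apply/trivIsetP => /= i j _ _ ij; rewrite -preimage_setI.
  by move/trivIsetP : tF => /(_ _ _ _ _ ij) ->//; rewrite preimage_set0.
- by rewrite -preimage_bigcup; exact: m_preimage.
Qed.

HB.instance Definition _ := isMeasure.Build _ _ _ lebesgue_consn
  consn0 consn_ge0 consn_sigma_additive.

Let consn_sigma_finite : sigma_finite setT lebesgue_consn.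
Proof.
have /sigma_finiteP[F [TF ndF Foo]] :=
  sigma_finiteT (@lebesgue_measure R).
have /sigma_finiteP[G [TG ndG Goo]] := sigma_finiteT mu.
exists (fun i => @rV_uncons R n @^-1` (F i `*` G i)).
  apply/esym; rewrite -subTset => x _.
  have [i _ Fi] : (\bigcup_i F i) (rV_uncons x).1 by rewrite -TF.
  have [j _ Gj] : (\bigcup_i G i) (rV_uncons x).2 by rewrite -TG.
  exists (maxn i j) => //; split => /=.
  - by move: Fi; exact/subsetPset/ndF/leq_maxl.
  - by move: Gj; exact/subsetPset/ndG/leq_maxr.
move=> i; have [? ?] := Foo i; have [? ?] := Goo i; split.
  rewrite -[X in measurable X]setTI; apply: measurable_rV_uncons => //.
  exact: measurableX.
rewrite /lebesgue_consn -comp_preimage (_ : _ \o _ = id); last first.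
  by apply/funext => z /=; rewrite rV_consK.
by rewrite product_measure1E// lte_mul_pinfty// ge0_fin_numE.
Qed.

HB.instance Definition _ := Measure_isSigmaFinite.Build _ _ _ lebesgue_consn
  consn_sigma_finite.

End pushforward_rV_cons.

(* Lebesgue measure on R^n, as an n-fold product of lebesgue_measure *)
Fixpoint lebesgue_rV (R : realType) (n : nat) :
    {sigma_finite_measure set 'rV[R]_n -> \bar R} :=
  match n with
  | 0 => \d_ (0 : 'rV[R]_0)
  | n'.+1 => lebesgue_consn (lebesgue_rV R n')
  end.

Lemma lebesgue_rV_box (R : realType) n (A : 'I_n -> set R) :
  (forall i, measurable (A i)) ->
  lebesgue_rV R n [set x | forall i, A i (x ord0 i)] =
  (\prod_(i < n) lebesgue_measure (A i))%E.
Proof.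
elim: n A => [|n IH] A mA /=.
  by rewrite big_ord0 diracE mem_set// => -[].
have mB : measurable [set x : 'rV[R]_n | forall i, A (lift ord0 i) (x ord0 i)].
  have -> : [set x : 'rV[R]_n | forall i, A (lift ord0 i) (x ord0 i)] =
      \bigcap_(i in [set: 'I_n])
        ((fun x : 'rV[R]_n => x ord0 i) @^-1` A (lift ord0 i)).
    apply/seteqP; split => x /= h i.
    - by move=> _; exact: (h i).
    - exact: (h i Logic.I).
  apply: fin_bigcap_measurable => // i _.
  rewrite -[X in measurable X]setTI; exact: measurable_coord.
rewrite /lebesgue_consn big_ord_recl -(IH (fun i => A (lift ord0 i)))//.
rewrite -product_measure1E//.
congr (_ _); apply/seteqP; split => [[a v] /= h|[a v] [/= h1 h2] i].
  split => /=; first by have := h ord0; rewrite mxE unlift_none.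
  by move=> i; have := h (lift ord0 i); rewrite mxE liftK.
by rewrite mxE; case: unliftP => [k ->|->].
exact: mA.
Qed.

Section probability_notions.
Local Open Scope ereal_scope.
Context (R : realType) d (Omega : measurableType d) (P : probability Omega R).

Definition mutually_independent d' (T : measurableType d')
    (X : nat -> Omega -> T) : Prop :=
  forall (s : seq nat) (A : nat -> set T), uniq s ->
    (forall i, measurable (A i)) ->
    P (\bigcap_(i in [set` s]) (X i @^-1` A i)) =
    \prod_(i <- s) P (X i @^-1` A i).

Definition identically_distributed d' (T : measurableType d')
    (X : nat -> Omega -> T) : Prop :=
  forall i (A : set T), measurable A -> P (X i @^-1` A) = P (X 0%N @^-1` A).

Definition has_lebesgue_density n (X : Omega -> 'rV[R]_n)
    (f : 'rV[R]_n -> R) : Prop :=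
  [/\ measurable_fun setT f, (forall x, 0 <= f x)%R &
   forall A, measurable A ->
     P (X @^-1` A) = \int[lebesgue_rV R n]_(x in A) (f x)%:E].

(* g is a version of z |-> E (V | X = z), for V >= 0. Both V and g may take the
   value +oo or have infinite integral, and g is determined up to a null set of
   the law of X. *)
Definition cond_expectation_version d' (T : measurableType d')
    (V : Omega -> \bar R) (X : Omega -> T) (g : T -> \bar R) : Prop :=
  [/\ measurable_fun setT g, (forall z, 0 <= g z) &
   forall B, measurable B ->
     \int[P]_(w in X @^-1` B) V w = \int[P]_(w in X @^-1` B) g (X w)].

End probability_notions.

Section entropy.
Local Open Scope ereal_scope.
Context (R : realType) d (T : measurableType d).
Implicit Types (G : set (T -> R)) (env : T -> R) (Q : probability T R).

Definition L2_dist Q (g1 g2 : T -> R) : \bar R :=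
  Lnorm Q 2%:E (fun t => (g1 t - g2 t)%:E).

(* Balls are open and their centers need not belong to the class G. *)
Definition covering_number (delta : R) G Q : \bar R :=
  ereal_inf [set n%:R%:E | n in [set n : nat |
    exists2 u : 'I_n -> T -> R, (forall i, measurable_fun setT (u i)) &
      forall g, G g -> exists i, L2_dist Q g (u i) < delta%:E]].

Definition sq_norm Q env : \bar R := \int[Q]_t ((env t) ^+ 2)%:E.

Definition uniform_covering_number (eps : R) G env : \bar R :=
  ereal_sup [set covering_number (eps * Num.sqrt (fine (sq_norm Q env))) G Q |
    Q in [set Q : probability T R | 0 < sq_norm Q env < +oo]].

Definition uniform_entropy_condition G env : Prop :=
  exists C nu : R, [/\ (0 < C)%R, (0 < nu)%R &
    forall eps : R, (0 < eps < 1)%R ->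
      uniform_covering_number eps G env <= (C * eps `^ (- nu))%:E].

End entropy.

Definition pointwise_measurable (R : realType) (T : Type) (G : set (T -> R)) :
    Prop :=
  exists G0 : set (T -> R), [/\ countable G0, G0 `<=` G &
    forall g, G g -> exists g_ : nat -> T -> R,
      (forall m, G0 (g_ m)) /\ (forall t, g_ ^~ t @ \oo --> g t)].

Definition closed_neighborhood (R : realType) n (I : set 'rV[R]_n) (eta : R) :
    set 'rV[R]_n :=
  [set x | exists2 y, I y & `|x - y| <= eta].

(* Suprema are taken in \bar R: the one over an empty set is -oo. *)
Definition sup_norm (R : realType) (T : Type) (A : set T) (psi : T -> \bar R) :
    \bar R :=
  ereal_sup [set `|psi x|%E | x in A].

Definition scaled_kernel (R : realType) n (K : 'rV[R]_n -> R) (h : R)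
    (x u : 'rV[R]_n) : R :=
  K ((h `^ (n%:R^-1))^-1 *: (x - u)).

Definition kernel_class (R : realType) n (K : 'rV[R]_n -> R) :
    set ('rV[R]_n -> R) :=
  [set g | exists h x, 0 < h /\ g = scaled_kernel K h x].

Section kernel_sum.
Context (R : realType) dO (Omega : measurableType dO) (P : probability Omega R).
Context (r d : nat) (Z : nat -> Omega -> 'rV[R]_r * 'rV[R]_d).
Context (K : 'rV[R]_d -> R) (cphi dphi : ('rV[R]_r -> R) -> 'rV[R]_d -> R).

(* Z i w = (Y_i, X_i) *)
Definition omega_sum (phi : 'rV[R]_r -> R) (n : nat) (h : R) (x : 'rV[R]_d)
    (w : Omega) : R :=
  \sum_(1 <= i < n.+1)
    (cphi phi x * phi (Z i w).1 + dphi phi x) * scaled_kernel K h x (Z i w).2.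

Definition centered_sup_norm (I : set 'rV[R]_d) (phi : 'rV[R]_r -> R) (n : nat)
    (h : R) (w : Omega) : \bar R :=
  sup_norm I (fun x =>
    (omega_sum phi n h x w)%:E - 'E_P[omega_sum phi n h x])%E.

Definition normalizer (n : nat) (h : R) : R :=
  Num.sqrt (n%:R * h * Num.max (ln h^-1) (ln (ln n%:R))).

Definition uniform_deviation (I : set 'rV[R]_d) (Phi : set ('rV[R]_r -> R))
    (gamma h0 c : R) (n : nat) (w : Omega) : \bar R :=
  ereal_sup [set
    (ereal_sup [set centered_sup_norm I phi n h w | phi in Phi]
     * (normalizer n h)^-1%:E)%E |
    h in [set h : R | c * (ln n%:R / n%:R) `^ gamma <= h <= h0]].

End kernel_sum.

(* Main.v *)
Require Import Defs.
From HB Require Import structures.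
From mathcomp Require Import all_boot all_order all_algebra.
From mathcomp Require Import all_classical all_reals all_analysis.
From mathcomp Require Import measurable_realfun.
From mathcomp Require Import ring lra.

(** For fixed [x] the coefficients [cphi phi x] and [dphi phi x] are numbers, and
    they are bounded over [Phi] and [I] because the two families are relatively
    compact. The claim therefore reduces to the classes of products
    [phi (y) * K ((x - u) / h ^ (1/d))], for [phi] in [Phi] and for [phi = 1]: almost
    surely, for all large [n], their centered sums are at most a constant times
    [normalizer n h], uniformly in [x], [phi] and [h].

    The core is a deviation inequality for a class with an envelope [G], bounded
    by [b], whose second moment is at most [v] ([local_deviation]). For every
    [A >= 8 n v + 16 b ^ 2] and every large [a], the probability that some centered
    sum of length at most [n] exceeds [40 sqrt (a A)] is at most
    [4 C exp (- a / 2) + 4 exp (- A / (8 b ^ 2))]. Its proof compares the sample with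
    an independent ghost copy ([symmetrization]) and exchanges the two
    observations with the same index according to random signs, which leaves
    the law unchanged ([sign_averaging]). With high probability the squared
    envelopes of both samples sum up to at most [A] ([chernoff_bounded]), and for
    such samples the signed sums are controlled by a chaining argument
    ([chaining]) driven by a maximal inequality of Hoeffding type
    ([maximal_hoeffding]). Covering numbers
    enter only relatively to the envelope; this form of the entropy condition
    passes to products ([product_entropy]), and it is not spoilt when the class is
    localized.

    Localization gives the right variance. Bandwidths are grouped into dyadic
    levels, and a kernel with bandwidth in the level of [h] lives in a cube of
    volume of order [h]. On that cube the envelope [kappa * F] has second moment of
    order [h], as the density of [X] is bounded; so [A] may be taken of order [n h]
    and [a] of order [log (1 / h)] or [log log n], whichever is larger. There are
    of order [1 / h] cubes, a number that [exp (- a / 2)] absorbs. Summing over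
    levels and cubes, the exceptional probability for the sample sizes between
    [2 ^ i] and [2 ^ i.+1] is of order [1 / i ^ 2] ([block_deviation]), and the
    Borel-Cantelli lemma applies. Pointwise measurability extends the bound from
    countable subclasses to the whole classes ([deviation_limit]).

    The inequality demands that the envelope be bounded by a multiple of
    [sqrt (n h / log n)]. For a bounded envelope this holds for the bandwidths
    [h >= c log n / n]. Under a moment of order [p > 2] the envelope is truncated at
    [(2 ^ i / i) ^ (1 / p)], and the condition holds for [h >= c (log n / n) ^ (1 - 2 / p)]
    ([trunc_level_scale]). The sum over the sample of the part cut off is of the
    order of the normalization, in expectation and almost surely ([excess_sum],
    [trunc_level_normalizer]). *)

Set Implicit Arguments.
Unset Strict Implicit.
Unset Printing Implicit Defensive.

Import Order.TTheory GRing.Theory Num.Theory.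
Import numFieldNormedType.Exports.

Local Open Scope classical_set_scope.
Local Open Scope ring_scope.

(** * Laws of independent samples *)

Section law_of_tuples.
Local Open Scope ereal_scope.
Context (R : realType) d1 d2 d3 (O1 : measurableType d1) (O2 : measurableType d2)
  (T : measurableType d3) (n : nat).
Variables (m1 : {measure set O1 -> \bar R}) (m2 : {measure set O2 -> \bar R}).
Variables (W1 : O1 -> n.-tuple T) (W2 : O2 -> n.-tuple T).
Hypothesis mW1 : measurable_fun setT W1.
Hypothesis mW2 : measurable_fun setT W2.
Hypothesis m1_fin : m1 setT < +oo.
Hypothesis rect : forall A : 'I_n -> set T, (forall i, measurable (A i)) ->
  m1 [set w | forall i, A i (tnth (W1 w) i)] =
  m2 [set w | forall i, A i (tnth (W2 w) i)].

Let rects : set (set (n.-tuple T)) :=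
  [set B | exists2 A : 'I_n -> set T, (forall i, measurable (A i)) &
    B = [set t | forall i, A i (tnth t i)]].

Let measurable_rects B : rects B -> measurable B.
Proof.
move=> [A mA ->].
have -> : [set t : n.-tuple T | forall i, A i (tnth t i)] =
    \bigcap_(i in [set: 'I_n]) ((fun t : n.-tuple T => tnth t i) @^-1` A i).
  by apply/seteqP; split => t /= h i; [move=> _; exact: h|exact: (h i Logic.I)].
apply: fin_bigcap_measurable => // i _.
rewrite -[X in measurable X]setTI; exact: measurable_tnth.
Qed.

Let generated : @measurable _ (n.-tuple T) = <<s rects >>.
Proof.
apply/seteqP; split; last first.
  apply: smallest_sub; first exact: sigma_algebra_measurable.
  by move=> B; exact: measurable_rects.
apply: smallest_sub; first exact: smallest_sigma_algebra.
rewrite -bigcup_seq/=; apply: bigcup_sub => i _ B [A mA <-].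
apply: sub_sigma_algebra; exists (fun j => if j == i then A else setT).
  by move=> j; case: ifP.
apply/seteqP; split => t /=.
  by move=> [_ At] j; case: ifP => // /eqP ->.
by move=> /(_ i); rewrite eqxx.
Qed.

Let W1_mixin := isMeasurableFun.Build _ _ _ _ _ mW1.
Let W1_pack : {mfun _ >-> _} := HB.pack W1 W1_mixin.
Let W2_mixin := isMeasurableFun.Build _ _ _ _ _ mW2.
Let W2_pack : {mfun _ >-> _} := HB.pack W2 W2_mixin.

(** Measurable rectangles form a pi-system generating the sigma-algebra of
    tuples. *)
Lemma eq_law_tuple B : measurable B -> m1 (W1 @^-1` B) = m2 (W2 @^-1` B).
Proof.
move=> mB.
have rectsI : setI_closed rects.
  move=> _ _ [A mA ->] [A' mA' ->].
  exists (fun i => A i `&` A' i); first by move=> i; exact: measurableI.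
  apply/seteqP; split => t /=; first by move=> [h h'] i; split.
  by move=> h; split=> i; have [] := h i.
have rectsT (_ : nat) : rects setT.
  by exists (fun=> setT) => //; apply/seteqP; split.
have coverT : \bigcup_(_ in [set: nat]) [set: n.-tuple T] = setT.
  by rewrite bigcup_const//; exists 0%N.
apply: (measure_unique rects (fun=> setT) generated rectsI rectsT coverT
  (pushforward m1 W1_pack) (pushforward m2 W2_pack)) => //.
by move=> _ [A mA ->]; exact: rect.
Qed.

Lemma eq_integral_law_tuple (f : n.-tuple T -> \bar R) :
  measurable_fun setT f -> (forall t, 0 <= f t) ->
  \int[m1]_w f (W1 w) = \int[m2]_w f (W2 w).
Proof.
move=> mf f0.
transitivity (\int[pushforward m1 W1_pack]_t f t).
  rewrite (ge0_integral_pushforward mW1)//.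
transitivity (\int[pushforward m2 W2_pack]_t f t).
  by apply: eq_measure_integral => B mB _; exact: eq_law_tuple.
rewrite (ge0_integral_pushforward mW2)//.
Qed.

End law_of_tuples.

Section independent_sequence.
Local Open Scope ereal_scope.
Context (R : realType) dO dT (Omega : measurableType dO) (T : measurableType dT).
Variables (P : probability Omega R) (Z : nat -> Omega -> T).
Hypothesis mZ : forall i, measurable_fun setT (Z i).
Hypothesis Z_indep : mutually_independent P Z.

Lemma indep_rect n (A : nat -> set T) : (forall i, measurable (A i)) ->
  P [set w | forall i, (i < n)%N -> A i (Z i w)] =
  \prod_(i < n) P (Z i @^-1` A i).
Proof.
move=> mA.
rewrite -(big_mkord xpredT (fun i => P (Z i @^-1` A i))) -(Z_indep _ mA).
  congr (P _); apply/seteqP; split => w /= h i.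
    by move=> /=; rewrite mem_index_iota => /andP[_]; exact: h.
  by move=> ni; apply: h; rewrite /= mem_index_iota.
exact: iota_uniq.
Qed.

Definition sample n (w : Omega) : n.-tuple T := [tuple Z i w | i < n].

Lemma measurable_sample n : measurable_fun setT (sample n).
Proof.
apply/measurable_fun_tnthP => i.
by apply: eq_measurable_fun (mZ i) => w _ /=; rewrite tnth_mktuple.
Qed.

Lemma measurable_sample_rect n (A : nat -> set T) :
  (forall i, measurable (A i)) ->
  measurable [set w | forall i, (i < n)%N -> A i (Z i w)].
Proof.
move=> mA.
have -> : [set w | forall i, (i < n)%N -> A i (Z i w)] =
    \bigcap_(i in `I_n) (Z i @^-1` A i) by [].
apply: fin_bigcap_measurable => // i _.
by rewrite -[X in measurable X]setTI; exact: mZ.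
Qed.

(** The last coordinate may be replaced by a copy living on a second factor:
    this is independence of the first coordinates from the last one. *)
Lemma ge0_expectation_prod n (e : nat -> T -> R) :
  (forall i, measurable_fun setT (e i)) -> (forall i t, (0 <= e i t)%R) ->
  \int[P]_w (\prod_(i < n) e i (Z i w))%R%:E =
  \prod_(i < n) \int[P]_w (e i (Z i w))%:E.
Proof.
move=> me e0; elim: n => [|n IH].
  under eq_integral do rewrite big_ord0.
  rewrite big_ord0 integral_cst// mul1e. exact: probability_setT.
pose W2 (z : Omega * Omega) : n.+1.-tuple T :=
  [tuple if (i < n)%N then Z i z.1 else Z i z.2 | i < n.+1].
have mW2 : measurable_fun setT W2.
  apply/measurable_fun_tnthP => i.
  have [ltn|len] := ltnP i n.
    apply: (eq_measurable_fun (fun z => Z i z.1)).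
      by move=> z _ /=; rewrite tnth_mktuple ltn.
    exact: measurableT_comp.
  apply: (eq_measurable_fun (fun z => Z i z.2)).
    by move=> z _ /=; rewrite tnth_mktuple ltnNge len.
  exact: measurableT_comp.
pose F (t : n.+1.-tuple T) := (\prod_(i < n.+1) e i (tnth t i))%R%:E.
have F0 t : 0 <= F t by rewrite lee_fin; apply: prodr_ge0.
have mF : measurable_fun setT F.
  apply/measurable_EFinP; apply: measurable_prod => i _.
  exact: (measurableT_comp (me i) (measurable_tnth i)).
have -> : \int[P]_w (\prod_(i < n.+1) e i (Z i w))%R%:E = \int[P]_w F (sample n.+1 w).
  apply: eq_integral => w _; congr EFin; apply: eq_bigr => i _.
  by rewrite tnth_mktuple.
rewrite (@eq_integral_law_tuple _ _ _ _ _ _ _ _ P (P \x P) _ W2)//; first last.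
- move=> A mA.
  pose B i := A (inord i).
  have mB i : measurable (B i) by exact: mA.
  have BA (i : 'I_n.+1) : B i = A i by rewrite /B inord_val.
  transitivity (P [set w | forall i, (i < n.+1)%N -> B i (Z i w)]).
    congr (P _); apply/seteqP; split => w /= h i.
      by move=> ni; have := h (Ordinal ni); rewrite tnth_mktuple -BA.
    by rewrite tnth_mktuple -BA; exact: h.
  rewrite indep_rect// big_ord_recr/= -indep_rect//.
  rewrite -product_measure1E//; last 2 first.
  + exact: measurable_sample_rect.
  + by rewrite -[X in measurable X]setTI; exact: mZ.
  congr (_ _); apply/seteqP; split => -[w w']/=.
    move=> [h h'] i; rewrite tnth_mktuple -BA.
    by case: ltnP => [/h//|ni]; have /eqP <-// : n == i by rewrite eqn_leq ni -ltnS ltn_ord.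
  move=> h; split => [i ni|].
    have := h (Ordinal (ltnW ni : (i < n.+1)%N)).
    by rewrite tnth_mktuple -BA/= ni.
  by have := h ord_max; rewrite tnth_mktuple -BA/= ltnn.
- by rewrite (le_lt_trans (probability_le1 _ _))// ltry.
- exact: measurable_sample.
rewrite fubini_tonelli1//; last exact: measurableT_comp.
rewrite big_ord_recr/= -IH /fubini_F.
under eq_integral => x _.
  under eq_integral => y _.
    rewrite /F big_ord_recr/= EFinM.
    under eq_bigr do rewrite tnth_mktuple/= ltn_ord.
    rewrite tnth_mktuple/= ltnn.
    over.
  rewrite ge0_integralZl//; last 3 first.
  - by apply/measurable_EFinP/measurableT_comp.
  - by move=> y _; rewrite lee_fin.
  - by rewrite lee_fin; apply: prodr_ge0.
  over.
rewrite ge0_integralZr//.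
- apply/measurable_EFinP; apply: measurable_prod => i _.
  exact: measurableT_comp.
- by move=> w _; rewrite lee_fin; apply: prodr_ge0.
- by apply: integral_ge0 => y _; rewrite lee_fin.
Qed.
End independent_sequence.

(** * Exponential inequalities *)

Section exponential_bounds.
Variable R : realType.
Implicit Type x : R.

Lemma expR_le_quadratic x : x <= 2^-1 -> expR x <= 1 + x + 2 * x ^+ 2.
Proof.
move=> x2; have := expR_ge1Dx (- x); rewrite expRN => h.
have x1 : 0 < 1 - x by lra.
have : expR x <= (1 - x)^-1.
  by rewrite -[expR x]invrK lef_pV2// ?posrE ?invr_gt0 ?expR_gt0//; lra.
move=> /le_trans; apply; rewrite -[leLHS]mul1r ler_pdivrMr//.
have : 0 <= x ^+ 2 * (1 - 2 * x) by rewrite mulr_ge0 ?sqr_ge0//; lra.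
by rewrite expr2; nra.
Qed.

Lemma expR_le_linear x : 0 <= x <= 2^-1 -> expR x <= 1 + 2 * x.
Proof.
move=> /andP[x0 x2]; have := expR_le_quadratic x2 => /le_trans; apply.
by rewrite expr2; nra.
Qed.

(** Up to [1/2] by the quadratic bound, beyond it because [x <= 2 * x ^ 2]. *)
Lemma cosh_le_expR x : (expR x + expR (- x)) / 2 <= expR (2 * x ^+ 2).
Proof.
wlog x0 : x / 0 <= x => [hw|].
  have [|/ltW x0] := leP 0 x; first exact: hw.
  rewrite addrC -[X in _ + expR X]opprK -[x ^+ 2]sqrrN; rewrite opprK.
  have := hw (- x); rewrite opprK; apply; lra.
have [x2|x2] := leP x 2^-1.
  have h1 := expR_le_quadratic x2.
  have h2 : expR (- x) <= 1 + - x + 2 * (- x) ^+ 2.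
    by apply: expR_le_quadratic; lra.
  have h3 := expR_ge1Dx (2 * x ^+ 2).
  by rewrite sqrrN in h2; lra.
have h1 : expR x <= expR (2 * x ^+ 2) by rewrite ler_expR expr2; nra.
have h2 : expR (- x) <= expR x by rewrite ler_expR; lra.
by lra.
Qed.

End exponential_bounds.

Section iid_sums.
Local Open Scope ereal_scope.
Context (R : realType) dO dT (Omega : measurableType dO) (T : measurableType dT).
Variables (P : probability Omega R) (Z : nat -> Omega -> T).
Hypothesis mZ : forall i, measurable_fun setT (Z i).
Hypothesis Z_indep : mutually_independent P Z.
Hypothesis Z_id : identically_distributed P Z.

Lemma ge0_integral_iid (f : T -> \bar R) i : measurable_fun setT f ->
  (forall t, 0 <= f t) -> \int[P]_w f (Z i w) = \int[P]_w f (Z 0 w).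
Proof.
move=> mf f0.
pose pack j : {mfun Omega >-> T} :=
  HB.pack (Z j) (isMeasurableFun.Build _ _ _ _ _ (mZ j)).
transitivity (\int[pushforward P (pack i)]_t f t).
  by rewrite (ge0_integral_pushforward (mZ i)).
transitivity (\int[pushforward P (pack 0%N)]_t f t).
  by apply: eq_measure_integral => A mA _; exact: Z_id.
by rewrite (ge0_integral_pushforward (mZ 0%N)).
Qed.

(** Markov's inequality for the exponential of an i.i.d. sum, whose
    expectation factors by independence. *)
Lemma exponential_markov (e : T -> R) (c t : R) n : measurable_fun setT e ->
  \int[P]_w (expR (e (Z 0 w)))%:E <= (expR c)%:E ->
  P [set w | (t < \sum_(i < n) e (Z i w))%R] <= (expR (n%:R * c - t))%:E.
Proof.
move=> me hc.
have mee : measurable_fun setT (fun t => expR (e t)).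
  by apply: measurableT_comp me; exact: measurable_expR.
have mS : measurable_fun setT (fun w => (\sum_(i < n) e (Z i w))%R).
  by apply: measurable_sum => i; exact: measurableT_comp.
have mA : measurable [set w | (t < \sum_(i < n) e (Z i w))%R].
  rewrite (_ : [set _ | _] = (fun w => (\sum_(i < n) e (Z i w))%R) @^-1` `]t, +oo[).
    by rewrite -[X in measurable X]setTI; exact: mS.
  by apply/seteqP; split => w /=; rewrite in_itv/= andbT.
rewrite -[P _]mul1e -(setIT [set w | _]) -integral_indic// mul1e.
apply: (@le_trans _ _ (\int[P]_w ((expR (- t))%:E *
    (\prod_(i < n) expR (e (Z i w)))%:E))).
  apply: ge0_le_integral => //.
  - by apply/measurable_EFinP; exact: measurable_indic.
  - apply/measurable_EFinP; apply: measurable_funM => //.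
    by apply: measurable_prod => i _; exact: (measurableT_comp mee (mZ i)).
  - move=> w _; rewrite -EFinM lee_fin indicE.
    rewrite -expR_sum -expRD; case: (boolP (w \in _)) => [|_].
      rewrite inE /= => h; rewrite -expR0 ler_expR; lra.
    by rewrite expR_ge0.
rewrite ge0_integralZl//; last 2 first.
- by apply/measurable_EFinP; apply: measurable_prod => i _; exact: (measurableT_comp mee (mZ i)).
- by move=> w _; rewrite lee_fin prodr_ge0// => i _; rewrite expR_ge0.
rewrite (ge0_expectation_prod mZ Z_indep n (fun=> mee)); last first.
  by move=> _ s; rewrite expR_ge0.
have pe : \prod_(i < n) \int[P]_w (expR (e (Z i w)))%:E <= (expR (n%:R * c))%:E.
  elim: n {mS mA} => [|n IH]; first by rewrite big_ord0 mul0r expR0.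
  rewrite big_ord_recr/= -natr1 mulrDl mul1r expRD EFinM lee_pmul//.
  - by apply: prode_ge0 => i _; apply: integral_ge0 => w _; rewrite lee_fin expR_ge0.
  - by apply: integral_ge0 => w _; rewrite lee_fin expR_ge0.
  - rewrite (ge0_integral_iid n (f := fun s => (expR (e s))%:E))//.
      exact/measurable_EFinP.
by rewrite (addrC (n%:R * c)%R) expRD EFinM lee_wpmul2l// lee_fin expR_ge0.
Qed.

(** The bound [expR x <= 1 + 2 * x] on [[0, 1/2]] applied to [u / (2 * b)]. *)
Lemma chernoff_bounded (u : T -> R) (b v A : R) n : measurable_fun setT u ->
  (0 < b)%R -> (forall t, (0 <= u t <= b)%R) ->
  \int[P]_w (u (Z 0 w))%:E <= v%:E ->
  P [set w | (A < \sum_(i < n) u (Z i w))%R] <=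
    (expR (- ((A - 2 * n%:R * v) / (2 * b))))%:E.
Proof.
move=> mu b0 ub hv.
pose l := (2 * b)^-1%R; have l0 : (0 < l)%R by rewrite invr_gt0 mulr_gt0.
have muZ : measurable_fun setT (fun w => u (Z 0 w)) by exact: measurableT_comp.
have lb : (l * b = 2^-1)%R by rewrite /l invfM -mulrA mulVf ?gt_eqF// mulr1.
have -> : [set w | (A < \sum_(i < n) u (Z i w))%R] =
    [set w | (l * A < \sum_(i < n) (l * u (Z i w)))%R].
  by apply/seteqP; split => w /=; rewrite -mulr_sumr ltr_pM2l.
apply: (le_trans (exponential_markov (e := fun t => (l * u t)%R) (c := (2 * l * v)%R) _ _ _ _)).
- exact: measurable_funM.
- apply: (@le_trans _ _ (\int[P]_w (1 + (2 * l)%:E * (u (Z 0 w))%:E))).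
    apply: ge0_le_integral => //.
    + by apply/measurable_EFinP/measurableT_comp => //; apply: measurable_funM.
    + by apply/measurable_EFinP/measurable_funD => //; apply: measurable_funM.
    + move=> w _; have /andP[u0 ub'] := ub (Z 0 w).
      rewrite -EFinM -EFinD lee_fin -mulrA; apply: expR_le_linear.
      by rewrite mulr_ge0 ?(ltW l0)//= -lb ler_pM2l.
  rewrite ge0_integralD//; last 2 first.
  + move=> w _; have /andP[u0 _] := ub (Z 0 w).
    by rewrite -EFinM lee_fin; nra.
  + by apply/measurable_EFinP; apply: measurable_funM.
  rewrite integral_cst//= mul1e [P _](probability_setT) ge0_integralZl//; last 3 first.
  + exact/measurable_EFinP/measurableT_comp.
  + by move=> w _; rewrite lee_fin; have /andP[] := ub (Z 0 w).
  + by rewrite lee_fin; nra.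
  apply: (@le_trans _ _ (1 + (2 * l)%:E * v%:E)).
    by rewrite leeD2l// lee_wpmul2l// lee_fin; nra.
  by rewrite -EFinM -EFinD lee_fin expR_ge1Dx.
- rewrite lee_fin ler_expR /l -/l.
  have -> : ((A - 2 * n%:R * v) / (2 * b) = l * (A - 2 * n%:R * v))%R by rewrite mulrC.
  nra.
Qed.

End iid_sums.

(** * Random signs and a maximal inequality *)

(** Lists of booleans, [true] standing for the sign [-1], so that inductions
    peel off one sign; [sign_prob] is the uniform probability on them. *)
Fixpoint sign_vectors n : seq bitseq :=
  if n is n'.+1 then map (cons true) (sign_vectors n') ++ map (cons false) (sign_vectors n')
  else [:: [::]].

Section sign_vectors.
Variable R : realType.
Implicit Types (n : nat) (Q : bitseq -> Prop).

Definition signed_sum (s : bitseq) m (a : nat -> R) : R :=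
  \sum_(i < m) (-1) ^+ nth false s i * a i.

Definition sign_prob n Q : R :=
  (2 ^+ n)^-1 * \sum_(s <- sign_vectors n) (`[< Q s >])%:R.

Lemma size_sign_vectors n : size (sign_vectors n) = (2 ^ n)%N.
Proof.
by elim: n => //= n IH; rewrite size_cat !size_map IH expnS mul2n addnn.
Qed.

Lemma sign_prob_le1 n Q : sign_prob n Q <= 1.
Proof.
rewrite /sign_prob mulrC ler_pdivrMr ?exprn_gt0// mul1r.
apply: (@le_trans _ _ (\sum_(s <- sign_vectors n) 1)).
  by apply: ler_sum => s _; case: asbool.
by rewrite big_const_seq count_predT size_sign_vectors iter_addr addr0 natrX.
Qed.

Lemma le_sign_prob n Q Q' : (forall s, Q s -> Q' s) -> sign_prob n Q <= sign_prob n Q'.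
Proof.
move=> QQ'; rewrite ler_pM2l ?invr_gt0 ?exprn_gt0//; apply: ler_sum => s _.
case: (asboolP (Q s)) => [q|_]; last by rewrite ler0n.
by rewrite asboolT//; exact: QQ'.
Qed.

Lemma sign_prob_or n Q Q' :
  sign_prob n (fun s => Q s \/ Q' s) <= sign_prob n Q + sign_prob n Q'.
Proof.
rewrite -mulrDr ler_pM2l ?invr_gt0 ?exprn_gt0// -big_split/=.
apply: ler_sum => s _; case: asboolP => [[q|q]|_]; rewrite ?(asboolT q).
- by rewrite lerDl.
- by rewrite lerDr.
- by rewrite addr_ge0.
Qed.

Lemma sign_prob_false n Q : (forall s, ~ Q s) -> sign_prob n Q = 0.
Proof.
by move=> Qn; rewrite /sign_prob big1 ?mulr0// => s _; rewrite asboolF.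
Qed.

Lemma sign_prob_has n (I : eqType) (l : seq I) (Q : I -> bitseq -> Prop) p :
  (forall u, sign_prob n (Q u) <= p) ->
  sign_prob n (fun s => exists2 u, u \in l & Q u s) <= (size l)%:R * p.
Proof.
move=> hp; elim: l => [|u l IH] /=.
  by rewrite mul0r sign_prob_false// => s [].
rewrite -natr1 mulrDl mul1r addrC.
apply: le_trans (lerD (hp u) IH).
apply: le_trans (sign_prob_or _ _ _); apply: le_sign_prob => s [u'].
by rewrite inE => /orP[/eqP ->|u'l] q; [left|right; exists u'].
Qed.

Lemma sign_prob0 Q : sign_prob 0 Q = (`[< Q [::] >])%:R.
Proof. by rewrite /sign_prob/= big_seq1 expr0 invr1 mul1r. Qed.

Lemma sign_probS n Q : sign_prob n.+1 Q =
  (sign_prob n (fun s => Q (true :: s)) + sign_prob n (fun s => Q (false :: s))) / 2.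
Proof.
rewrite /sign_prob/= big_cat/= !big_map exprS invfM.
by rewrite -mulrDr [RHS]mulrC mulrA.
Qed.

Lemma signed_sum_cons b s m a : signed_sum (b :: s) m.+1 a =
  (-1) ^+ b * a 0%N + signed_sum s m (fun i => a i.+1).
Proof. by rewrite /signed_sum big_ord_recl. Qed.

Lemma signed_sumB s m (a a' : nat -> R) :
  signed_sum s m (fun i => a i - a' i) = signed_sum s m a - signed_sum s m a'.
Proof. by rewrite -sumrB; apply: eq_bigr => i _; rewrite mulrBr. Qed.

Lemma signed_sumN s m (a : nat -> R) :
  signed_sum s m (fun i => - a i) = - signed_sum s m a.
Proof. by rewrite -sumrN; apply: eq_bigr => i _; rewrite mulrN. Qed.

(** Reaching the level [t] is decided by the first sign and the remaining
    walk, so the bound propagates by induction to all [m] at once, [cosh]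
    accounting for one sign. *)
Lemma maximal_exponential_bound n (a : nat -> R) (t l : R) : 0 <= l ->
  sign_prob n (fun s => exists2 m, (m <= n)%N & t <= signed_sum s m a) <=
  expR (2 * l ^+ 2 * (\sum_(i < n) a i ^+ 2) - l * t).
Proof.
move=> l0; elim: n a t => [|n IH] a t.
  rewrite big_ord0 mulr0 add0r sign_prob0.
  have [t0|t0] := leP t 0.
    apply: (@le_trans _ _ 1); first by case: asbool.
    by rewrite -[leLHS]expR0 ler_expR; nra.
  rewrite asboolF ?expR_ge0// => -[m]; rewrite leqn0 => /eqP ->.
  by rewrite /signed_sum big_ord0; lra.
have [t0|t0] := leP t 0.
  apply: (le_trans (sign_prob_le1 _ _)); rewrite -[leLHS]expR0 ler_expR.
  have : 0 <= 2 * l ^+ 2 * \sum_(i < n.+1) a i ^+ 2.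
    by rewrite mulr_ge0 ?mulr_ge0 ?sqr_ge0// sumr_ge0// => i _; exact: sqr_ge0.
  have : l * t <= 0 by rewrite mulr_ge0_le0.
  move=> lt V0; rewrite subr_ge0; exact: le_trans V0.
rewrite sign_probS.
have step b : sign_prob n (fun s => exists2 m, (m <= n.+1)%N &
      t <= signed_sum (b :: s) m a) <=
    expR (2 * l ^+ 2 * (\sum_(i < n) a i.+1 ^+ 2) - l * (t - (-1) ^+ b * a 0%N)).
  apply: le_trans (IH (fun i => a i.+1) (t - (-1) ^+ b * a 0%N)).
  apply: le_sign_prob => s [[|m] mn]; first by rewrite /signed_sum big_ord0; lra.
  by rewrite signed_sum_cons => h; exists m; rewrite ?lerBlDl.
rewrite big_ord_recl.
set V := \sum_(i < n) _.
have st := step true; have sf := step false.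
rewrite /= expr1 mulN1r in st; rewrite /= expr0 mul1r in sf.
have -> : 2 * l ^+ 2 * (a 0%N ^+ 2 + V) - l * t =
  2 * (l * a 0%N) ^+ 2 + (2 * l ^+ 2 * V - l * t) by ring.
rewrite expRD.
apply: (@le_trans _ _ ((expR (l * a 0%N) + expR (- (l * a 0%N))) / 2 *
  expR (2 * l ^+ 2 * V - l * t))); last first.
  by rewrite ler_pM2r ?expR_gt0// cosh_le_expR.
rewrite mulrAC ler_pM2r ?invr_gt0// mulrDl -!expRD addrC.
apply: lerD.
- apply: (le_trans sf); rewrite ler_expR /V; lra.
- apply: (le_trans st); rewrite ler_expR /V; lra.
Qed.

Lemma maximal_hoeffding n (a : nat -> R) (t delta : R) : 0 < delta -> 0 <= t ->
  \sum_(i < n) a i ^+ 2 <= delta ^+ 2 ->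
  sign_prob n (fun s => exists2 m, (m <= n)%N & t < `|signed_sum s m a|) <=
  2 * expR (- (t ^+ 2 / (8 * delta ^+ 2))).
Proof.
move=> d0 t0 ad; have d20 : 0 < delta ^+ 2 by rewrite exprn_gt0.
have key (a' : nat -> R) : \sum_(i < n) a' i ^+ 2 <= delta ^+ 2 ->
    sign_prob n (fun s => exists2 m, (m <= n)%N & t <= signed_sum s m a') <=
    expR (- (t ^+ 2 / (8 * delta ^+ 2))).
  move=> ad'.
  (* This [l] minimizes the exponent of the exponential bound. *)
  pose l := t / (4 * delta ^+ 2).
  have l0 : 0 <= l by rewrite divr_ge0// mulr_ge0// ltW.
  apply: (le_trans (maximal_exponential_bound n a' t l0)); rewrite ler_expR.
  apply: (@le_trans _ _ (2 * l ^+ 2 * delta ^+ 2 - l * t)).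
    by rewrite lerB// ler_wpM2l// mulr_ge0// sqr_ge0.
  rewrite le_eqVlt; apply/orP; left; apply/eqP; rewrite /l; field.
  by rewrite gt_eqF.
rewrite mulr_natl mulr2n.
apply: le_trans (lerD (key a ad) (key (fun i => - a i) _)); last first.
  by under eq_bigr do rewrite sqrrN.
apply: le_trans (sign_prob_or _ _ _); apply: le_sign_prob => s [m mn].
rewrite real_ltr_normr ?num_real// => /orP[h|h]; [left|right]; exists m => //; first exact: ltW.
by rewrite signed_sumN ltW.
Qed.

End sign_vectors.

(** * Chaining for signed sums *)

Section chaining.
Variables (R : realType) (I : eqType) (n : nat) (v : I -> nat -> R).
Variables (cov : nat -> seq I) (delta s p : R).
Hypotheses (delta_gt0 : 0 < delta) (s_gt0 : 0 < s) (p_ge0 : 0 <= p).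
Hypothesis v_bound : forall q, \sum_(i < n) v q i ^+ 2 <= delta ^+ 2.
Hypothesis cov_net : forall k q, exists2 u, u \in cov k &
  \sum_(i < n) (v q i - v u i) ^+ 2 <= (delta / 2 ^+ k.+1) ^+ 2.
Hypothesis cov_size : forall k,
  2 * (size (cov k))%:R * expR (- (s ^+ 2 / 8 * k.+1%:R)) <= p / 2 ^+ k.+1.

Let exceeds t q sigma := exists2 m, (m <= n)%N & t < `|signed_sum sigma m (v q)|.

(** The squared threshold [(9/16) ^ k] of a link, divided by its squared length
    [(1/4) ^ k], has to grow as fast as the logarithm of the size of the net. *)
Lemma ler_Sn_expr94 k : k.+1%:R <= (9 / 4) ^+ k :> R.
Proof.
elim: k => [|k IH]; first by rewrite expr0.
rewrite exprS; have k0 : 0 <= k%:R :> R by [].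
by rewrite -[k.+2%:R]natr1; rewrite -natr1 in IH *; lra.
Qed.

(** Every point of a net is linked to a close point of the preceding net. A
    union bound over the links of one level costs at most [p / 2 ^ k.+1],
    while the thresholds still have a finite sum. *)
Lemma chain_prob K :
  sign_prob R n (fun sigma => exists2 u, u \in cov K &
    exceeds (s * delta * \sum_(k < K.+1) (3 / 4) ^+ k) u sigma) <=
  p * \sum_(k < K.+1) (2 ^+ k.+1)^-1.
Proof.
elim: K => [|K IH].
  rewrite !big_ord1 expr0 mulr1.
  apply: le_trans (cov_size 0%N); rewrite mulr1.
  rewrite [leRHS](_ : _ = (size (cov 0%N))%:R * (2 * expR (- (s ^+ 2 / 8)))); last by ring.
  apply: (@sign_prob_has R n I (cov 0%N) (exceeds (s * delta))) => u.
  apply: (le_trans (maximal_hoeffding delta_gt0 _ (v_bound u))).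
    by rewrite mulr_ge0// ltW.
  rewrite ler_pM2l// ler_expR lerN2 le_eqVlt; apply/orP; left; apply/eqP; field.
  by rewrite gt_eqF.
rewrite big_ord_recr/= [in leRHS]big_ord_recr/= !mulrDr.
set t := s * delta * \sum_(k < K.+1) _.
set e := s * delta * (3 / 4) ^+ K.+1.
pose link u u' sigma := exists2 m, (m <= n)%N &
  e < `|signed_sum sigma m (fun i => v u i - v u' i)|.
have [par par_cov par_net] : exists2 par : I -> I, (forall u, par u \in cov K) &
    forall u, \sum_(i < n) (v u i - v (par u) i) ^+ 2 <= (delta / 2 ^+ K.+1) ^+ 2.
  have ex u : exists u', u' \in cov K /\
      \sum_(i < n) (v u i - v u' i) ^+ 2 <= (delta / 2 ^+ K.+1) ^+ 2.
    by have [u' ? ?] := cov_net K u; exists u'.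
  by have [par parP] := choice ex; exists par => u; have [] := parP u.
apply: (@le_trans _ _ (sign_prob R n (fun sigma => exists2 u, u \in cov K &
    exceeds t u sigma) + sign_prob R n (fun sigma => exists2 u, u \in cov K.+1 &
    link u (par u) sigma))).
  apply: le_trans (sign_prob_or _ _ _ _); apply: le_sign_prob => sigma.
  move=> [u uK [m mn h]].
  have [|hle] := ltP t `|signed_sum sigma m (v (par u))|.
    by move=> ht; left; exists (par u) => //; exists m.
  right; exists u => //; exists m => //.
  rewrite signed_sumB.
  have := ler_normD (signed_sum sigma m (v u) - signed_sum sigma m (v (par u)))
    (signed_sum sigma m (v (par u))).
  by rewrite subrK => h2; lra.
apply: lerD => //.
apply: le_trans (cov_size K.+1).
rewrite [leRHS](_ : _ = (size (cov K.+1))%:R *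
  (2 * expR (- (s ^+ 2 / 8 * K.+2%:R)))); last by ring.
apply: (@sign_prob_has R n I (cov K.+1) (fun u => link u (par u))) => u.
have e0 : 0 <= e by rewrite mulr_ge0 ?mulr_ge0 ?exprn_ge0 ?(ltW s_gt0) ?(ltW delta_gt0)// divr_ge0.
apply: (le_trans (maximal_hoeffding _ e0 (par_net u))).
  by rewrite divr_gt0// exprn_gt0.
rewrite ler_pM2l// ler_expR lerN2.
have -> : e ^+ 2 / (8 * (delta / 2 ^+ K.+1) ^+ 2) =
    s ^+ 2 / 8 * (9 / 4) ^+ K.+1.
  have -> : (9 / 4 : R) ^+ K.+1 = ((3 / 4) ^+ K.+1 * 2 ^+ K.+1) ^+ 2.
    by rewrite -exprMn -exprM mulnC exprM; congr (_ ^+ _); field.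
  have : (2 : R) ^+ K.+1 != 0 by rewrite expf_neq0.
  rewrite /e; move: ((2 : R) ^+ K.+1) ((3 / 4 : R) ^+ K.+1) => x y x0; field.
  by rewrite x0 gt_eqF.
by rewrite ler_wpM2l ?divr_ge0 ?sqr_ge0// ler_Sn_expr94.
Qed.

Lemma sum_geometric34 K : \sum_(k < K) (3 / 4) ^+ k <= 4 :> R.
Proof.
have -> : \sum_(k < K) (3 / 4) ^+ k = 4 - 4 * (3 / 4) ^+ K :> R.
  elim: K => [|K IH]; first by rewrite big_ord0 expr0; ring.
  by rewrite big_ord_recr/= IH exprS; field.
by rewrite gerBl mulr_ge0// exprn_ge0// divr_ge0.
Qed.

Lemma sum_geometric_half K : \sum_(k < K) (2 ^+ k.+1)^-1 <= 1 :> R.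
Proof.
have -> : \sum_(k < K) (2 ^+ k.+1)^-1 = 1 - (2 ^+ K)^-1 :> R.
  elim: K => [|K IH]; first by rewrite big_ord0 expr0; field.
  by rewrite big_ord_recr/= IH exprS; field; rewrite expf_neq0.
by rewrite gerBl invr_ge0 exprn_ge0.
Qed.

(** From some level on the vectors are so close to the net that even the sum
    of the absolute values of all their increments is below [s * delta]. *)
Lemma chaining : sign_prob R n (fun sigma => exists q, exists2 m, (m <= n)%N &
  5 * s * delta < `|signed_sum sigma m (v q)|) <= p.
Proof.
pose K := Num.truncn (n%:R / s).
have nK : n%:R / 2 ^+ K.+1 <= s.
  rewrite ler_pdivrMr ?exprn_gt0// mulrC -ler_pdivrMr//.
  have := real_truncnS_gt (num_real (n%:R / s)) => /ltW /le_trans; apply.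
  rewrite -natrX ler_nat -/K; exact/ltnW/ltn_expl.
apply: (@le_trans _ _ (p * \sum_(k < K.+1) (2 ^+ k.+1)^-1)); last first.
  by rewrite -[leRHS]mulr1 ler_wpM2l// sum_geometric_half.
apply: le_trans (chain_prob K); apply: le_sign_prob => sigma [q [m mn h]].
have [u uK hu] := cov_net K q; exists u => //; exists m => //.
have small : `|signed_sum sigma m (fun i => v q i - v u i)| <= s * delta.
  apply: (@le_trans _ _ (\sum_(i < m) delta / 2 ^+ K.+1)); last first.
    rewrite big_const_ord iter_addr addr0 -[leLHS]mulr_natr.
    rewrite mulrAC -mulrA mulrC ler_pM2r//; apply: le_trans nK.
    by rewrite ler_pM2r ?invr_gt0 ?exprn_gt0// ler_nat.
  apply: (le_trans (ler_norm_sum _ _ _)); apply: ler_sum => i _.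
  rewrite normrM normrX normrN1 expr1n mul1r.
  have D0 : 0 <= delta / 2 ^+ K.+1 by rewrite divr_ge0 ?exprn_ge0// ltW.
  rewrite -(ler_pXn2r (n := 2))// ?nnegrE// real_normK ?num_real//.
  apply: le_trans hu.
  have im : (i < n)%N by exact: leq_trans mn.
  rewrite (bigD1 (Ordinal im))//= lerDl sumr_ge0// => j _; exact: sqr_ge0.
have h1 : s * delta * \sum_(k < K.+1) (3 / 4) ^+ k <= 4 * (s * delta).
  by rewrite mulrC ler_wpM2r ?mulr_ge0 ?(ltW s_gt0) ?(ltW delta_gt0)// sum_geometric34.
rewrite signed_sumB in small.
have := ler_normD (signed_sum sigma m (v q) - signed_sum sigma m (v u)) (signed_sum sigma m (v u)).
rewrite subrK => h2.
rewrite -mulrA in h; lra.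
Qed.

End chaining.

(** * Symmetrization by a ghost sample *)

Lemma measurable_exists_lt (R : realType) d (T : measurableType d) (J : countType)
    (D : J -> Prop) (f : J -> T -> R) (t : R) :
  (forall j, measurable_fun setT (f j)) ->
  measurable [set w | exists2 j, D j & t < f j w].
Proof.
move=> mf.
have -> : [set w | exists2 j, D j & t < f j w] =
    \bigcup_j (if pselect (D j) then f j @^-1` `]t, +oo[ else set0).
  apply/seteqP; split => w /= [j].
    by move=> Dj h; exists j => //; case: pselect => //= _; rewrite in_itv/= h.
  by move=> _; case: pselect => //= Dj; rewrite in_itv/= andbT => h; exists j.
apply: countable_bigcupT_measurable => [|j]; first exact: countableP.
case: (pselect (D j)) => Dj; last exact: measurable0.
by rewrite -[X in measurable X]setTI; exact: mf.
Qed.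

Section symmetrization.
Local Open Scope ereal_scope.
Context (R : realType) dO (Omega : measurableType dO) (P : probability Omega R).

(** Fix the first sample and an index that violates the bound there: an
    independent copy stays below [t / 2] at that index with probability at
    least [1 / 2], so the difference of the two exceeds [t / 2]. *)
Lemma symmetrization (J : countType) (D : J -> Prop) (X : J -> Omega -> R) (t : R) :
  (forall j, measurable_fun setT (X j)) ->
  (forall j, D j -> P [set w | (t / 2 < `|X j w|)%R] <= (2^-1)%:E) ->
  P [set w | exists2 j, D j & (t < `|X j w|)%R] <=
  2%:E * (P \x P) [set z | exists2 j, D j & (t / 2 < `|X j z.1 - X j z.2|)%R].
Proof.
move=> mX small.
set U := [set w | _]; set E := [set z | _].
have mN j : measurable_fun setT (fun w => `|X j w|%R).
  by apply: measurableT_comp (mX j); exact: normr_measurable.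
have mU : measurable U by exact: measurable_exists_lt.
have mE : measurable E.
  apply: (@measurable_exists_lt R _ (Omega * Omega)%type J D
    (fun j (z : Omega * Omega) => `|X j z.1 - X j z.2|%R)) => j.
  apply: measurableT_comp; first exact: normr_measurable.
  by apply: measurable_funB; apply: measurableT_comp => //.
rewrite [X in _ * X]/product_measure1 -ge0_integralZl//; last first.
  exact: measurable_fun_xsection.
rewrite -[P U]mul1e -(setIT U) -integral_indic// mul1e.
apply: ge0_le_integral => //.
- by apply/measurable_EFinP; exact: measurable_indic.
- by apply: measurable_funeM; exact: measurable_fun_xsection.
move=> w _; rewrite indicE; case: (boolP (w \in U)) => [|_]; last by rewrite mule_ge0.
rewrite inE => -[j Dj tj] /=.
pose B := [set w' | (t / 2 < `|X j w'|)%R].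
have mB : measurable B.
  have -> : B = (fun w => `|X j w|%R) @^-1` `](t / 2)%R, +oo[.
    by apply/seteqP; split => w' /=; rewrite in_itv/= andbT.
  by rewrite -[X in measurable X]setTI; exact: mN.
have BE : ~` B `<=` xsection E w.
  move=> w' /negP; rewrite -leNgt => hB; apply/xsectionP; exists j => //=.
  have := ler_normD (X j w - X j w')%R (X j w'); rewrite subrK => h.
  lra.
have : P (~` B) <= P (xsection E w).
  apply: le_measure => //; rewrite inE; first exact: measurableC.
  exact: measurable_xsection.
rewrite probability_setC// => h.
apply: (@le_trans _ _ (2%:E * (1 - P B))); last by rewrite lee_pmul2l.
have := small j Dj; rewrite -/B.
have : P B \is a fin_num by rewrite fin_num_measure.
move=> /fineK <-; rewrite -EFinB -EFinM !lee_fin; lra.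
Qed.

End symmetrization.

Section sample_swap.
Local Open Scope ereal_scope.
Context (R : realType) dO dT (Omega : measurableType dO) (T : measurableType dT).
Variables (P : probability Omega R) (Z : nat -> Omega -> T).
Hypothesis mZ : forall i, measurable_fun setT (Z i).
Hypothesis Z_indep : mutually_independent P Z.

(** The sample followed by its ghost copy, the two [i]-th observations being
    exchanged when the [i]-th sign is [true]. *)
Definition swapped_sample n (s : bitseq) (z : Omega * Omega) : (n + n).-tuple T :=
  [tuple match fintype.split i with
         | inl j => if nth false s j then Z j z.2 else Z j z.1
         | inr j => if nth false s j then Z j z.1 else Z j z.2
         end | i < n + n].

Lemma measurable_swapped_sample n s : measurable_fun setT (@swapped_sample n s).
Proof.
apply/measurable_fun_tnthP => i.
pose f (z : Omega * Omega) := match fintype.split i with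
         | inl j => if nth false s j then Z j z.2 else Z j z.1
         | inr j => if nth false s j then Z j z.1 else Z j z.2
         end.
apply: (eq_measurable_fun f); first by move=> z _ /=; rewrite tnth_mktuple.
by rewrite /f; case: (fintype.split i) => j; case: (nth false s j); exact: measurableT_comp.
Qed.

Lemma swapped_sample_rect n s (A : 'I_(n + n) -> set T) :
  (forall i, measurable (A i)) ->
  (P \x P) [set z | forall i, A i (tnth (swapped_sample n s z) i)] =
  \prod_(j < n) (P (Z j @^-1` A (lshift n j)) * P (Z j @^-1` A (rshift n j))).
Proof.
move=> mA.
pose B1 k := if insub k is Some j then
  (if nth false s k then A (rshift n j) else A (lshift n j)) else setT.
pose B2 k := if insub k is Some j then
  (if nth false s k then A (lshift n j) else A (rshift n j)) else setT.
have mB1 k : measurable (B1 k) by rewrite /B1; case: insubP => // ? _ _; case: ifP.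
have mB2 k : measurable (B2 k) by rewrite /B2; case: insubP => // ? _ _; case: ifP.
have B1E (j : 'I_n) : B1 j = if nth false s j then A (rshift n j) else A (lshift n j).
  by rewrite /B1 valK.
have B2E (j : 'I_n) : B2 j = if nth false s j then A (lshift n j) else A (rshift n j).
  by rewrite /B2 valK.
have -> : [set z | forall i, A i (tnth (swapped_sample n s z) i)] =
    [set w | forall i, (i < n)%N -> B1 i (Z i w)] `*`
    [set w | forall i, (i < n)%N -> B2 i (Z i w)].
  apply/seteqP; split => -[w w'] /=.
    move=> h; split => i ni.
      rewrite (B1E (Ordinal ni))/=.
      have := h (lshift n (Ordinal ni)); have := h (rshift n (Ordinal ni)).
      by rewrite !tnth_mktuple (unsplitK (inl _)) (unsplitK (inr _))/=; case: ifP.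
    rewrite (B2E (Ordinal ni))/=.
    have := h (lshift n (Ordinal ni)); have := h (rshift n (Ordinal ni)).
    by rewrite !tnth_mktuple (unsplitK (inl _)) (unsplitK (inr _))/=; case: ifP.
  move=> [h1 h2] i; rewrite -(splitK i); case: (fintype.split i) => j.
    rewrite tnth_mktuple unsplitK/=; have := h1 _ (ltn_ord j); have := h2 _ (ltn_ord j).
    by rewrite B1E B2E; case: ifP.
  rewrite tnth_mktuple unsplitK/=; have := h1 _ (ltn_ord j); have := h2 _ (ltn_ord j).
  by rewrite B1E B2E; case: ifP.
rewrite product_measure1E; [|exact: measurable_sample_rect..].
rewrite [X in X * _](indep_rect Z_indep n mB1) [X in _ * X](indep_rect Z_indep n mB2).
rewrite -big_split/=; apply: eq_bigr => j _.
by rewrite B1E B2E; case: ifP => // _; rewrite muleC.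
Qed.

(** By exchangeability every sign vector gives the swapped event the same
    probability; averaging over the signs inside the integral leaves a
    purely combinatorial probability. *)
Lemma sign_averaging n (B : set ((n + n).-tuple T)) (p : R) : measurable B ->
  (forall z, sign_prob R n (fun s => B (swapped_sample n s z)) <= p)%R ->
  (P \x P) (swapped_sample n [::] @^-1` B) <= p%:E.
Proof.
move=> mB hp.
pose E s := swapped_sample n s @^-1` B.
have mE s : measurable (E s).
  by rewrite -[X in measurable X]setTI; apply: measurable_swapped_sample.
have PPT : (P \x P) setT = 1.
  by rewrite -setXTT product_measure1E// -[RHS]mule1; congr (_ * _); exact: probability_setT.
have PPlt : (P \x P) setT < +oo by rewrite PPT ltry.
have PPfin s : (P \x P) (E s) \is a fin_num.
  rewrite ge0_fin_numE//; apply: (@le_lt_trans _ _ ((P \x P) setT)).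
    by apply: le_measure; rewrite ?inE.
  by rewrite PPT ltry.
have EE s : (P \x P) (E s) = (P \x P) (E [::]).
  apply: eq_law_tuple => //.
  - exact: measurable_swapped_sample.
  - exact: measurable_swapped_sample.
  - by move=> A mA; etransitivity; [exact: swapped_sample_rect|exact/esym/swapped_sample_rect].
pose x := fine ((P \x P) (E [::])).
have xE : (P \x P) (E [::]) = x%:E by rewrite fineK.
rewrite -/(E [::]) xE lee_fin.
have : \sum_(s <- sign_vectors n) (P \x P) (E s) <= (2 ^+ n * p)%:E.
  have -> : \sum_(s <- sign_vectors n) (P \x P) (E s) =
      \int[P \x P]_z (\sum_(s <- sign_vectors n) (\1_(E s) z)%:E).
    rewrite ge0_integral_sum//.
      apply: eq_bigr => s _; rewrite integral_indic// setIT//.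
    by move=> s; apply/measurable_EFinP; exact: measurable_indic.
  apply: (@le_trans _ _ (\int[P \x P]_z (cst (2 ^+ n * p)%:E z))); last first.
    by rewrite integral_cst// [X in _ * X]PPT mule1.
  apply: ge0_le_integral => //.
  - by move=> z _; apply: sume_ge0 => s _; rewrite lee_fin.
  - apply: emeasurable_sum => s; apply/measurable_EFinP; exact: measurable_indic.
  move=> z _; rewrite sumEFin lee_fin.
  by have := hp z; rewrite /sign_prob ler_pdivrMl ?exprn_gt0.
under eq_bigr do rewrite EE xE.
rewrite sumEFin lee_fin big_const_seq count_predT size_sign_vectors iter_addr addr0.
by rewrite -[leLHS]mulr_natl natrX ler_pM2l// exprn_gt0.
Qed.

End sample_swap.

(** * Tails of centered sums *)

(** Entropy over finite point sets, relative to the envelope. The centers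
    belong to the class, so that consecutive nets can be linked into chains. *)
Definition discrete_entropy (R : realType) (I : eqType) (T : Type)
    (g : I -> T -> R) (G : T -> R) (C nu : R) : Prop :=
  forall N (t : nat -> T) (eps : R), 0 < eps < 1 ->
    exists2 l : seq I, (size l)%:R <= C * eps `^ (- nu) &
      forall q, exists2 u, u \in l &
        \sum_(i < N) (g q (t i) - g u (t i)) ^+ 2 <=
        eps ^+ 2 * \sum_(i < N) G (t i) ^+ 2.

Section bounded_integrals.
Local Open Scope ereal_scope.
Context (R : realType) d (T : measurableType d) (P : probability T R).

Lemma bounded_integrable (f : T -> R) (b : R) : measurable_fun setT f ->
  (forall t, (`|f t| <= b)%R) -> P.-integrable setT (EFin \o f).
Proof.
move=> mf fb; apply: measurable_bounded_integrable => //.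
  by rewrite (le_lt_trans (probability_le1 _ _))// ltry.
exists b; split; first exact: num_real.
by move=> M bM t _; exact: le_trans (fb t) (ltW bM).
Qed.

Lemma bounded_integral (f : T -> R) (b : R) : measurable_fun setT f ->
  (forall t, (`|f t| <= b)%R) ->
  exists2 mu, (`|mu| <= b)%R & \int[P]_t (f t)%:E = mu%:E.
Proof.
move=> mf fb; have fi := bounded_integrable mf fb.
have fin := integrable_fin_num measurableT fi.
exists (fine (\int[P]_t (f t)%:E)); last by rewrite fineK.
rewrite -lee_fin -abse_EFin fineK//.
apply: (le_trans (le_abse_integral _ _ _)) => //; first exact/measurable_EFinP.
apply: (@le_trans _ _ (\int[P]_t cst b%:E t)).
  apply: ge0_le_integral => //.
  - by apply: measurableT_comp => //; exact/measurable_EFinP.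
  - by move=> t _; rewrite lee_fin.
by rewrite integral_cst// [X in _ * X]probability_setT mule1.
Qed.

(** The condition on [l] keeps [l * (f - mu)] below [1/2], where the exponential
    is at most quadratic; the linear term integrates to zero and the variance
    is at most the second moment. *)
Lemma centered_mgf (f : T -> R) (b v l mu : R) : measurable_fun setT f ->
  (forall t, (`|f t| <= b)%R) -> \int[P]_t (f t ^+ 2)%:E <= v%:E ->
  \int[P]_t (f t)%:E = mu%:E -> (4 * b * `|l| <= 1)%R ->
  \int[P]_t (expR (l * (f t - mu)))%:E <= (expR (2 * l ^+ 2 * v))%:E.
Proof.
move=> mf fb fv fmu bl.
have mub : (`|mu| <= b)%R.
  by have [mu' hb] := bounded_integral mf fb; rewrite fmu => -[->].
have mf2 : measurable_fun setT (fun t => f t ^+ 2)%R by exact: measurable_funX.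
have b0 : (0 <= b)%R by exact: le_trans mub.
have fb2 t : (`|f t ^+ 2| <= b ^+ 2)%R.
  by rewrite normrX lerXn2r// ?nnegrE.
have [q _ fq] := bounded_integral mf2 fb2.
have fi := bounded_integrable mf fb; have f2i := bounded_integrable mf2 fb2.
pose c0 := (1 - l * mu + 2 * l ^+ 2 * mu ^+ 2)%R.
pose c1 := (l - 4 * l ^+ 2 * mu)%R.
apply: (@le_trans _ _ (\int[P]_t ((c0%:E + c1%:E * (f t)%:E) +
    (2 * l ^+ 2)%:E * (f t ^+ 2)%:E))).
  apply: ge0_le_integral => //.
  - apply/measurable_EFinP; apply: measurableT_comp; first exact: measurable_expR.
    by apply: measurable_funM => //; apply: measurable_funB.
  - apply/measurable_EFinP; apply: measurable_funD; last exact: measurable_funM.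
    by apply: measurable_funD => //; apply: measurable_funM.
  move=> t _; rewrite -!EFinM -!EFinD lee_fin.
  apply: (le_trans (expR_le_quadratic _)).
    apply: (le_trans (ler_norm _)); rewrite normrM.
    have h : (`|f t - mu| <= 2 * b)%R.
      by have := ler_normB (f t) mu; have := fb t; lra.
    have := ler_wpM2l (normr_ge0 l) h; lra.
  by rewrite le_eqVlt; apply/orP; left; apply/eqP; rewrite /c0 /c1; ring.
have ci := finite_measure_integrable_cst P c0 measurableT.
rewrite integralD//; last 2 first.
- by apply: integrableD => //; exact: integrableZl.
- exact: integrableZl.
rewrite integralD//; last exact: integrableZl.
rewrite !integralZl// fmu fq integral_cst// [X in _ * X]probability_setT mule1.
rewrite -!EFinM -!EFinD lee_fin.
have : (q <= v)%R by rewrite -lee_fin -fq.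
move=> qv; apply: le_trans (expR_ge1Dx _).
have := ler_wpM2l (sqr_ge0 l) qv; have := mulr_ge0 (sqr_ge0 l) (sqr_ge0 mu).
by rewrite /c0 /c1; nra.
Qed.

End bounded_integrals.

Section local_deviation.
Local Open Scope ereal_scope.
Context (R : realType) dO dT (Omega : measurableType dO) (T : measurableType dT).
Variables (P : probability Omega R) (Z : nat -> Omega -> T).
Hypothesis mZ : forall i, measurable_fun setT (Z i).
Hypothesis Z_indep : mutually_independent P Z.
Hypothesis Z_id : identically_distributed P Z.

Lemma centered_tail (f : T -> R) (b v l mu t : R) n : measurable_fun setT f ->
  (forall x, (`|f x| <= b)%R) -> \int[P]_w (f (Z 0 w) ^+ 2)%:E <= v%:E ->
  \int[P]_w (f (Z 0 w))%:E = mu%:E -> (0 <= l)%R -> (4 * b * l <= 1)%R ->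
  P [set w | (t < `|\sum_(i < n) (f (Z i w) - mu)|)%R] <=
  (2 * expR (2 * n%:R * l ^+ 2 * v - l * t))%:E.
Proof.
move=> mf fb fv fmu l0 bl.
have fZ : measurable_fun setT (fun w => f (Z 0 w)) by exact: measurableT_comp.
have side (e : bool) : P [set w | (l * t < \sum_(i < n) ((-1) ^+ e * l * (f (Z i w) - mu)))%R] <=
    (expR (2 * n%:R * l ^+ 2 * v - l * t))%:E.
  apply: (le_trans (exponential_markov mZ Z_indep Z_id
    (e := fun x => ((-1) ^+ e * l * (f x - mu))%R) (c := (2 * l ^+ 2 * v)%R) _ _ _ _)).
  - by apply: measurable_funM => //; exact: measurable_funB.
  - have -> : (2 * l ^+ 2 * v = 2 * ((-1) ^+ e * l) ^+ 2 * v)%R.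
      by rewrite exprMn sqrr_sign mul1r.
    apply: (centered_mgf (b := b)) => //.
    by rewrite normrM normrX normrN1 expr1n mul1r ger0_norm.
  - by rewrite lee_fin ler_expR le_eqVlt; apply/orP; left; apply/eqP; ring.
have mS (e : bool) : measurable_fun setT
    (fun w => (\sum_(i < n) ((-1) ^+ e * l * (f (Z i w) - mu)))%R).
  apply: measurable_sum => i; apply: measurable_funM => //.
  by apply: measurable_funB => //; exact: measurableT_comp.
have mside (e : bool) : measurable
    [set w | (l * t < \sum_(i < n) ((-1) ^+ e * l * (f (Z i w) - mu)))%R].
  rewrite (_ : [set _ | _] = (fun w => (\sum_(i < n) ((-1) ^+ e * l * (f (Z i w) - mu)))%R)
      @^-1` `](l * t)%R, +oo[).
    by rewrite -[X in measurable X]setTI; exact: mS.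
  by apply/seteqP; split => w /=; rewrite in_itv/= andbT.
have [l_eq0|l_neq0] := eqVneq l 0%R.
  apply: (le_trans (probability_le1 _ _)).
    rewrite (_ : [set _ | _] = (fun w => `|\sum_(i < n) (f (Z i w) - mu)|%R)
        @^-1` `]t, +oo[).
      rewrite -[X in measurable X]setTI; apply: measurableT_comp => //.
      apply: measurable_sum => i; apply: measurable_funB => //.
      exact: measurableT_comp.
    by apply/seteqP; split => w /=; rewrite in_itv/= andbT.
  by rewrite lee_fin l_eq0 expr0n/= !(mulr0, mul0r) subr0 expR0; lra.
have l_gt0 : (0 < l)%R by rewrite lt_neqAle eq_sym l_neq0.
rewrite mulr_natl mulr2n EFinD.
apply: le_trans (leeD (side true) (side false)).
apply: le_trans (measureU2 _ _ _) => //.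
apply: le_measure; rewrite ?inE.
- rewrite (_ : [set _ | _] = (fun w => `|\sum_(i < n) (f (Z i w) - mu)|%R)
        @^-1` `]t, +oo[).
    rewrite -[X in measurable X]setTI; apply: measurableT_comp => //.
    apply: measurable_sum => i; apply: measurable_funB => //.
    exact: measurableT_comp.
  by apply/seteqP; split => w /=; rewrite in_itv/= andbT.
- exact: measurableU.
- move=> w /=; rewrite real_ltr_normr ?num_real// => /orP[h|h]; [right|left].
    by rewrite -mulr_sumr expr0 mul1r ltr_pM2l.
  by rewrite -mulr_sumr expr1 mulN1r mulNr -mulrN ltr_pM2l.
Qed.

End local_deviation.

(** * Deviations of a class with a bounded envelope *)

Section entropy_chaining.
Variables (R : realType) (I : eqType) (T : Type) (g : I -> T -> R) (G : T -> R).
Variables (C nu a A : R) (n : nat) (x y : nat -> T).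
Hypotheses (C_ge0 : 0 <= C) (a_gt0 : 0 < a) (A_gt0 : 0 < A).
Hypothesis a_large : 2 * (nu + 1) * ln 2 <= a.
Hypothesis g_le : forall q t, `|g q t| <= G t.
Hypothesis g_entropy : discrete_entropy g G C nu.
Hypothesis G_sum : \sum_(i < n) (G (x i) ^+ 2 + G (y i) ^+ 2) <= A.

Let pts i := if (i < n)%N then x i else y (i - n)%N.

Let sum_pts (f : T -> R) :
  \sum_(i < n + n) f (pts i) = \sum_(i < n) (f (x i) + f (y i)).
Proof.
rewrite big_split_ord/= big_split/=; congr (_ + _); apply: eq_bigr => i _.
  by rewrite /pts ltn_ord.
by rewrite /pts ltnNge leq_addr addKn.
Qed.

Let sqr_diff (u w : R) : (u - w) ^+ 2 <= 2 * (u ^+ 2 + w ^+ 2).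
Proof. by have := sqr_ge0 (u + w); rewrite !expr2; nra. Qed.

(** The two samples together carry squared envelope at most [A], so that the
    differences have length at most [sqrt (2 * A)]; nets at relative precision
    [2 ^ - k.+1] have a size polynomial in [2 ^ k], which the exponent [a] beats
    at every level. *)
Lemma entropy_chaining :
  sign_prob R n (fun s => exists q, exists2 m, (m <= n)%N &
    20 * Num.sqrt (a * A) < `|signed_sum s m (fun i => g q (x i) - g q (y i))|) <=
  2 * C * expR (- (a / 2)).
Proof.
pose delta : R := Num.sqrt (2 * A); pose s : R := Num.sqrt (8 * a).
have delta2 : delta ^+ 2 = 2 * A by rewrite sqr_sqrtr// mulr_ge0// ltW.
have s2 : s ^+ 2 = 8 * a by rewrite sqr_sqrtr// mulr_ge0// ltW.
have -> : 20 * Num.sqrt (a * A) = 5 * s * delta.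
  rewrite -mulrA -sqrtrM ?mulr_ge0 ?(ltW a_gt0)//.
  rewrite (_ : 8 * a * (2 * A) = 4 ^+ 2 * (a * A)); last by ring.
  by rewrite [in RHS]sqrtrM ?sqr_ge0// sqrtr_sqr ger0_norm//; ring.
have eps01 k : 0 < ((2 : R) ^+ k.+1)^-1 < 1.
  by rewrite invr_gt0 exprn_gt0//= invf_lt1 ?exprn_gt0// exprn_egt1// ltr1n.
have [cov cov_size cov_net] : exists2 cov : nat -> seq I,
    forall k, (size (cov k))%:R <= C * (2 ^+ k.+1)^-1 `^ (- nu) &
    forall k q, exists2 u, u \in cov k &
      \sum_(i < n + n) (g q (pts i) - g u (pts i)) ^+ 2 <=
        (2 ^+ k.+1)^-1 ^+ 2 * \sum_(i < n + n) G (pts i) ^+ 2.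
  have ex k : exists l : seq I, (size l)%:R <= C * (2 ^+ k.+1)^-1 `^ (- nu) /\
      forall q, exists2 u, u \in l &
      \sum_(i < n + n) (g q (pts i) - g u (pts i)) ^+ 2 <=
        (2 ^+ k.+1)^-1 ^+ 2 * \sum_(i < n + n) G (pts i) ^+ 2.
    by have [l ? ?] := g_entropy (n + n) pts (eps01 k); exists l.
  by have [cov covP] := choice ex; exists cov => k; have [] := covP k.
have diff_le (w : T -> R) :
    \sum_(i < n) (w (x i) - w (y i)) ^+ 2 <= 2 * \sum_(i < n + n) w (pts i) ^+ 2.
  by rewrite (sum_pts (fun t => w t ^+ 2)) mulr_sumr; apply: ler_sum => i _.
have GA : \sum_(i < n + n) G (pts i) ^+ 2 <= A by rewrite (sum_pts (fun t => G t ^+ 2)).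
apply: (@chaining R I n (fun q i => g q (x i) - g q (y i)) cov delta s).
- by rewrite sqrtr_gt0 mulr_gt0.
- by rewrite sqrtr_gt0 mulr_gt0.
- by rewrite mulr_ge0 ?expR_ge0// mulr_ge0.
- move=> q; apply: (le_trans (diff_le _)); rewrite delta2 ler_pM2l//.
  apply: le_trans GA; apply: ler_sum => i _.
  by rewrite -[leLHS]real_normK ?num_real// lerXn2r ?nnegrE// (le_trans _ (g_le q _)).
- move=> k q; have [u uk hu] := cov_net k q; exists u => //.
  rewrite (eq_bigr (fun i : 'I_n => ((g q (x i) - g u (x i)) - (g q (y i) - g u (y i))) ^+ 2)); last first.
    by move=> i _; congr (_ ^+ _); ring.
  apply: (le_trans (diff_le (fun t => g q t - g u t))).
  rewrite exprMn delta2 -mulrA ler_pM2l//.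
  by apply: (le_trans hu); rewrite mulrC ler_wpM2r// sqr_ge0.
move=> k; rewrite s2 (_ : 8 * a / 8 = a); last by field.
have k1 : 1 <= k.+1%:R :> R by rewrite ler1n.
have pw : (2 ^+ k.+1)^-1 `^ (- nu) = expR (nu * (k.+1%:R * ln 2)) :> R.
  rewrite /powR invr_eq0 expf_eq0/= pnatr_eq0/=.
  by rewrite lnV ?posrE ?exprn_gt0// lnXn// mulrNN mulr_natl.
have p2 : (2 ^+ k.+1)^-1 = expR (- (k.+1%:R * ln 2)) :> R.
  by rewrite expRN mulr_natl -lnXn// lnK// posrE exprn_gt0.
apply: (@le_trans _ _ (2 * (C * expR (nu * (k.+1%:R * ln 2))) * expR (- (a * k.+1%:R)))).
  by rewrite ler_pM2r ?expR_gt0// ler_pM2l// -pw.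
rewrite p2 -!mulrA ler_pM2l// ler_wpM2l// -!expRD ler_expR.
have := ler_wpM2l (ler0n R k.+1) a_large.
nra.
Qed.

End entropy_chaining.

Section local_deviation.
Local Open Scope ereal_scope.
Context (R : realType) dO dT (Omega : measurableType dO) (T : measurableType dT).
Variables (P : probability Omega R) (Z : nat -> Omega -> T).
Hypothesis mZ : forall i, measurable_fun setT (Z i).
Hypothesis Z_indep : mutually_independent P Z.
Hypothesis Z_id : identically_distributed P Z.
Variables (I : countType) (g : I -> T -> R) (G : T -> R) (mu : I -> R).
Variables (b v C nu a A : R) (n : nat).
Hypotheses (mg : forall q, measurable_fun setT (g q)) (mG : measurable_fun setT G).
Hypotheses (g_le : forall q t, (`|g q t| <= G t)%R) (G_le : forall t, (G t <= b)%R).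
Hypotheses (b_gt0 : (0 < b)%R) (G_ge0 : forall t, (0 <= G t)%R).
Hypothesis G_var : \int[P]_w (G (Z 0 w) ^+ 2)%:E <= v%:E.
Hypothesis g_mean : forall q, \int[P]_w (g q (Z 0 w))%:E = (mu q)%:E.
Hypothesis g_entropy : discrete_entropy g G C nu.
Hypothesis C_ge0 : (0 <= C)%R.
Hypotheses (a_ge1 : (1 <= a)%R) (a_large : (2 * (nu + 1) * ln 2 <= a)%R).
Hypotheses (A_var : (8 * n%:R * v <= A)%R) (A_bound : (16 * b ^+ 2 <= A)%R).

Let A_gt0 : (0 < A)%R.
Proof. by rewrite (lt_le_trans _ A_bound)// mulr_gt0// exprn_gt0. Qed.

Let X (j : I * nat) (w : Omega) : R := (\sum_(i < j.2) (g j.1 (Z i w) - mu j.1))%R.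

Let mgZ q i : measurable_fun setT (fun w => g q (Z i w)).
Proof. exact: measurableT_comp. Qed.

Let mX j : measurable_fun setT (X j).
Proof. by apply: measurable_sum => i; apply: measurable_funB. Qed.

Let g_le_b q t : (`|g q t| <= b)%R.
Proof. exact: le_trans (G_le t). Qed.

Let v_ge0 : (0 <= v)%R.
Proof.
rewrite -lee_fin; apply: le_trans G_var; apply: integral_ge0 => w _.
by rewrite lee_fin sqr_ge0.
Qed.

(** The parameter [1 / sqrt A] of the exponential bound makes the exponent at
    most [1 - 20]. *)
Let ghost_small j : (j.2 <= n)%N ->
  P [set w | (40 * Num.sqrt (a * A) / 2 < `|X j w|)%R] <= (2^-1)%:E.
Proof.
move=> jn.
have sA : (0 < Num.sqrt A)%R by rewrite sqrtr_gt0.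
have sA2 : (Num.sqrt A ^+ 2 = A)%R by rewrite sqr_sqrtr// ltW.
have gv : \int[P]_w (g j.1 (Z 0 w) ^+ 2)%:E <= v%:E.
  apply: le_trans G_var; apply: ge0_le_integral => //.
  - by move=> w _; rewrite lee_fin sqr_ge0.
  - by apply/measurable_EFinP; exact: measurable_funX.
  - by apply/measurable_EFinP; apply: measurable_funX; exact: measurableT_comp.
  - move=> w _; rewrite lee_fin -[leLHS]real_normK ?num_real//.
    by rewrite lerXn2r ?nnegrE.
have bA : (4 * b <= Num.sqrt A)%R.
  rewrite -(ler_pXn2r (n := 2))// ?nnegrE ?mulr_ge0 ?(ltW b_gt0) ?sqrtr_ge0//.
  by rewrite sA2 exprMn (_ : 4 ^+ 2 = 16 :> R)%R//; ring.
apply: (le_trans (centered_tail mZ Z_indep Z_id (b := b) (l := (Num.sqrt A)^-1) _ j.2 (mg j.1) (g_le_b j.1) gv (g_mean j.1) _ _)).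
- by rewrite invr_ge0 ltW.
- by rewrite ler_pdivrMr// mul1r.
rewrite lee_fin.
have h1 : (2 * j.2%:R * (Num.sqrt A)^-1 ^+ 2 * v <= 1)%R.
  rewrite exprVn sA2 -mulrA mulrCA mulrC ler_pdivrMr// mul1r.
  apply: le_trans A_var; rewrite -!mulrA.
  have : (j.2%:R <= n%:R :> R)%R by rewrite ler_nat.
  move=> /(ler_wpM2r v_ge0); have : (0 <= n%:R * v)%R by rewrite mulr_ge0.
  by move=> *; lra.
have h2 : (20 <= (Num.sqrt A)^-1 * (40 * Num.sqrt (a * A) / 2))%R.
  rewrite sqrtrM ?(le_trans _ a_ge1)//.
  have -> : ((Num.sqrt A)^-1 * (40 * (Num.sqrt a * Num.sqrt A) / 2) = 20 * Num.sqrt a)%R.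
    by field; rewrite gt_eqF.
  have : (1 <= Num.sqrt a)%R by rewrite -[leLHS]sqrtr1 ler_wsqrtr.
  by move=> *; lra.
apply: (@le_trans _ _ (2 * expR (- 19))%R).
  by rewrite ler_pM2l// ler_expR; lra.
rewrite expRN -ler_pdivlMl// -[leRHS]invrK lef_pV2 ?posrE ?expR_gt0 ?invr_gt0 ?mulr_gt0 ?invr_gt0//.
by apply: le_trans (expR_ge1Dx _); rewrite invfM !invrK; lra.
Qed.

Let square_sum k := (\sum_(i < n) G (k i) ^+ 2)%R.

Let square_tail :
  P [set w | (A / 2 < square_sum (fun i => Z i w))%R] <= (expR (- (A / (8 * b ^+ 2))))%:E.
Proof.
have b2 : (0 < b ^+ 2)%R by rewrite exprn_gt0.
apply: (le_trans (chernoff_bounded mZ Z_indep Z_id (u := fun t => (G t ^+ 2)%R)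
  (b := (b ^+ 2)%R) (v := v) (A / 2)%R n _ b2 _ G_var)).
- exact: measurable_funX.
- by move=> t; rewrite sqr_ge0/= lerXn2r ?nnegrE// ltW.
rewrite lee_fin ler_expR lerN2.
have -> : (A / (8 * b ^+ 2) = (A / 4) / (2 * b ^+ 2))%R by field; rewrite gt_eqF.
rewrite ler_pM2r ?invr_gt0 ?mulr_gt0//.
have -> : (2 * n%:R * v = (8 * n%:R * v) / 4)%R by field.
by move: A_var; set e := (8 * n%:R * v)%R; lra.
Qed.

(** The squares of the envelope concentrate, so up to a small probability the
    signed process has increments of size [sqrt A]; it is then chained with
    the entropy relative to the envelope, which is free of any scale. *)
Lemma local_deviation :
  P [set w | exists2 j : I * nat, (j.2 <= n)%N & (40 * Num.sqrt (a * A) < `|X j w|)%R] <=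
  (4 * C * expR (- (a / 2)) + 4 * expR (- (A / (8 * b ^+ 2))))%:E.
Proof.
apply: (le_trans (symmetrization mX ghost_small)).
set E := [set z | _].
pose B : set ((n + n).-tuple T) :=
  [set t | exists2 j : I * nat, (j.2 <= n)%N &
     (20 * Num.sqrt (a * A) < `|\sum_(i < n | (i < j.2)%N)
        (g j.1 (tnth t (lshift n i)) - g j.1 (tnth t (rshift n i)))|)%R] `&`
  [set t | (\sum_(i < n + n) G (tnth t i) ^+ 2 <= A)%R].
have mB : measurable B.
  apply: measurableI.
    apply: (@measurable_exists_lt R _ ((n + n).-tuple T) (I * nat)%type
      (fun j => (j.2 <= n)%N) (fun j t => `|\sum_(i < n | (i < j.2)%N)
        (g j.1 (tnth t (lshift n i)) - g j.1 (tnth t (rshift n i)))|%R)) => j.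
    apply: measurableT_comp => //; under eq_fun do rewrite big_mkcond/=.
    apply: measurable_sum => i; case: (i < j.2)%N => //.
    by apply: measurable_funB; apply: (measurableT_comp (mg j.1)); exact: measurable_tnth.
  rewrite (_ : [set _ | _] = (fun t : (n + n).-tuple T => \sum_(i < n + n) G (tnth t i) ^+ 2)%R
    @^-1` `]-oo, A]).
    rewrite -[X in measurable X]setTI.
    have : measurable_fun setT (fun t : (n + n).-tuple T => \sum_(i < n + n) G (tnth t i) ^+ 2)%R.
      apply: measurable_sum => i; apply: measurable_funX.
      by apply: (measurableT_comp mG); exact: measurable_tnth.
    by apply.
  by apply/seteqP; split => t /=; rewrite in_itv.
have PB : (P \x P) (swapped_sample Z n [::] @^-1` B) <= (2 * C * expR (- (a / 2)))%:E.
  apply: sign_averaging => // -[w w'].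
  have [good|bad] := leP (\sum_(i < n) (G (Z i w) ^+ 2 + G (Z i w') ^+ 2))%R A.
    have key := (entropy_chaining (x := Z ^~ w) (y := Z ^~ w') C_ge0 (lt_le_trans ltr01 a_ge1) A_gt0
      a_large g_le g_entropy good).
    apply: le_trans key.
    apply: le_sign_prob => s [[[q m] /= mn h] _].
    exists q, m => //; move: h; congr (_ < `| _ |)%R.
    rewrite /signed_sum (big_ord_widen n (fun i =>
      (-1) ^+ nth false s i * (g q (Z i w) - g q (Z i w')))%R mn).
    apply: eq_bigr => i _.
    rewrite !tnth_mktuple (unsplitK (inl _)) (unsplitK (inr _))/=.
    by case: (nth false s i); rewrite /= ?expr1 ?expr0; ring.
  rewrite sign_prob_false ?mulr_ge0 ?expR_ge0// => s [_] /=.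
  rewrite big_split_ord/= -big_split/=; apply/negP; rewrite -ltNge.
  apply: (lt_le_trans bad); rewrite le_eqVlt; apply/orP; left; apply/eqP.
  apply: eq_bigr => i _; rewrite !tnth_mktuple (unsplitK (inl _)) (unsplitK (inr _))/=.
  by case: (nth false s i) => //; rewrite addrC.
pose bad := [set w | (A / 2 < square_sum (fun i => Z i w))%R].
have mbad : measurable bad.
  rewrite (_ : bad = (fun w => square_sum (fun i => Z i w)) @^-1` `](A / 2)%R, +oo[).
    rewrite -[X in measurable X]setTI.
    have : measurable_fun setT (fun w => square_sum (fun i => Z i w)).
      by apply: measurable_sum => i; apply: measurable_funX; exact: measurableT_comp.
    by apply.
  by apply/seteqP; split => t /=; rewrite in_itv/= andbT.
have mSB : measurable (swapped_sample Z n [::] @^-1` B).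
  by rewrite -[X in measurable X]setTI; apply: measurable_swapped_sample.
have EB : E `<=` (swapped_sample Z n [::] @^-1` B) `|` ((bad `*` setT) `|` (setT `*` bad)).
  move=> [w w'] [[q m] /= mn h].
  have [b1|g1] := ltP (A / 2)%R (square_sum (fun i => Z i w)).
    by right; left; split.
  have [b2|g2] := ltP (A / 2)%R (square_sum (fun i => Z i w')).
    by right; right; split.
  left; split => /=.
    exists (q, m) => //=; move: h; rewrite /X/= -sumrB.
    have -> : (40 * Num.sqrt (a * A) / 2 = 20 * Num.sqrt (a * A))%R by field.
    congr (_ < `| _ |)%R; rewrite (big_ord_widen _ (fun i => g q (Z i w) - mu q - (g q (Z i w') - mu q))%R mn).
    apply: eq_bigr => i _.
    by rewrite !tnth_mktuple (unsplitK (inl _)) (unsplitK (inr _))/= nth_nil; ring.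
  rewrite big_split_ord/=.
  rewrite (eq_bigr (fun i : 'I_n => G (Z i w) ^+ 2)%R); last first.
    by move=> i _; rewrite tnth_mktuple (unsplitK (inl _))/= nth_nil.
  rewrite [X in (_ + X)%R](eq_bigr (fun i : 'I_n => G (Z i w') ^+ 2)%R); last first.
    by move=> i _; rewrite tnth_mktuple (unsplitK (inr _))/= nth_nil.
  by move: g1 g2; rewrite /square_sum; lra.
have mE : measurable E.
  apply: (@measurable_exists_lt R _ (Omega * Omega)%type (I * nat)%type
    (fun j => (j.2 <= n)%N) (fun j (z : Omega * Omega) => `|X j z.1 - X j z.2|%R)) => j.
  apply: measurableT_comp => //.
  by apply: measurable_funB; apply: measurableT_comp => //.
have badL : (P \x P) (bad `*` setT) <= (expR (- (A / (8 * b ^+ 2))))%:E.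
  rewrite product_measure1E// [X in _ * X]probability_setT mule1.
  exact: square_tail.
have badR : (P \x P) (setT `*` bad) <= (expR (- (A / (8 * b ^+ 2))))%:E.
  rewrite product_measure1E// [X in X * _]probability_setT mul1e.
  exact: square_tail.
have PE : (P \x P) E <= (2 * C * expR (- (a / 2)) + 2 * expR (- (A / (8 * b ^+ 2))))%:E.
  apply: (@le_trans _ _ ((P \x P) ((swapped_sample Z n [::] @^-1` B) `|` ((bad `*` setT) `|` (setT `*` bad))))).
    apply: le_measure; rewrite ?inE//.
    by apply: measurableU => //; apply: measurableU; exact: measurableX.
  apply: (le_trans (measureU2 _ _ _)) => //.
    by apply: measurableU; exact: measurableX.
  rewrite EFinD leeD//.
  apply: (le_trans (measureU2 _ _ _)); [exact: measurableX|exact: measurableX|].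
  by rewrite mulr_natl mulr2n EFinD leeD.
apply: (le_trans (lee_wpmul2l _ PE)) => //.
rewrite -EFinM lee_fin; lra.
Qed.

End local_deviation.

(** * Entropy over weighted point sets *)

Section discrete_probability.
Local Open Scope ereal_scope.
Context (R : realType) d (T : measurableType d) (N : nat) (t : nat -> T) (w : nat -> R).
Hypothesis w_ge0 : forall i, (0 <= w i)%R.

Let atom i : {measure set T -> \bar R} := mscale (NngNum (w_ge0 i)) \d_(t i).

Definition discrete_measure : set T -> \bar R := msum atom N.

HB.instance Definition _ := Measure.on discrete_measure.

Lemma discrete_measureT : (\sum_(i < N) w i = 1)%R -> discrete_measure setT = 1.
Proof.
move=> w_sum; rewrite -[RHS]/(1%R%:E) -w_sum -sumEFin; apply: eq_bigr => i _.
by rewrite /atom /= /mscale/= diracT mule1.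
Qed.


Lemma integral_discrete (f : T -> R) : measurable_fun setT f -> (forall x, (0 <= f x)%R) ->
  \int[discrete_measure]_x (f x)%:E = (\sum_(i < N) w i * f (t i))%:E%R.
Proof.
move=> mf f0; have mEf : measurable_fun setT (EFin \o f) by exact/measurable_EFinP.
rewrite /discrete_measure ge0_integral_measure_sum//; last by move=> x _; rewrite lee_fin.
rewrite -sumEFin; apply: eq_bigr => i _.
rewrite /atom ge0_integral_mscale//; last by move=> x _; rewrite lee_fin.
by rewrite integral_dirac// diracT mul1e.
Qed.

End discrete_probability.

(** Covering by members of the class itself, for arbitrary finite weighted
    point sets: this is the form of the uniform entropy condition that is
    stable under products. *)
Definition weighted_entropy (R : realType) (I : eqType) (T : Type)
    (f : I -> T -> R) (env : T -> R) (C nu : R) : Prop :=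
  forall N (t : nat -> T) (w : nat -> R) (eps : R),
    (forall i, 0 <= w i) -> 0 < eps < 1 ->
    exists2 l : seq I, (size l)%:R <= C * eps `^ (- nu) &
      forall q, exists2 u, u \in l &
        \sum_(j < N) w j * (f q (t j) - f u (t j)) ^+ 2 <=
        eps ^+ 2 * \sum_(j < N) w j * env (t j) ^+ 2.

Lemma powR_ge1_neg (R : realType) (eps nu : R) : 0 < eps < 1 -> 0 <= nu ->
  1 <= eps `^ (- nu).
Proof.
move=> /andP[e0 e1] nu0; rewrite powRN -[leLHS]invr1 lef_pV2 ?posrE ?powR_gt0//.
have := @ge0_ler_powR R nu nu0 eps 1.
by rewrite powR1 !nnegrE => ->//; exact: ltW.
Qed.

Section entropy_of_discrete_measures.
Context (R : realType) d (T : measurableType d).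
Variables (H : set (T -> R)) (env : T -> R).
Hypothesis mH : forall g, H g -> measurable_fun setT g.
Hypothesis menv : measurable_fun setT env.
Hypothesis H_env : forall g x, H g -> `|g x| <= env x.

(** The entropy condition is tested against the normalized weights, a discrete
    probability measure. When the envelope vanishes at all weighted points, so
    do all members of the class, and the zero function covers. *)
Lemma weighted_cover : uniform_entropy_condition H env ->
  exists C nu : R, [/\ 0 < C, 0 < nu & forall N (t : nat -> T) (w : nat -> R) (eps : R),
    (forall i, 0 <= w i) -> 0 < eps < 1 ->
    exists2 l : seq (T -> R), (size l)%:R <= C * eps `^ (- nu) &
      forall g, H g -> exists2 i, (i < size l)%N &
        \sum_(j < N) w j * (g (t j) - nth (cst 0) l i (t j)) ^+ 2 <=
        eps ^+ 2 * \sum_(j < N) w j * env (t j) ^+ 2].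
Proof.
move=> [C [nu [C0 nu0 hC]]]; exists (2 * Num.max C 1), nu; split => //.
  by rewrite mulr_gt0// lt_max ltr01 orbT.
move=> N t w eps w0 /andP[e0 e1].
have pw1 : 1 <= eps `^ (- nu).
  by apply: powR_ge1_neg; rewrite ?e0// ltW.
have w2_ge0 (f : T -> R) : 0 <= \sum_(j < N) w j * f (t j) ^+ 2.
  by apply: sumr_ge0 => j _; rewrite mulr_ge0// sqr_ge0.
have [env0|env_neq0] := eqVneq (\sum_(j < N) w j * env (t j) ^+ 2) 0.
  exists [:: cst 0].
    rewrite /=; have : 1 <= Num.max C 1 by rewrite le_max lexx orbT.
    by nra.
  move=> g Hg; exists 0%N => //=; rewrite env0 mulr0 -[leRHS]env0.
    apply: ler_sum => j _; rewrite ler_wpM2l// subr0 -[leLHS]real_normK ?num_real//.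
    by rewrite lerXn2r ?nnegrE// ?(le_trans _ (H_env _ Hg))// H_env.
have env_gt0 : 0 < \sum_(j < N) w j * env (t j) ^+ 2 by rewrite lt_neqAle eq_sym env_neq0 w2_ge0.
pose W := \sum_(j < N) w j.
have W0 : 0 < W.
  rewrite lt_neqAle sumr_ge0 ?andbT//; apply/negP => /eqP W0.
  move: env_neq0; rewrite big1 ?eqxx// => j _.
  have := @psumr_eq0P _ _ (fun=> true) (fun j : 'I_N => w j) (fun j _ => w0 j) (esym W0) j isT.
  by move=> ->; rewrite mul0r.
pose p j := w j / W.
have p0 j : 0 <= p j by rewrite divr_ge0// ltW.
have p1 : \sum_(j < N) p j = 1 by rewrite -mulr_suml divff// gt_eqF.
pose Q : probability T R := HB.pack (discrete_measure N t p0)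
  (Measure_isProbability.Build _ _ _ (discrete_measure N t p0) (discrete_measureT t p0 p1)).
have sqE (f : T -> R) : measurable_fun setT f ->
    (\int[Q]_x (f x ^+ 2)%:E = (\sum_(j < N) p j * f (t j) ^+ 2)%:E)%E.
  move=> mf; rewrite /Q integral_discrete// => [|x]; last exact: sqr_ge0.
  exact: measurable_funX.
have pE (f : T -> R) : \sum_(j < N) p j * f (t j) ^+ 2 =
    (\sum_(j < N) w j * f (t j) ^+ 2) / W.
  by rewrite mulr_suml; apply: eq_bigr => j _; rewrite /p mulrAC.
have Qenv : sq_norm Q env = (\sum_(j < N) p j * env (t j) ^+ 2)%:E by exact: sqE.
have penv : 0 < \sum_(j < N) p j * env (t j) ^+ 2 by rewrite pE divr_gt0.
pose rad := eps * Num.sqrt (\sum_(j < N) p j * env (t j) ^+ 2).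
have rad0 : 0 < rad by rewrite mulr_gt0// sqrtr_gt0.
have cov : (covering_number rad H Q < (2 * Num.max C 1 * eps `^ (- nu))%:E)%E.
  apply: (@le_lt_trans _ _ (C * eps `^ (- nu))%:E).
    apply: (le_trans _ (hC eps _)); last by rewrite e0.
    apply: ereal_sup_ubound; exists Q; first by rewrite /= Qenv lte_fin penv ltry.
    by rewrite Qenv.
  rewrite lte_fin ltr_pM2r ?powR_gt0//.
  have : C <= Num.max C 1 by rewrite le_max lexx.
  by lra.
have [_ [n [u mu hu] <-] nlt] := ereal_inf_lt cov.
exists [seq u i | i <- enum 'I_n].
  by rewrite size_map size_enum_ord; rewrite lte_fin in nlt; exact: ltW.
move=> g Hg; have [i hi] := hu g Hg.
exists i; first by rewrite size_map size_enum_ord.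
rewrite (nth_map i) ?size_enum_ord// nth_ord_enum.
have mgu : measurable_fun setT (fun x => g x - u i x).
  by apply: measurable_funB => //; exact: mH.
have : (\int[Q]_x ((g x - u i x) ^+ 2)%:E <= (rad ^+ 2)%:E)%E.
  have n2 : (2 : R) != 0 by rewrite pnatr_eq0.
  have hp := powR_Lnorm Q (fun x => (g x - u i x)%:E) n2.
  have -> : (\int[Q]_x ((g x - u i x) ^+ 2)%:E =
      \int[Q]_x (`|(g x - u i x)%:E| `^ 2))%E.
    apply: eq_integral => x _.
    by rewrite abse_EFin poweR_EFin powR_mulrn// real_normK ?num_real.
  rewrite -hp -/(L2_dist Q g (u i)).
  have : (0 <= L2_dist Q g (u i))%E by exact: Lnorm_ge0.
  move: hi; case: (L2_dist Q g (u i)) => [s| |]//.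
  rewrite lte_fin lee_fin poweR_EFin lee_fin => s1 s0.
  by rewrite powR_mulrn// lerXn2r ?nnegrE// ltW.
rewrite (sqE (fun x => g x - u i x))// lee_fin.
rewrite (pE (fun x => g x - u i x)) /rad exprMn sqr_sqrtr ?(ltW penv)// (pE env) mulrA.
by rewrite ler_pM2r ?invr_gt0.
Qed.
(** Replacing every center by a member of the class lying in its ball, when
    there is one, doubles the radius. *)
Lemma uniform_weighted_entropy (I : eqType) (f : I -> T -> R) :
  (forall q, H (f q)) -> uniform_entropy_condition H env ->
  exists C nu : R, [/\ 0 < C, 0 < nu & weighted_entropy f env C nu].
Proof.
move=> Hf /weighted_cover[C [nu [C0 nu0 hC]]].
exists (C * 2^-1 `^ (- nu)), nu; split => //; first by rewrite mulr_gt0// powR_gt0.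
move=> N t w eps w0 /andP[e0 e1].
have e2 : 0 < 2^-1 * eps < 1 by rewrite mulr_gt0//=; lra.
have [l lsize lcov] := hC N t w (2^-1 * eps) w0 e2.
pose S (g g' : T -> R) := \sum_(j < N) w j * (g (t j) - g' (t j)) ^+ 2.
pose E := \sum_(j < N) w j * env (t j) ^+ 2.
pose close i q : Prop := S (f q) (nth (cst 0) l i) <= (2^-1 * eps) ^+ 2 * E.
pose chosen i (o : option I) : Prop :=
  match o with Some q => close i q | None => forall q, ~ close i q end.
have [pick pickP] : exists pick : nat -> option I, forall i, chosen i (pick i).
  have ex i : exists o, chosen i o.
    have [[q hq]|no] := pselect (exists q, close i q); first by exists (Some q).
    by exists None => q hq; apply: no; exists q.
  by have [pick pickP] := choice ex; exists pick.
exists (pmap pick (iota 0 (size l))).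
  apply: (@le_trans _ _ (size l)%:R).
    by rewrite ler_nat size_pmap (leq_trans (count_size _ _))// ?size_map size_iota.
  by apply: (le_trans lsize); rewrite powRM ?invr_ge0 ?(ltW e0)// mulrA.
move=> q; have [i il hi] := lcov (f q) (Hf q).
have := pickP i; rewrite /chosen; case E1 : (pick i) => [u|]; last by move/(_ q); case.
move=> hu; exists u.
  rewrite mem_pmap -E1; apply: map_f; by rewrite mem_iota.
apply: (@le_trans _ _ (2 * S (f q) (nth (cst 0) l i) + 2 * S (f u) (nth (cst 0) l i))).
  rewrite /S !mulr_sumr -big_split/=; apply: ler_sum => j _.
  set x := f q _; set y := f u _; set z := nth _ _ _ _.
  have h : (x - y) ^+ 2 <= 2 * (x - z) ^+ 2 + 2 * (y - z) ^+ 2.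
    by have := sqr_ge0 (x - z + (y - z)); rewrite !expr2; nra.
  have := ler_wpM2l (w0 j) h; rewrite mulrDr => /le_trans; apply.
  by rewrite le_eqVlt; apply/orP; left; apply/eqP; ring.
rewrite /close -/E in hi hu *.
have -> : eps ^+ 2 * E = 2 * ((2^-1 * eps) ^+ 2 * E) + 2 * ((2^-1 * eps) ^+ 2 * E) by field.
by apply: lerD; rewrite ler_pM2l.
Qed.

End entropy_of_discrete_measures.

Lemma weighted_entropy1 (R : realType) (T : Type) :
  weighted_entropy (fun (_ : nat) (_ : T) => 1 : R) (fun=> 1) 1 1.
Proof.
move=> N t w eps w0 e01; exists [:: 0%N].
  by rewrite /= mul1r powR_ge1_neg.
move=> q; exists 0%N; rewrite ?inE//.
rewrite big1 => [|j _]; last by rewrite subrr expr0n mulr0.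
by rewrite mulr_ge0 ?sqr_ge0// sumr_ge0// => j _; rewrite expr1n mulr1.
Qed.

(** Against [k] the class [phi] is measured with constant weights, and against
    [phi] the class [k] is measured with the weights [F ^ 2]. *)
Lemma product_entropy (R : realType) (T1 T2 : Type) (I1 I2 : eqType)
    (phi : I1 -> T1 -> R) (k : I2 -> T2 -> R) (F : T1 -> R) (kappa : R)
    (S : T1 * T2 -> R) (C1 nu1 C2 nu2 : R) :
  0 <= C1 -> 0 <= C2 ->
  (forall a y, `|phi a y| <= F y) -> (forall b x, `|k b x| <= kappa) ->
  weighted_entropy phi F C1 nu1 -> weighted_entropy k (fun=> kappa) C2 nu2 ->
  discrete_entropy (fun (q : I1 * I2) t => S t * phi q.1 t.1 * k q.2 t.2)
    (fun t => kappa * `|S t| * F t.1)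
    (C1 * C2 * 2^-1 `^ (- (nu1 + nu2))) (nu1 + nu2).
Proof.
move=> C10 C20 phiF kk h1 h2 N t eps /andP[e0 e1].
have e2 : 0 < 2^-1 * eps < 1 by rewrite mulr_gt0//=; lra.
have [|l1 s1 c1] := h1 N (fun j => (t j).1) (fun j => kappa ^+ 2 * S (t j) ^+ 2) _ _ e2.
  by move=> j; rewrite mulr_ge0// sqr_ge0.
have [|l2 s2 c2] := h2 N (fun j => (t j).2) (fun j => S (t j) ^+ 2 * F (t j).1 ^+ 2) _ _ e2.
  by move=> j; rewrite mulr_ge0// sqr_ge0.
exists [seq (a, b) | a <- l1, b <- l2].
  rewrite size_allpairs natrM; apply: (le_trans (ler_pM _ _ s1 s2)) => //.
  rewrite !powRM ?invr_ge0 ?(ltW e0)// opprD !powRD; first last.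
  - by apply/implyP => _; rewrite gt_eqF// invr_gt0.
  - by apply/implyP => _; rewrite gt_eqF// invr_gt0.
  by rewrite le_eqVlt; apply/orP; left; apply/eqP; ring.
move=> [a b]; have [a' a'l ha] := c1 a; have [b' b'l hb] := c2 b.
exists (a', b'); first by apply/allpairsP; exists (a', b').
pose G := \sum_(i < N) (kappa * `|S (t i)| * F (t i).1) ^+ 2; rewrite -/G.
have G1 : \sum_(j < N) kappa ^+ 2 * S (t j) ^+ 2 * F (t j).1 ^+ 2 = G.
  by apply: eq_bigr => j _; rewrite !exprMn real_normK ?num_real.
have G2 : \sum_(j < N) S (t j) ^+ 2 * F (t j).1 ^+ 2 * kappa ^+ 2 = G.
  by rewrite -G1; apply: eq_bigr => j _; ring.
rewrite G1 in ha; rewrite G2 in hb.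
have -> : eps ^+ 2 * G = 2 * ((2^-1 * eps) ^+ 2 * G) + 2 * ((2^-1 * eps) ^+ 2 * G) by field.
apply: (@le_trans _ _ (2 * (\sum_(j < N) kappa ^+ 2 * S (t j) ^+ 2 * (phi a (t j).1 - phi a' (t j).1) ^+ 2)
   + 2 * \sum_(j < N) S (t j) ^+ 2 * F (t j).1 ^+ 2 * (k b (t j).2 - k b' (t j).2) ^+ 2)); last first.
  by apply: lerD; rewrite ler_pM2l.
rewrite !mulr_sumr -big_split/=; apply: ler_sum => j _.
move: (t j) => [y x] /=.
have hk : k b x ^+ 2 <= kappa ^+ 2.
  rewrite -[leLHS]real_normK ?num_real// lerXn2r ?nnegrE ?(le_trans _ (kk b x))//.
have hp : phi a' y ^+ 2 <= F y ^+ 2.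
  rewrite -[leLHS]real_normK ?num_real// lerXn2r ?nnegrE ?(le_trans _ (phiF a' y))//.
set p := phi a y in ha *; set p' := phi a' y in hp *.
set u := k b x in hk *; set u' := k b' x.
apply: (@le_trans _ _ (2 * (S (y, x) ^+ 2 * (u ^+ 2 * (p - p') ^+ 2)) +
  2 * (S (y, x) ^+ 2 * (p' ^+ 2 * (u - u') ^+ 2)))).
  have : 0 <= S (y, x) ^+ 2 * ((p - p') * u - p' * (u - u')) ^+ 2.
    by rewrite mulr_ge0 ?sqr_ge0.
  by move=> h; rewrite -subr_ge0; apply: le_trans h _; rewrite le_eqVlt; apply/orP; left; apply/eqP; ring.
have S2 := sqr_ge0 (S (y, x)).
apply: lerD; rewrite ler_pM2l//.
  by rewrite (mulrC (kappa ^+ 2)) -[leRHS]mulrA ler_wpM2l// ler_wpM2r ?sqr_ge0.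
by rewrite -[leRHS]mulrA ler_wpM2l// ler_wpM2r ?sqr_ge0.
Qed.

(** * Boxes, compact sets and grids *)

Section boxes.
Variables (R : realType) (d : nat).
Implicit Types (c x u : 'rV[R]_d) (s : R).

Definition box c s : set 'rV[R]_d := [set u | forall i, `|u ord0 i - c ord0 i| <= s].

Lemma measurable_box c s : measurable (box c s).
Proof.
have -> : box c s = \bigcap_(i in [set: 'I_d])
    ((fun u : 'rV[R]_d => u ord0 i) @^-1` `[c ord0 i - s, c ord0 i + s]).
  apply/seteqP; split => u /= h i; first by move=> _ /=; rewrite in_itv/= -ler_distl.
  by have := h i Logic.I; rewrite /= in_itv/= -ler_distl.
apply: fin_bigcap_measurable => // i _.
by rewrite -[X in measurable X]setTI; exact: measurable_coord.
Qed.

Lemma lebesgue_box c s : 0 <= s ->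
  lebesgue_rV R d (box c s) = ((2 * s) ^+ d)%:E.
Proof.
move=> s0.
have -> : box c s = [set u : 'rV[R]_d |
    forall i, `[c ord0 i - s, c ord0 i + s]%classic (u ord0 i)].
  by apply/seteqP; split => u /= h i; have := h i; rewrite /= in_itv/= -ler_distl.
rewrite (@lebesgue_rV_box R d (fun i => `[c ord0 i - s, c ord0 i + s]%classic))//.
under eq_bigr => i _.
  rewrite lebesgue_measure_itv/= lte_fin.
  have -> : (if c ord0 i - s < c ord0 i + s then
      ((c ord0 i + s)%:E - (c ord0 i - s)%:E)%E else 0%E) = (2 * s)%:E.
    case: ltP => h; first by rewrite -EFinB; congr EFin; ring.
    by congr EFin; lra.
  over.
by rewrite prodEFin prodr_const card_ord.
Qed.

Lemma mx_norm_le u s : 0 <= s -> (`|u| <= s) <-> (forall i, `|u ord0 i| <= s).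
Proof.
move=> s0; rewrite [`|u|]/Num.norm/= mx_normrE; split => [|h].
  by move=> /bigmax_leP[_ h] i; exact: (h (ord0, i)).
by apply/bigmax_leP; split => // -[i j] _ /=; rewrite ord1.
Qed.

Lemma box_normE c s : 0 <= s -> box c s = [set u | `|u - c| <= s].
Proof.
move=> s0; apply/seteqP; split => u /=.
  by move=> h; apply/(mx_norm_le _ s0) => i; rewrite !mxE.
by move=> /(mx_norm_le _ s0) h i; have := h i; rewrite !mxE.
Qed.

Lemma compact_box c s : compact (box c s).
Proof.
have -> : box c s = [set u : 'rV[R]_d |
    forall i, `[c ord0 i - s, c ord0 i + s]%classic (u ord0 i)].
  by apply/seteqP; split => u /= h i; have := h i; rewrite /= in_itv/= -ler_distl.
apply: (@rV_compact _ _ (fun i => `[c ord0 i - s, c ord0 i + s]%classic)) => i.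
exact: segment_compact.
Qed.

(** Finitely many boxes around points of [I] leave room [eta - eps] around
    every point of [I]; unlike the neighborhood itself their union is
    obviously measurable. *)
Lemma box_cover (I : set 'rV[R]_d) (eta eps : R) : compact I -> 0 < eps <= eta ->
  exists J' : set 'rV[R]_d, [/\ measurable J', compact J',
    J' `<=` closed_neighborhood I eta &
    forall x u, I x -> `|u - x| <= eta - eps -> J' u].
Proof.
move=> cI /andP[eps0 eps_eta].
have eta0 : 0 <= eta by exact/ltW/lt_le_trans/eps_eta.
have cI' := cI; rewrite compact_cover in cI'.
have [||D DI Icov] := cI' _ I (fun y => ball y eps).
- by move=> y _; exact: ball_open.
- by move=> y Iy; exists y => //; exact: ballxx.
exists (\big[setU/set0]_(y <- finmap.enum_fset D) box y eta); split.
- by apply: bigsetU_measurable => y _; exact: measurable_box.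
- by apply: bigsetU_compact => y _; exact: compact_box.
- move=> u; rewrite -bigcup_seq => -[y yD]; rewrite box_normE// => h.
  by exists y => //; have := DI _ yD; rewrite inE.
move=> x u Ix ux; rewrite -bigcup_seq; have [y yD xy] := Icov x Ix.
exists y => //; rewrite box_normE//=.
move: xy; rewrite -ball_normE /= distrC => xy.
have := ler_normD (u - x) (x - y); rewrite addrA subrK; lra.
Qed.

Lemma compact_coordinates_bounded (I : set 'rV[R]_d) : compact I ->
  exists2 M, 0 < M & forall x i, I x -> `|x ord0 i| <= M.
Proof.
move=> /compact_bounded[M [_ hM]]; exists (Num.max M 0 + 1).
  by rewrite ltr_wpDl// le_max lexx orbT.
move=> x i Ix; have M1 : M < Num.max M 0 + 1.
  by rewrite ltr_pwDr// le_max lexx.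
have s0 : 0 <= Num.max M 0 + 1 by rewrite addr_ge0// le_max lexx orbT.
exact: ((mx_norm_le x s0).1 (hM _ M1 x Ix) i).
Qed.

Lemma continuous_compact_le (J J' : set 'rV[R]_d) (f : 'rV[R]_d -> R) :
  {within J, continuous f} -> compact J' -> J' `<=` J ->
  exists2 M, 0 < M & forall x, J' x -> f x <= M.
Proof.
move=> cf cJ' JJ; have cf' := continuous_subspaceW JJ cf.
have /compact_bounded[M [_ hM]] := continuous_compact cf' cJ'.
exists (Num.max M 0 + 1); first by rewrite ltr_wpDl// le_max lexx orbT.
move=> x J'x; apply: (le_trans (ler_norm _)); apply: (hM _ _ (f x)); last by exists x.
by rewrite ltr_pwDr// le_max lexx.
Qed.

Lemma grid (M s : R) : 0 < s -> 0 < M -> exists L : seq 'rV[R]_d,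
  (size L)%:R <= ((2 * M + s) / s) ^+ d /\
  forall x, (forall i, `|x ord0 i| <= M) -> exists2 c, c \in L & box c s x.
Proof.
move=> s0 M0; pose m := Num.truncn (2 * M / s).
have q0 : 0 <= 2 * M / s by rewrite divr_ge0 ?mulr_ge0// ltW.
pose node (a : {ffun 'I_d -> 'I_m.+1}) : 'rV[R]_d := \row_i (s * (a i)%:R - M).
exists [seq node a | a : {ffun 'I_d -> 'I_m.+1}].
split.
  rewrite size_image card_ffun !card_ord natrX lerXn2r ?nnegrE//.
    by rewrite divr_ge0 ?(ltW s0)// addr_ge0 ?mulr_ge0// ltW.
  have /andP[h _] := truncn_itv q0.
  by rewrite mulrDl divff ?gt_eqF// -natr1 lerD2r.
move=> x xM; pose b i : nat := Num.truncn ((x ord0 i + M) / s).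
have b0 i : 0 <= (x ord0 i + M) / s.
  by rewrite divr_ge0 ?(ltW s0)//; have := xM i; rewrite ler_norml; lra.
have bm i : (b i < m.+1)%N.
  rewrite ltnS; apply: le_truncn; rewrite ler_pM2r ?invr_gt0//.
  by have := xM i; rewrite ler_norml; lra.
exists (node [ffun i => Ordinal (bm i)]).
  by rewrite /image_mem; apply/mapP; exists [ffun i => Ordinal (bm i)]; rewrite ?mem_enum.
move=> i; rewrite mxE ffunE/=.
have /andP[h1 h2] := truncn_itv (b0 i); rewrite -/(b i) in h1 h2.
rewrite ler_pdivlMr// in h1; rewrite ltr_pdivrMr// -natr1 in h2.
by rewrite ler_norml; lra.
Qed.

End boxes.

(** * Uniform deviations and pointwise limits *)

Section truncated_class.
Local Open Scope ereal_scope.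
Context (R : realType) dO (Omega : measurableType dO) (P : probability Omega R)
  (r d : nat).
Let T : measurableType _ := ('rV[R]_r * 'rV[R]_d)%type.
Variable W : nat -> Omega -> T.
Hypothesis mW : forall i, measurable_fun setT (W i).
Hypothesis W_indep : mutually_independent P W.
Hypothesis W_id : identically_distributed P W.

Definition mean (g : T -> R) : R := fine (\int[P]_w (g (W 0 w))%:E).

Definition centered_sum (g : T -> R) m w : R :=
  (\sum_(i < m) (g (W i w) - mean g))%R.

Definition deviation (I : Type) (g : I -> T -> R) n (t : R) : set Omega :=
  [set w | exists2 j : I * nat, (j.2 <= n)%N & (t < `|centered_sum (g j.1) j.2 w|)%R].

Lemma measurable_centered_sum (g : T -> R) m : measurable_fun setT g ->
  measurable_fun setT (centered_sum g m).
Proof.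
by move=> mg; apply: measurable_sum => i; apply: measurable_funB => //; exact: measurableT_comp.
Qed.

Lemma measurable_deviation (I : countType) (g : I -> T -> R) n (t : R) :
  (forall q, measurable_fun setT (g q)) -> measurable (deviation g n t).
Proof.
move=> mg; apply: (@measurable_exists_lt R _ Omega (I * nat)%type (fun j => (j.2 <= n)%N)
  (fun j w => `|centered_sum (g j.1) j.2 w|%R)) => j.
by apply: measurableT_comp => //; exact: measurable_centered_sum.
Qed.

(** Bounded pointwise limits inherit a uniform deviation bound, by dominated
    convergence for the means. *)
Lemma deviation_limit (I : Type) (g : I -> T -> R) (f : T -> R) (b t : R) n w
    (q : nat -> I) m :
  (forall q, measurable_fun setT (g q)) -> (forall q x, (`|g q x| <= b)%R) ->
  (forall x, (fun l => g (q l) x) @ \oo --> f x) ->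
  ~ deviation g n t w -> (m <= n)%N -> (`|centered_sum f m w| <= t)%R.
Proof.
move=> mg gb gf ndev mn.
have mf : measurable_fun setT f.
  by apply: (measurable_fun_cvg (h := fun l => g (q l))) => // x _; exact: gf.
have fb x : (`|f x| <= b)%R.
  have h : (fun l => `|g (q l) x|%R) @ \oo --> `|f x|%R by exact: cvg_norm (gf x).
  by apply: (cvgr_to_le h); apply: nearW => l; exact: gb.
have mfW : measurable_fun setT (fun w => f (W 0 w)) by exact: measurableT_comp.
have mean_cvg : (fun l => mean (g (q l))) @ \oo --> mean f.
  have ib : P.-integrable setT (EFin \o cst b).
    exact: finite_measure_integrable_cst.
  apply: (@fine_cvg _ _ _ _ (fun l => \int[P]_w (g (q l) (W 0 w))%:E)).
  rewrite fineK; last first.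
    apply: (integrable_fin_num measurableT).
    by apply: (@bounded_integrable _ _ _ P (fun w => f (W 0 w)) b).
  apply: (@dominated_cvg _ _ _ P setT measurableT (fun l w => (g (q l) (W 0 w))%:E)
    (fun w => (f (W 0 w))%:E) (EFin \o cst b)) => //.
  - by move=> l; apply/measurable_EFinP; exact: measurableT_comp.
  - by move=> x _; apply: cvg_EFin; [exact: nearW|exact: gf].
  - by move=> l x _; rewrite /= lee_fin.
have cs : (fun l => `|centered_sum (g (q l)) m w|%R) @ \oo --> `|centered_sum f m w|%R.
  apply: cvg_norm; rewrite /centered_sum; elim: m {mn} => [|m IH].
    under eq_fun do rewrite big_ord0; rewrite big_ord0; exact: cvg_cst.
  under eq_fun do rewrite big_ord_recr/=; rewrite big_ord_recr/=.
  by apply: cvgD => //; apply: cvgB => //; exact: gf.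
apply: (cvgr_to_le cs); apply: nearW => l.
by rewrite leNgt; apply/negP => h; apply: ndev; exists (q l, m).
Qed.
End truncated_class.

(** * Products localized to a cube *)

Section local_class.
Local Open Scope ereal_scope.
Context (R : realType) dO (Omega : measurableType dO) (P : probability Omega R)
  (r d : nat).
Let T : measurableType _ := ('rV[R]_r * 'rV[R]_d)%type.
Variable W : nat -> Omega -> T.
Hypothesis mW : forall i, measurable_fun setT (W i).
Hypothesis W_indep : mutually_independent P W.
Hypothesis W_id : identically_distributed P W.
Variables (phi : nat -> 'rV[R]_r -> R) (F : 'rV[R]_r -> R).
Variables (k : nat -> 'rV[R]_d -> R) (kappa : R).
Hypotheses (mphi : forall a, measurable_fun setT (phi a)) (mF : measurable_fun setT F).
Hypothesis mk : forall b, measurable_fun setT (k b).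
Hypothesis phi_le : forall a y, (`|phi a y| <= F y)%R.
Hypothesis k_le : forall b x, (`|k b x| <= kappa)%R.
Hypothesis kappa_gt0 : (0 < kappa)%R.
Variables (C1 nu1 C2 nu2 : R).
Hypotheses (C1_ge0 : (0 <= C1)%R) (C2_ge0 : (0 <= C2)%R).
Hypothesis phi_entropy : weighted_entropy phi F C1 nu1.
Hypothesis k_entropy : weighted_entropy k (fun=> kappa) C2 nu2.

Definition cutoff (tau : R) (Q : set 'rV[R]_d) (t : T) : R :=
  (\1_[set y | F y <= tau] t.1 * \1_Q t.2)%R.

Definition local_product tau Q (q : nat * nat) (t : T) : R :=
  (cutoff tau Q t * phi q.1 t.1 * k q.2 t.2)%R.

Lemma measurable_sublevel tau : measurable [set y | (F y <= tau)%R].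
Proof.
rewrite (_ : [set _ | _] = F @^-1` `]-oo, tau]).
  by rewrite -[X in measurable X]setTI; exact: mF.
by apply/seteqP; split => y /=; rewrite in_itv.
Qed.

Lemma measurable_cutoff tau Q : measurable Q -> measurable_fun setT (cutoff tau Q).
Proof.
move=> mQ; apply: measurable_funM; apply: measurableT_comp => //.
exact: measurable_indic (measurable_sublevel tau).
Qed.

Lemma cutoff01 tau Q t : cutoff tau Q t = 0%R \/ cutoff tau Q t = 1%R.
Proof.
rewrite /cutoff !indicE; case: (_ \in _); case: (_ \in _);
  rewrite ?(mulr0, mul0r, mulr1); by [left|right].
Qed.

Lemma measurable_local_product tau Q q : measurable Q ->
  measurable_fun setT (local_product tau Q q).
Proof.
move=> mQ; apply: measurable_funM.
  by apply: measurable_funM; [exact: measurable_cutoff|exact: measurableT_comp].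
exact: measurableT_comp.
Qed.

(** Restricting the envelope to the cube makes its second moment proportional
    to the volume of the cube, hence to the bandwidth. *)
Definition local_envelope tau Q (t : T) : R := (kappa * `|cutoff tau Q t| * F t.1)%R.

Lemma local_product_le tau Q q t : (`|local_product tau Q q t| <= local_envelope tau Q t)%R.
Proof.
rewrite /local_product /local_envelope !normrM mulrC mulrA.
by rewrite ler_pM// ?mulr_ge0// ler_wpM2r.
Qed.

Lemma local_envelope_le tau Q t : (0 < tau)%R -> (local_envelope tau Q t <= kappa * tau)%R.
Proof.
move=> tau0; rewrite /local_envelope -mulrA ler_pM2l//.
rewrite /cutoff !indicE; case: (boolP (t.1 \in _)) => [|_]; last first.
  by rewrite mul0r normr0 mul0r ltW.
rewrite inE/= => Ft; rewrite mul1r; case: (_ \in _); rewrite ?normr1 ?mul1r//.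
by rewrite normr0 mul0r ltW.
Qed.

Lemma local_class_deviation tau Q n v a A : measurable Q -> (0 < tau)%R ->
  \int[P]_w (F (W 0 w).1 ^+ 2 * cutoff tau Q (W 0 w))%:E <= v%:E ->
  (8 * n%:R * (kappa ^+ 2 * v) <= A)%R -> (16 * (kappa * tau) ^+ 2 <= A)%R ->
  (1 <= a)%R -> (2 * (nu1 + nu2 + 1) * ln 2 <= a)%R ->
  P (deviation P W (local_product tau Q) n (40 * Num.sqrt (a * A))) <=
  (4 * (C1 * C2 * 2^-1 `^ (- (nu1 + nu2))) * expR (- (a / 2)) +
   4 * expR (- (A / (8 * (kappa * tau) ^+ 2))))%:E.
Proof.
move=> mQ tau0 hv vA bA a1 alarge.
have b0 : (0 < kappa * tau)%R by rewrite mulr_gt0.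
have mG : measurable_fun setT (local_envelope tau Q).
  apply: measurable_funM; last exact: measurableT_comp.
  apply: measurable_funM => //; apply: measurableT_comp => //.
  exact: measurable_cutoff.
have G0 t : (0 <= local_envelope tau Q t)%R.
  exact: le_trans (local_product_le tau Q (0%N, 0%N) t).
have gb q t : (`|local_product tau Q q t| <= kappa * tau)%R.
  by rewrite (le_trans (local_product_le _ _ _ _))// local_envelope_le.
apply: (@local_deviation _ _ _ _ _ P W mW W_indep W_id (nat * nat)%type
  (local_product tau Q) (local_envelope tau Q) (fun q => mean P W (local_product tau Q q))
  (kappa * tau) (kappa ^+ 2 * v) _ (nu1 + nu2) a A n) => //.
- by move=> q; exact: measurable_local_product.
- exact: local_product_le.
- by move=> t; exact: local_envelope_le.
- rewrite EFinM; apply: le_trans (lee_wpmul2l _ hv); last by rewrite lee_fin sqr_ge0.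
  rewrite -ge0_integralZl//; last 3 first.
  + apply/measurable_EFinP; apply: measurable_funM.
      by apply: measurable_funX; apply: measurableT_comp => //; exact: measurableT_comp.
    by apply: (measurableT_comp (measurable_cutoff tau mQ)).
  + move=> w _; rewrite lee_fin mulr_ge0 ?sqr_ge0//.
    by have [->|->] := cutoff01 tau Q (W 0 w).
  + by rewrite lee_fin sqr_ge0.
  rewrite le_eqVlt; apply/orP; left; apply/eqP; apply: eq_integral => w _.
  rewrite -EFinM; congr EFin; rewrite /local_envelope.
  by have [->|->] := cutoff01 tau Q (W 0 w); rewrite ?normr0 ?normr1; ring.
- move=> q; rewrite /mean fineK//.
  apply: (integrable_fin_num measurableT).
  apply: (@bounded_integrable _ _ _ P (fun w => local_product tau Q q (W 0 w)) (kappa * tau)) => //.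
  exact: (measurableT_comp (measurable_local_product tau q mQ)).
- exact: product_entropy.
- by rewrite mulr_ge0 ?powR_ge0// mulr_ge0.
Qed.

End local_class.

(** * The Borel-Cantelli lemma and logarithmic bounds *)

Section borel_cantelli.
Local Open Scope ereal_scope.
Context (R : realType) d (T : measurableType d) (P : probability T R).

Lemma sum_inv_square (N : nat) :
  (\sum_(i < N.+1) (i.+1%:R ^+ 2)^-1 <= 2 - (N.+1%:R)^-1 :> R)%R.
Proof.
elim: N => [|N IH]; first by rewrite big_ord1 expr1n invr1; lra.
rewrite big_ord_recr/=; apply: le_trans (lerD IH (lexx _)) _.
have N1 : (0 < N.+1%:R :> R)%R by rewrite ltr0n.
rewrite -[N.+2%:R]natr1; move: (N.+1%:R : R)%R N1 => x x0.
have h : (0 <= (x * (x + 1) ^+ 2)^-1 :> R)%R.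
  by rewrite invr_ge0 mulr_ge0 ?sqr_ge0// ltW.
rewrite -subr_ge0; apply: le_trans h _; rewrite le_eqVlt; apply/orP; left; apply/eqP.
by field; rewrite !gt_eqF// addr_gt0.
Qed.

Lemma borel_cantelli_ae (F : nat -> set T) (M : R) : (forall i, measurable (F i)) ->
  (forall N, \sum_(i < N) P (F i) <= M%:E) ->
  {ae P, forall w, exists i1, forall i, (i1 <= i)%N -> ~ F i w}.
Proof.
move=> mF hF.
have Fsum : \sum_(n <oo) P (F n) < +oo.
  apply: (@le_lt_trans _ _ M%:E); last exact: ltry.
  apply: lime_le; first exact: is_cvg_nneseries.
  by apply: nearW => N; rewrite big_mkord.
exists (lim_sup_set F); split.
- by apply: bigcapT_measurable => k; apply: bigcup_measurable => i _.
- exact: lim_sup_set_cvg0.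
move=> w; apply: contra_notP => notlim.
apply: contrapT => h; apply: notlim => n _; apply: contrapT => h'.
by apply: h; exists n => k nk Fk; apply: h'; exists k.
Qed.

Lemma borel_cantelli_inv_square (B : nat -> set T) (C : R) (i0 : nat) :
  (forall i, measurable (B i)) ->
  (forall i, (i0 <= i)%N -> P (B i) <= (C * (i%:R ^+ 2)^-1)%:E) ->
  {ae P, forall w, exists i1, forall i, (i1 <= i)%N -> ~ B i w}.
Proof.
move=> mB hB.
have C0 : (0 <= C)%R.
  have := le_trans (measure_ge0 P _) (hB i0.+1 (leqnSn _)).
  by rewrite lee_fin pmulr_lge0// invr_gt0 exprn_gt0// ltr0n.
have : {ae P, forall w, exists i1, forall i, (i1 <= i)%N -> ~ B (i + i0.+1)%N w}.
  apply: (@borel_cantelli_ae (fun n => B (n + i0.+1)%N) (C * 2)%R) => // N.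
  apply: (@le_trans _ _ (\sum_(n < N) (C * (n.+1%:R ^+ 2)^-1)%:E)).
    apply: lee_sum => n _; apply: (le_trans (hB _ _)).
      by rewrite (leq_trans (leqnSn _))// leq_addl.
    rewrite lee_fin ler_wpM2l// lef_pV2 ?posrE ?exprn_gt0 ?ltr0n ?addnS//.
    by rewrite lerXn2r ?nnegrE// ler_nat ltnS leq_addr.
  rewrite sumEFin lee_fin -mulr_sumr ler_wpM2l//.
  case: N => [|N]; first by rewrite big_ord0.
  by apply: (le_trans (sum_inv_square N)); rewrite gerBl invr_ge0.
apply: filterS => w [n hn].
exists (n + i0.+1)%N => i hi; have := hn (i - i0.+1)%N.
rewrite subnK; last by rewrite (leq_trans _ hi)// leq_addl.
by apply; rewrite leq_subRL ?(leq_trans _ hi) ?leq_addl// addnC.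
Qed.

End borel_cantelli.

Section log_bounds.
Variable R : realType.

Lemma ln2_ge_half : 2^-1 <= ln 2 :> R.
Proof.
rewrite -ler_expR lnK ?posrE//.
have := @expR_le_quadratic R 2^-1 (lexx _) => /le_trans; apply.
by rewrite expr2; lra.
Qed.

Lemma ln_pow2 i : ln (2 ^+ i) = i%:R * ln 2 :> R.
Proof. by rewrite lnXn// mulr_natl. Qed.

Lemma pow2_le_expR i : 2 ^+ i <= expR i%:R :> R.
Proof.
rewrite -[i%:R]mulr1 expRM_natl lerXn2r ?nnegrE ?expR_ge0//.
by have := @expR_ge1Dx R 1; lra.
Qed.

Lemma expRN_le_cube x : 0 < x -> expR (- (3 * x)) <= (x ^+ 3)^-1 :> R.
Proof.
move=> x0; rewrite expRN lef_pV2 ?posrE ?expR_gt0 ?exprn_gt0//.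
rewrite expRM_natl lerXn2r ?nnegrE ?expR_ge0 ?(ltW x0)//.
by have := @expR_ge1Dx R x; lra.
Qed.

Lemma expRN_le_fourth x : 0 < x -> expR (- (4 * x)) <= (x ^+ 4)^-1 :> R.
Proof.
move=> x0; rewrite expRN lef_pV2 ?posrE ?expR_gt0 ?exprn_gt0//.
rewrite expRM_natl lerXn2r ?nnegrE ?expR_ge0 ?(ltW x0)//.
by have := @expR_ge1Dx R x; lra.
Qed.

Lemma sqr_le_expR x : 0 <= x -> x ^+ 2 <= 4 * expR x :> R.
Proof.
move=> x0; have -> : expR x = expR (2^-1 * x) ^+ 2.
  by rewrite -expRM_natl mulrA divff ?mul1r.
rewrite (_ : 4 = 2 ^+ 2 :> R); last by ring.
rewrite -exprMn lerXn2r ?nnegrE ?mulr_ge0 ?expR_ge0//.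
by have := @expR_ge1Dx R (2^-1 * x); lra.
Qed.

End log_bounds.

(** * Dyadic scales of bandwidths *)

Lemma measure_bigsetU_le (R : realType) d (T : measurableType d)
    (mu : {measure set T -> \bar R}) (I : Type) (s : seq I) (Q : pred I) (F : I -> set T) :
  (forall i, measurable (F i)) ->
  (mu (\big[setU/set0]_(i <- s | Q i) F i) <= \sum_(i <- s | Q i) mu (F i))%E.
Proof.
move=> mF; elim: s => [|i s IH]; first by rewrite !big_nil measure0.
rewrite !big_cons; case: ifP => // _.
apply: le_trans (measureU2 _ _ _) _ => //; first exact: bigsetU_measurable.
exact: leeD.
Qed.

Lemma mem_bigsetU (I : eqType) (T : Type) (s : seq I) (Q : pred I) (F : I -> set T) i x :
  i \in s -> Q i -> F i x -> (\big[setU/set0]_(j <- s | Q j) F j) x.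
Proof. by move=> si Qi Fx; rewrite (big_rem i)//= Qi; left. Qed.

Lemma powRVX (R : realType) (h : R) (d : nat) : (0 < d)%N -> 0 <= h ->
  (h `^ d%:R^-1) ^+ d = h.
Proof.
move=> d0 h0; rewrite -powR_mulrn ?powR_ge0// -powRrM mulVf ?powRr1//.
by rewrite pnatr_eq0 -lt0n.
Qed.

Section scales.
Variables (R : realType) (d : nat) (h0 c gamma MI : R).
Hypotheses (d_gt0 : (0 < d)%N) (h0_gt0 : 0 < h0) (c_gt0 : 0 < c)
  (gamma_itv : 0 < gamma <= 1) (MI_gt0 : 0 < MI).

(** Lower bound for the bandwidths allowed at the sample sizes of [[2 ^ i, 2 ^ i.+1]]. *)
Definition min_scale i : R := c * (ln (2 ^+ i) / 2 ^+ i.+1) `^ gamma.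

(** Bandwidths are grouped into the levels [scale j.+1 <= h <= scale j]. Up to
    constants, [side j] is the diameter of the supports of the kernels of a
    level, and [log_level] the logarithmic factor of the normalization. *)
Definition scale j : R := h0 / 2 ^+ j.

Definition side j : R := scale j `^ d%:R^-1.

Definition log_level i j : R := Num.max (ln (scale j)^-1) (ln (ln (2 ^+ i))).

Lemma scale_gt0 j : 0 < scale j.
Proof. by rewrite divr_gt0// exprn_gt0. Qed.

Lemma side_gt0 j : 0 < side j.
Proof. by rewrite powR_gt0// scale_gt0. Qed.

Lemma sideX j : side j ^+ d = scale j.
Proof. by rewrite powRVX// ltW// scale_gt0. Qed.

Lemma min_scale_ge i : (2 <= i)%N -> c / 2 ^+ i.+1 <= min_scale i.
Proof.
move=> i2; rewrite /min_scale ler_pM2l//.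
have l1 : 1 <= ln (2 ^+ i) :> R.
  rewrite ln_pow2; have : (2 : R) <= i%:R by rewrite (ler_nat _ 2%N).
  have l20 : 0 <= ln 2 :> R by apply: le_trans (ln2_ge_half R).
  by move=> /(ler_wpM2r l20); have := ln2_ge_half R; lra.
have p0 : 0 < ((2 : R) ^+ i.+1)^-1 by rewrite invr_gt0 exprn_gt0.
have p1 : ((2 : R) ^+ i.+1)^-1 <= 1 by rewrite invf_le1 ?exprn_gt0// exprn_ege1// ler1n.
apply: (@le_trans _ _ ((2 ^+ i.+1)^-1 `^ gamma)).
  case/andP: gamma_itv => g0 g1.
  rewrite -[leLHS]powRr1 ?(ltW p0)//.
  rewrite /powR gt_eqF// ler_expR ler_wnM2r ?ln_le0//.
have [g0 _] := andP gamma_itv.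
apply: ge0_ler_powR; rewrite ?nnegrE ?(ltW g0) ?(ltW p0)//.
  by rewrite mulr_ge0 ?(ltW p0)// (le_trans _ l1).
by rewrite -[leLHS]mul1r ler_pM2r.
Qed.

Lemma grid_size j (L : seq 'rV[R]_d) :
  (size L)%:R <= ((2 * MI + side j) / side j) ^+ d ->
  (size L)%:R <= (2 * MI + side 0) ^+ d / scale j.
Proof.
move=> /le_trans; apply; rewrite expr_div_n sideX ler_pM2r ?invr_gt0 ?scale_gt0//.
have s0 k := ltW (side_gt0 k).
rewrite lerXn2r ?nnegrE ?addr_ge0 ?mulr_ge0 ?(ltW MI_gt0)// lerD2l.
apply: ge0_ler_powR; rewrite ?invr_ge0 ?nnegrE ?(ltW (scale_gt0 _))//.
rewrite /scale expr0 ler_pM2l// lef_pV2 ?posrE ?exprn_gt0//.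
by rewrite exprn_ege1// ler1n.
Qed.

(** The smallest bandwidths are at least of order [2 ^ - i], so that only
    [i + O(1)] levels matter. *)
Lemma max_level : exists J0 : nat, forall i j, (2 <= i)%N -> min_scale i <= scale j ->
  (j < i + J0)%N.
Proof.
exists (Num.truncn (2 * h0 / c)).+1 => i j i2 hij.
have := le_trans (min_scale_ge i2) hij.
rewrite ler_pdivrMr ?exprn_gt0// /scale mulrAC ler_pdivlMr ?exprn_gt0// => h.
have h2 : (2 : R) ^+ j <= 2 * h0 / c * 2 ^+ i.
  rewrite mulrAC ler_pdivlMr// mulrC; apply: (le_trans h).
  by rewrite exprS mulrCA mulrA.
rewrite ltnNge; apply/negP => ij.
have h3 : 2 * h0 / c < 2 ^+ (Num.truncn (2 * h0 / c)).+1.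
  apply: (lt_le_trans (real_truncnS_gt (num_real _))).
  by rewrite -natrX ler_nat; exact/ltnW/ltn_expl.
have : (2 : R) ^+ (i + (Num.truncn (2 * h0 / c)).+1) <= 2 ^+ j.
  by apply: ler_weXn2l => //; rewrite ler1n.
rewrite exprD => h4; have := le_trans h4 h2.
by rewrite mulrC ler_pM2r ?exprn_gt0// leNgt h3.
Qed.

Lemma loglog_large : exists2 i1 : nat, (2 <= i1)%N & forall i, (i1 <= i)%N ->
  1 <= ln (ln (2 ^+ i)) :> R.
Proof.
exists (Num.truncn (2 * expR 1 : R)).+2 => // i hi.
rewrite -ler_expR lnK; last first.
  rewrite posrE ln_pow2 mulr_gt0//; last exact: lt_le_trans (ln2_ge_half R).
  by rewrite ltr0n; apply: leq_trans hi.
rewrite ln_pow2.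
have h : 2 * expR 1 <= i%:R :> R.
  apply: (le_trans (ltW (real_truncnS_gt (num_real _)))).
  by rewrite ler_nat; apply: leq_trans hi.
have := ler_pM (mulr_ge0 (ler0n R 2) (expR_ge0 1)) (_ : 0 <= 2^-1 :> R) h (ln2_ge_half R).
by rewrite mulrAC divff ?mul1r//; apply; rewrite invr_ge0.
Qed.

(** Every level costs [O(1 / i ^ 3)]: the first exponential beats the number
    [O(1 / scale j)] of cubes through [log (1 / scale)] and leaves a power of
    [log n] through [log log n], the second one is a power of [n]. *)
Lemma level_cost (Cn a0 C kt A : R) (i j : nat) :
  0 <= Cn -> 0 <= C -> 8 <= a0 -> (2 <= i)%N -> 1 <= ln (ln (2 ^+ i)) :> R ->
  min_scale i <= scale j -> 0 < kt -> 4 * i%:R <= A / (8 * kt ^+ 2) ->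
  Cn / scale j * (4 * C * expR (- (a0 * log_level i j / 2)) +
                  4 * expR (- (A / (8 * kt ^+ 2)))) <=
  Cn * (32 * C + 8 / c) * (i%:R ^+ 3)^-1.
Proof.
move=> Cn0 C0 a08 i2 ll1 hij kt0 hA.
have i_gt0 : 0 < i%:R :> R by rewrite ltr0n (leq_trans _ i2).
have s0 := scale_gt0 j.
have s1 : (scale j)^-1 <= 2 ^+ i.+1 / c.
  rewrite -[leRHS]invrK lef_pV2 ?posrE ?invr_gt0 ?divr_gt0 ?exprn_gt0// invf_div.
  exact: le_trans (min_scale_ge i2) hij.
have L1 : ln (scale j)^-1 <= log_level i j by rewrite le_max lexx.
have L2 : ln (ln (2 ^+ i)) <= log_level i j by rewrite le_max lexx orbT.
have e1 : (scale j)^-1 * expR (- (a0 * log_level i j / 2)) <= 8 * (i%:R ^+ 3)^-1.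
  rewrite -[(scale j)^-1]lnK ?posrE ?invr_gt0// -expRD.
  apply: (@le_trans _ _ (expR (- (3 * ln (ln (2 ^+ i)))))).
    rewrite ler_expR; have : 8 * log_level i j <= a0 * log_level i j.
      by rewrite ler_wpM2r//; lra.
    by lra.
  have l0 : 0 < ln (2 ^+ i) :> R.
    by rewrite ln_pow2 mulr_gt0//; exact: lt_le_trans (ln2_ge_half R).
  rewrite expRN expRM_natl lnK ?posrE// ln_pow2 exprMn invfM mulrC ler_pM2r ?invr_gt0 ?exprn_gt0//.
  rewrite -[leRHS]invrK lef_pV2 ?posrE ?exprn_gt0 ?invr_gt0//; last exact: lt_le_trans (ln2_ge_half R).
  have -> : (8^-1 : R) = 2^-1 ^+ 3 by field.
  by rewrite lerXn2r ?nnegrE ?ln2_ge_half// (le_trans _ (ln2_ge_half R)).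
have e2 : (scale j)^-1 * expR (- (A / (8 * kt ^+ 2))) <= 2 / c * (i%:R ^+ 3)^-1.
  apply: (@le_trans _ _ (2 ^+ i.+1 / c * expR (- (4 * i%:R)))).
    by rewrite ler_pM ?invr_ge0 ?expR_ge0 ?(ltW s0)// ler_expR lerN2.
  rewrite exprS; set E := expR _.
  rewrite (_ : 2 * 2 ^+ i / c * E = 2 / c * (2 ^+ i * E)); last by ring.
  rewrite ler_pM2l ?divr_gt0// /E.
  apply: (@le_trans _ _ (expR i%:R * expR (- (4 * i%:R)))).
    by rewrite ler_pM2r ?expR_gt0// pow2_le_expR.
  rewrite -expRD; apply: le_trans (expRN_le_cube i_gt0).
  by rewrite ler_expR; lra.
move: e1 e2; set E1 := expR _; set E2 := expR _; set X := (i%:R ^+ 3)^-1 => e1 e2.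
have -> : Cn / scale j * (4 * C * E1 + 4 * E2) =
    Cn * (4 * C * ((scale j)^-1 * E1) + 4 * ((scale j)^-1 * E2)) by ring.
have -> : Cn * (32 * C + 8 / c) * X = Cn * (4 * C * (8 * X) + 4 * (2 / c * X)) by ring.
by rewrite ler_wpM2l// lerD// ler_wpM2l// mulr_ge0.
Qed.

End scales.

Lemma min_scale_gt0 (R : realType) (c gamma : R) i : 0 < c -> (1 <= i)%N ->
  0 < min_scale c gamma i.
Proof.
move=> c0 i1; rewrite mulr_gt0// powR_gt0// divr_gt0// ?exprn_gt0// ln_pow2 mulr_gt0 ?ltr0n//.
by apply: lt_le_trans (ln2_ge_half R).
Qed.

Lemma min_scale_le (R : realType) (c gamma : R) i n h : 0 < c -> 0 <= gamma ->
  (1 <= i)%N -> (2 ^ i <= n <= 2 ^ i.+1)%N ->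
  c * (ln n%:R / n%:R) `^ gamma <= h -> min_scale c gamma i <= h.
Proof.
move=> c_gt0 g0 i1 /andP[n1 n2]; apply: le_trans; rewrite ler_pM2l//.
have pn1 : (2 ^+ i <= n%:R :> R)%R by rewrite -natrX ler_nat.
have pn2 : (n%:R <= 2 ^+ i.+1 :> R)%R by rewrite -natrX ler_nat.
have pi_gt0 : (0 < 2 ^+ i :> R)%R by rewrite exprn_gt0.
have n_gt0 : (0 < n%:R :> R)%R by exact: lt_le_trans pn1.
have lni : (0 < ln (2 ^+ i) :> R)%R.
  by rewrite ln_pow2 mulr_gt0 ?ltr0n//; apply: lt_le_trans (ln2_ge_half R).
have lnn : (ln (2 ^+ i) <= ln n%:R :> R)%R by rewrite ler_ln// posrE.
apply: ge0_ler_powR; rewrite // ?nnegrE.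
- by rewrite divr_ge0 ?exprn_ge0// ltW.
- by rewrite divr_ge0 ?(ltW n_gt0)// (le_trans _ lnn)// ltW.
- by rewrite ler_pM// ?invr_ge0 ?(ltW lni) ?exprn_ge0// lef_pV2 ?posrE ?exprn_gt0.
Qed.

(** * Uniform deviations over a dyadic block *)

Section block_deviation.
Local Open Scope ereal_scope.
Context (R : realType) dO (Omega : measurableType dO) (P : probability Omega R)
  (r d : nat).
Let T : measurableType _ := ('rV[R]_r * 'rV[R]_d)%type.
Variable W : nat -> Omega -> T.
Hypothesis mW : forall i, measurable_fun setT (W i).
Hypothesis W_indep : mutually_independent P W.
Hypothesis W_id : identically_distributed P W.
Variables (phi : nat -> 'rV[R]_r -> R) (F : 'rV[R]_r -> R).
Variables (k : nat -> 'rV[R]_d -> R) (kappa : R).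
Hypotheses (mphi : forall a, measurable_fun setT (phi a)) (mF : measurable_fun setT F).
Hypothesis mk : forall b, measurable_fun setT (k b).
Hypothesis phi_le : forall a y, (`|phi a y| <= F y)%R.
Hypothesis k_le : forall b x, (`|k b x| <= kappa)%R.
Hypothesis kappa_gt0 : (0 < kappa)%R.
Variables (C1 nu1 C2 nu2 : R).
Hypotheses (C1_ge0 : (0 <= C1)%R) (C2_ge0 : (0 <= C2)%R)
  (nu1_ge0 : (0 <= nu1)%R) (nu2_ge0 : (0 <= nu2)%R).
Hypothesis phi_entropy : weighted_entropy phi F C1 nu1.
Hypothesis k_entropy : weighted_entropy k (fun=> kappa) C2 nu2.
Variables (h0 c gamma MI : R).
Hypotheses (d_gt0 : (0 < d)%N) (h0_gt0 : (0 < h0)%R) (c_gt0 : (0 < c)%R)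
  (gamma_itv : (0 < gamma <= 1)%R) (MI_gt0 : (0 < MI)%R).
Variables (J' : set 'rV[R]_d) (tau : nat -> R) (Vd c1 : R).
Hypotheses (mJ' : measurable J') (tau_gt0 : forall i, (0 < tau i)%R)
  (Vd_ge0 : (0 <= Vd)%R) (c1_gt0 : (0 < c1)%R).
Hypothesis second_moment : forall i cen s, (0 <= s)%R ->
  \int[P]_w (F (W 0 w).1 ^+ 2 * cutoff F (tau i) (J' `&` box cen s) (W 0 w))%:E <=
  (Vd * (2 * s) ^+ d)%:E.
Hypothesis scale_tau : forall i h, (1 <= i)%N -> (min_scale c gamma i <= h)%R ->
  (c1 * i%:R * tau i ^+ 2 <= 2 ^+ i.+1 * h)%R.

(** The bad set is the union, over the levels and over the cubes of a grid, of
    the deviation events of the class localized to a cube. Off this set, [h] has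
    a level [j] with [h <= scale j <= 2 * h], and [x] lies in a grid cube; the
    kernel is supported in the enlarged cube, so that the product is a pointwise
    limit of the class localized there. *)
Lemma block_deviation : exists (B : nat -> set Omega) (Cb E : R) (i1 : nat),
  [/\ forall i, measurable (B i),
      forall i, (i1 <= i)%N -> P (B i) <= (Cb * (i%:R ^+ 2)^-1)%:E,
      (0 <= E)%R &
      forall i w n h (x : 'rV[R]_d) (f1 : 'rV[R]_r -> R) (f2 : 'rV[R]_d -> R)
        (a b : nat -> nat),
        (i1 <= i)%N -> ~ B i w -> (2 ^ i <= n <= 2 ^ i.+1)%N ->
        (c * (ln n%:R / n%:R) `^ gamma <= h <= h0)%R ->
        (forall l, `|x ord0 l| <= MI)%R ->
        (forall y, phi (a l) y @[l --> \oo] --> f1 y) ->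
        (forall u, k (b l) u @[l --> \oo] --> f2 u) ->
        (forall u, f2 u != 0%R ->
          J' u /\ forall l, (`|u ord0 l - x ord0 l| <= h `^ d%:R^-1 / 2)%R) ->
        (`|centered_sum P W
           (fun t => \1_[set y | F y <= tau i] t.1 * f1 t.1 * f2 t.2) n w| <=
         E * normalizer n h)%R].
Proof.
pose C := (C1 * C2 * 2^-1 `^ (- (nu1 + nu2)))%R.
have C_ge0 : (0 <= C)%R by rewrite mulr_ge0 ?powR_ge0// mulr_ge0.
(* [D] is large enough for the level [Acl] to dominate both the bound
   [kappa * tau] and the variance term: see [D1] and [D2]. The constant [a0]
   serves the summability over the levels and the entropy. *)
pose D := (32 * kappa ^+ 2 / c1 + 8 * kappa ^+ 2 * Vd * 4 ^+ d)%R.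
pose a0 := (8 + 2 * (nu1 + nu2 + 1) * ln 2 : R)%R.
have ln2_gt0 : (0 < ln 2 :> R)%R by apply: lt_le_trans (ln2_ge_half R).
have kappa2 : (0 < kappa ^+ 2)%R by rewrite exprn_gt0.
have a0_ge8 : (8 <= a0)%R.
  by rewrite lerDl mulr_ge0 ?(ltW ln2_gt0)// mulr_ge0// addr_ge0// addr_ge0.
have a0_ge : (2 * (nu1 + nu2 + 1) * ln 2 <= a0)%R by rewrite lerDr.
have D1 : (32 * kappa ^+ 2 <= D * c1)%R.
  rewrite /D [leRHS]mulrDl divfK ?gt_eqF// lerDl.
  apply: mulr_ge0; last exact: ltW.
  apply: mulr_ge0; last by rewrite exprn_ge0.
  by apply: mulr_ge0 => //; rewrite mulr_ge0// ltW.
have D2 : (8 * kappa ^+ 2 * Vd * 4 ^+ d <= D)%R.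
  by rewrite lerDr divr_ge0 ?(ltW c1_gt0)// mulr_ge0// ltW.
have D_gt0 : (0 < D)%R.
  by rewrite -(pmulr_lgt0 _ c1_gt0); apply: lt_le_trans D1; rewrite mulr_gt0.
pose sc := scale h0; pose Q j cen := J' `&` box cen (2 * side d h0 j)%R.
pose lv := log_level h0.
pose Acl i j : R := (D * 2 ^+ i.+1 * sc j)%R.
pose dev i j cen : set Omega := deviation P W (local_product phi F k (tau i) (Q j cen))
  (2 ^ i.+1) (40 * Num.sqrt (a0 * lv i j * Acl i j))%R.
have mQ j cen : measurable (Q j cen) by apply: measurableI => //; exact: measurable_box.
have mdev i j cen : measurable (dev i j cen).
  by apply: measurable_deviation => // q; exact: measurable_local_product.
have [L Lsize Lnet] : exists2 L : nat -> seq 'rV[R]_d,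
    forall j, ((size (L j))%:R <= (2 * MI + side d h0 0) ^+ d / scale h0 j)%R &
    forall j (x : 'rV[R]_d), (forall i, `|x ord0 i| <= MI)%R ->
      exists2 cen, cen \in L j & box cen (side d h0 j) x.
  have ex j : exists L : seq 'rV[R]_d,
      ((size L)%:R <= ((2 * MI + side d h0 j) / side d h0 j) ^+ d)%R /\
      forall x : 'rV[R]_d, (forall i, `|x ord0 i| <= MI)%R ->
        exists2 cen, cen \in L & box cen (side d h0 j) x.
    by apply: grid => //; exact: side_gt0.
  have [L hL] := choice ex; exists L => j; last by have [] := hL j.
  by have [hj _] := hL j; exact: (grid_size d_gt0 h0_gt0 MI_gt0 hj).
have [J0 hJ0] := max_level h0 c_gt0 gamma_itv.
have [i1 i1_ge2 hi1] := loglog_large R.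
pose Cn := ((2 * MI + side d h0 0) ^+ d)%R.
have Cn_ge0 : (0 <= Cn)%R.
  by rewrite exprn_ge0// addr_ge0 ?mulr_ge0 ?(ltW MI_gt0) ?ltW// side_gt0.
pose B i := \big[setU/set0]_(j < i + J0 | (min_scale c gamma i <= sc j)%R)
  \big[setU/set0]_(cen <- L j) dev i j cen.
pose C3 := (Cn * (32 * C + 8 / c))%R.
have C3_ge0 : (0 <= C3)%R.
  by rewrite mulr_ge0// addr_ge0// mulr_ge0// invr_ge0 ltW.
exists B, (C3 * (1 + J0%:R))%R, (80 * Num.sqrt (a0 * D))%R, i1; split.
- by move=> i; apply: bigsetU_measurable => j _; apply: bigsetU_measurable.
- move=> i ii1; have i2 : (2 <= i)%N by exact: leq_trans ii1.
  have i_gt0 : (0 < i%:R :> R)%R by rewrite ltr0n (leq_trans _ i2).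
  have ll1 := hi1 _ ii1.
  have level (j : 'I_(i + J0)) : (min_scale c gamma i <= sc j)%R ->
      P (\big[setU/set0]_(cen <- L j) dev i j cen) <= (C3 * (i%:R ^+ 3)^-1)%:E.
    move=> hij.
    have lv1 : (1 <= lv i j)%R by apply: (le_trans ll1); rewrite le_max lexx orbT.
    have hst := scale_tau (ltnW i2) hij.
    have kt0 : (0 < kappa * tau i)%R by rewrite mulr_gt0.
    have Akt : (32 * kappa ^+ 2 * i%:R * tau i ^+ 2 <= Acl i j)%R.
      apply: (@le_trans _ _ (D * (c1 * i%:R * tau i ^+ 2))%R).
        rewrite (_ : D * _ = D * c1 * (i%:R * tau i ^+ 2))%R; last by ring.
        by rewrite -[leLHS]mulrA ler_wpM2r// mulr_ge0 ?sqr_ge0.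
      by rewrite /Acl -[leRHS]mulrA ler_pM2l.
    have A4 : (4 * i%:R <= Acl i j / (8 * (kappa * tau i) ^+ 2))%R.
      rewrite ler_pdivlMr ?mulr_gt0 ?exprn_gt0//; apply: le_trans Akt.
      by rewrite exprMn le_eqVlt; apply/orP; left; apply/eqP; ring.
    have A16 : (16 * (kappa * tau i) ^+ 2 <= Acl i j)%R.
      apply: le_trans Akt; rewrite exprMn mulrA.
      have : (1 <= i%:R :> R)%R by rewrite ler1n (leq_trans _ i2).
      have kt2 : (0 <= kappa ^+ 2 * tau i ^+ 2)%R by rewrite mulr_ge0 ?sqr_ge0.
      move=> /(ler_wpM2l kt2) => h.
      rewrite (_ : 16 * kappa ^+ 2 * tau i ^+ 2 = 16 * (kappa ^+ 2 * tau i ^+ 2))%R; last by ring.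
      rewrite (_ : 32 * kappa ^+ 2 * i%:R * tau i ^+ 2 = 32 * (kappa ^+ 2 * tau i ^+ 2 * i%:R))%R; last by ring.
      lra.
    have one cen : P (dev i j cen) <= (4 * C * expR (- (a0 * lv i j / 2)) +
        4 * expR (- (Acl i j / (8 * (kappa * tau i) ^+ 2))))%:E.
      have s0 : (0 <= 2 * side d h0 j)%R by rewrite mulr_ge0// ltW// side_gt0.
      apply: (local_class_deviation mW W_indep W_id mphi mF mk phi_le k_le kappa_gt0
        C1_ge0 C2_ge0 phi_entropy k_entropy (mQ j cen) (tau_gt0 i) (second_moment i cen s0)).
      - rewrite !exprMn sideX// natrX /Acl.
        apply: (@le_trans _ _ ((8 * kappa ^+ 2 * Vd * 4 ^+ d) * 2 ^+ i.+1 * sc j)%R).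
          rewrite (_ : 4 = 2 * 2 :> R)%R; last by ring.
          by rewrite exprMn le_eqVlt; apply/orP; left; apply/eqP; rewrite /sc; ring.
        by rewrite ler_pM2r ?scale_gt0// ler_pM2r ?exprn_gt0.
      - exact: A16.
      - by rewrite -[leLHS]mul1r ler_pM//; lra.
      - apply: (le_trans a0_ge); rewrite -[leLHS]mulr1 ler_wpM2l//; lra.
    apply: (le_trans (measure_bigsetU_le _ _ _ (mdev i j))).
    apply: (@le_trans _ _ (\sum_(cen <- L j) (4 * C * expR (- (a0 * lv i j / 2)) +
        4 * expR (- (Acl i j / (8 * (kappa * tau i) ^+ 2))))%:E)).
      by apply: lee_sum => cen _; exact: one.
    rewrite sumEFin lee_fin big_const_seq count_predT iter_addr addr0.
    have := level_cost h0_gt0 c_gt0 gamma_itv Cn_ge0 C_ge0 a0_ge8 i2 ll1 hij kt0 A4.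
    apply: le_trans; rewrite -[leLHS]mulr_natl ler_wpM2r//.
    by rewrite addr_ge0// !mulr_ge0// expR_ge0.
  apply: (le_trans (measure_bigsetU_le _ _ _ _)).
    by move=> j; apply: bigsetU_measurable => cen _.
  apply: (@le_trans _ _ (\sum_(j < i + J0 | (min_scale c gamma i <= sc j)%R) (C3 * (i%:R ^+ 3)^-1)%:E)).
    by apply: lee_sum => j hij; exact: level.
  rewrite sumEFin lee_fin.
  apply: (@le_trans _ _ (\sum_(j < i + J0) (C3 * (i%:R ^+ 3)^-1))%R).
    rewrite [leRHS](bigID (fun j : 'I_(i + J0) => min_scale c gamma i <= sc j)%R)/= lerDl.
    by apply: sumr_ge0 => j _; rewrite mulr_ge0// invr_ge0 exprn_ge0.
  rewrite big_const_ord iter_addr addr0 -[leLHS]mulr_natl natrD.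
  rewrite (_ : C3 * (1 + J0%:R) * (i%:R ^+ 2)^-1 = (i%:R + J0%:R * i%:R) * (C3 * (i%:R ^+ 3)^-1))%R; last first.
    by field; rewrite gt_eqF.
  have X0 : (0 <= C3 * (i%:R ^+ 3)^-1)%R by rewrite mulr_ge0// invr_ge0 exprn_ge0.
  rewrite ler_wpM2r//.
  by rewrite lerD2l ler_peMr// ler1n (leq_trans _ i2).
- by rewrite mulr_ge0// sqrtr_ge0.
move=> i w n h x f1 f2 a b ii1 nB /andP[n1 n2] /andP[ch hh0] xM lf1 lf2 f2supp.
have i2 : (2 <= i)%N by exact: leq_trans ii1.
have ll1 := hi1 _ ii1.
have pn1 : (2 ^+ i <= n%:R :> R)%R by rewrite -natrX ler_nat.
have pn2 : (n%:R <= 2 ^+ i.+1 :> R)%R by rewrite -natrX ler_nat.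
have pi_gt0 : (0 < 2 ^+ i :> R)%R by rewrite exprn_gt0.
have n_gt0 : (0 < n%:R :> R)%R by exact: lt_le_trans pn1.
have lni : (0 < ln (2 ^+ i) :> R)%R by rewrite ln_pow2 mulr_gt0// ltr0n (leq_trans _ i2).
have lnn : (ln (2 ^+ i) <= ln n%:R :> R)%R by rewrite ler_ln// posrE.
have hmin : (min_scale c gamma i <= h)%R.
  have [/ltW g0 _] := andP gamma_itv.
  by apply: min_scale_le (ltnW i2) _ ch => //; rewrite n1.
have h_gt0 : (0 < h)%R.
  by apply: lt_le_trans hmin; apply: min_scale_gt0 => //; exact: ltnW.
(* The level of [h] is found as the last one that is at least [h]. *)
have [j hj1 hj2] : exists2 j, (h <= sc j)%R & (sc j <= 2 * h)%R.
  have ex : exists j, (sc j < h)%R.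
    exists (Num.truncn (h0 / h)).+1; rewrite /sc /scale ltr_pdivrMr ?exprn_gt0// mulrC.
    rewrite -ltr_pdivrMr//; apply: (lt_le_trans (real_truncnS_gt (num_real _))).
    by rewrite -natrX ler_nat; exact/ltnW/ltn_expl.
  have := ex_minnP ex => -[[|j] hj minj].
    by move: hj; rewrite /sc /scale expr0 divr1 ltNge hh0.
  exists j; first by rewrite leNgt; apply/negP => /minj; rewrite ltnn.
  apply/ltW; move: hj; rewrite /sc /scale exprS invfM => hj.
  by rewrite -ltr_pdivrMl// mulrCA.
have hij : (min_scale c gamma i <= sc j)%R by exact: le_trans hj1.
have [cen cenL xcen] := Lnet j x xM.
have ndev : ~ dev i j cen w.
  move=> hdev; apply: nB; have jlt := hJ0 _ _ i2 hij.
  apply: (@mem_bigsetU _ _ _ _ _ (Ordinal jlt)); rewrite ?mem_index_enum//.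
  exact: mem_bigsetU hdev.
have fE t : (\1_[set y | F y <= tau i] t.1 * f1 t.1 * f2 t.2 =
    cutoff F (tau i) (Q j cen) t * f1 t.1 * f2 t.2)%R.
  have [->|f20] := eqVneq (f2 t.2) 0%R; first by rewrite !mulr0.
  congr (_ * _ * _)%R; rewrite /cutoff.
  rewrite [X in (_ = _ * X)%R]indicE mem_set ?mulr1//.
  have [Jt hx] := f2supp _ f20; split => // l.
  have := xcen l; have := hx l.
  have hs : (h `^ d%:R^-1 <= side d h0 j)%R.
    by apply: ge0_ler_powR; rewrite ?invr_ge0 ?nnegrE// ltW// scale_gt0.
  have := ler_normD (t.2 ord0 l - x ord0 l)%R (x ord0 l - cen ord0 l)%R.
  rewrite addrA subrK; have := side_gt0 d h0_gt0 j.
  by lra.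
have kt0 : (0 < kappa * tau i)%R by rewrite mulr_gt0.
have lim t : local_product phi F k (tau i) (Q j cen) (a l, b l) t @[l --> \oo] -->
    (\1_[set y | F y <= tau i] t.1 * f1 t.1 * f2 t.2)%R.
  rewrite fE; apply: cvgM; last exact: lf2.
  by apply: cvgM; [exact: cvg_cst|exact: lf1].
have := deviation_limit mW (b := (kappa * tau i)%R) _ _ lim ndev n2.
move=> /(_ _ _) /le_trans; apply.
- by move=> q; exact: measurable_local_product.
- by move=> q t; rewrite (le_trans (local_product_le phi_le k_le _ _ _ _))// local_envelope_le.
pose M := (Num.max (ln h^-1) (ln (ln n%:R)) : R)%R.
have lvM : (lv i j <= M)%R.
  rewrite /lv /log_level ge_max; apply/andP; split; rewrite le_max.
    by apply/orP; left; rewrite ler_ln ?posrE ?invr_gt0 ?scale_gt0// lef_pV2 ?posrE// scale_gt0.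
  by apply/orP; right; rewrite ler_ln ?posrE// (lt_le_trans lni).
have lv0 : (0 <= lv i j)%R by rewrite (le_trans _ (le_trans ll1 _))// le_max lexx orbT.
have M0 : (0 <= M)%R by exact: le_trans lvM.
have a00 : (0 <= a0)%R by rewrite (le_trans _ a0_ge8).
rewrite /normalizer -/M (_ : 80 = 40 * Num.sqrt (2 ^+ 2) :> R)%R; last first.
  by rewrite sqrtr_sqr ger0_norm//; ring.
rewrite -!mulrA ler_pM2l// -!sqrtrM ?sqr_ge0 ?mulr_ge0 ?(ltW D_gt0)//.
apply: ler_wsqrtr; rewrite /Acl.
rewrite (_ : _ * (_ * _) = a0 * D * (lv i j * (2 ^+ i.+1 * sc j)))%R; last by ring.
rewrite (_ : _ ^+ 2 * _ = a0 * D * (M * ((2 * n%:R) * (2 * h))))%R; last by ring.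
have sc0 : (0 <= sc j)%R by exact/ltW/scale_gt0.
have p0 : (0 <= 2 ^+ i.+1 :> R)%R by rewrite exprn_ge0.
rewrite ler_wpM2l ?mulr_ge0 ?(ltW D_gt0)//.
apply: ler_pM => //; first exact: mulr_ge0.
by apply: ler_pM => //; rewrite exprS ler_pM2l.
Qed.

End block_deviation.

(** * Truncation levels under a moment condition *)

Section moment_truncation.
Variables (R : realType) (p : R).
Hypothesis p_gt2 : 2 < p.

(** With this truncation level the truncated variables are small enough for
    exponential inequalities at the smallest bandwidths, and what is cut off
    has mean of the order of the normalization. *)
Definition trunc_level i : R := (2 ^+ i / i.+1%:R) `^ p^-1.

Let p_gt0 : 0 < p. Proof. by apply: lt_trans p_gt2. Qed.

Let q_gt0 i : 0 < 2 ^+ i / i.+1%:R :> R.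
Proof. by rewrite divr_gt0 ?exprn_gt0// ltr0n. Qed.

Lemma trunc_level_gt0 i : 0 < trunc_level i.
Proof. by rewrite powR_gt0. Qed.

Lemma trunc_level_powR i s : trunc_level i `^ s = expR (s / p * ln (2 ^+ i / i.+1%:R)).
Proof.
by rewrite -powRrM /powR gt_eqF//; congr (expR (_ * _)); rewrite mulrC.
Qed.

Lemma trunc_level_mean i :
  2 ^+ i.+1 * trunc_level i `^ (1 - p) = 2 * (i.+1%:R * trunc_level i).
Proof.
have tE : trunc_level i = expR (1 / p * ln (2 ^+ i / i.+1%:R)).
  by rewrite -trunc_level_powR powRr1// ltW// trunc_level_gt0.
rewrite trunc_level_powR [in RHS]tE.
have -> : (1 - p) / p * ln (2 ^+ i / i.+1%:R) =
    1 / p * ln (2 ^+ i / i.+1%:R) - ln (2 ^+ i / i.+1%:R) :> R.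
  by field; rewrite gt_eqF.
rewrite expRD expRN lnK ?posrE// invf_div exprS.
by field; rewrite expf_neq0.
Qed.

Lemma trunc_level_cap i :
  Num.sqrt i.+1%:R * ((2 ^+ i) `^ p^-1) <= i.+1%:R * trunc_level i.
Proof.
have i0 : 0 < i.+1%:R :> R by rewrite ltr0n.
have two0 : 0 < 2 ^+ i :> R by rewrite exprn_gt0.
rewrite /trunc_level powRM ?invr_ge0 ?exprn_ge0//.
rewrite [leLHS]mulrC [leRHS]mulrCA ler_pM2l ?powR_gt0//.
have i1 : 1 <= i.+1%:R :> R by rewrite ler1n.
have -> : Num.sqrt i.+1%:R = i.+1%:R `^ (1 / 2) :> R by rewrite div1r powR12_sqrt.
rewrite -[i.+1%:R^-1]powR_inv1 ?ler0n// -powRrM.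
rewrite -[X in _ <= X * _]powRr1 ?ler0n// -powRD; last by rewrite (gt_eqF i0) implybT.
apply: ler_powR => //.
have : p^-1 <= 2^-1 by rewrite lef_pV2 ?posrE// ltW.
lra.
Qed.

Lemma trunc_level_sqr_le i : trunc_level i ^+ 2 <= expR (2 / p * (i%:R * ln 2)).
Proof.
rewrite -powR_mulrn ?powR_ge0// trunc_level_powR ler_expR.
rewrite ler_wpM2l ?divr_ge0 ?(ltW p_gt0)// -ln_pow2 ler_ln ?posrE ?exprn_gt0//.
by rewrite ler_pdivrMr ?ltr0n// ler_peMr ?exprn_ge0// ler1n.
Qed.

Variables (c gamma : R).
Hypotheses (c_gt0 : 0 < c) (gammaE : gamma = 1 - 2 / p).

Lemma gamma_moment_itv : 0 < gamma <= 1.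
Proof.
rewrite gammaE; apply/andP; split; last by rewrite gerBl divr_ge0// ltW.
by rewrite subr_gt0 ltr_pdivrMr// mul1r.
Qed.

Let c1 := 2 * c * (ln 2 / 4) `^ gamma.

Let ln2_gt0 : 0 < ln 2 :> R.
Proof. exact: lt_le_trans (ln2_ge_half R). Qed.

Lemma trunc_level_scale : exists2 c1 : R, 0 < c1 & forall i h, (1 <= i)%N ->
  min_scale c gamma i <= h -> c1 * i%:R * trunc_level i ^+ 2 <= 2 ^+ i.+1 * h.
Proof.
exists c1; first by rewrite mulr_gt0 ?mulr_gt0 ?powR_gt0// divr_gt0.
move=> i h i1 hh.
have two0 : 0 < 2 ^+ i :> R by rewrite exprn_gt0.
have iR1 : 1 <= i%:R :> R by rewrite ler1n.
have i0 : 0 < i.+1%:R :> R by rewrite ltr0n.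
apply: (@le_trans _ _ (2 ^+ i.+1 * min_scale c gamma i)); last by rewrite ler_pM2l ?exprn_gt0.
rewrite /min_scale ln_pow2.
have h1 : (ln 2 / 4 : R) * (2 ^+ i / i.+1%:R)^-1 <= i%:R * ln 2 / 2 ^+ i.+1.
  rewrite invf_div exprS.
  rewrite (_ : ln 2 / 4 * (i.+1%:R / 2 ^+ i) = i.+1%:R * (ln 2 / 4 / 2 ^+ i)); last by ring.
  rewrite (_ : i%:R * ln 2 / (2 * 2 ^+ i) = (2 * i%:R) * (ln 2 / 4 / 2 ^+ i)); last by field; rewrite gt_eqF.
  by rewrite ler_pM2r ?divr_gt0// -natr1; lra.
have [g0 g1] := andP gamma_moment_itv.
have h2 : (ln 2 / 4 * (2 ^+ i / i.+1%:R)^-1) `^ gamma <= (i%:R * ln 2 / 2 ^+ i.+1) `^ gamma.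
  apply: ge0_ler_powR => //; first exact: ltW.
    by rewrite nnegrE mulr_ge0 ?divr_ge0 ?invr_ge0 ?(ltW ln2_gt0) ?(ltW (q_gt0 i)).
  by rewrite nnegrE divr_ge0 ?mulr_ge0 ?(ltW ln2_gt0) ?exprn_ge0.
apply: (@le_trans _ _ (2 ^+ i.+1 * (c * (ln 2 / 4 * (2 ^+ i / i.+1%:R)^-1) `^ gamma))); last first.
  by rewrite ler_pM2l ?exprn_gt0// ler_pM2l.
rewrite powRM ?invr_ge0 ?divr_ge0 ?(ltW ln2_gt0) ?(ltW two0) ?(ltW i0)//.
have -> : (2 ^+ i / i.+1%:R)^-1 `^ gamma = i.+1%:R / 2 ^+ i * trunc_level i ^+ 2.
  rewrite -powR_mulrn ?powR_ge0// trunc_level_powR.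
  rewrite {1}/powR gt_eqF ?invr_gt0// lnV ?posrE// gammaE.
  have -> : (1 - 2 / p) * - ln (2 ^+ i / i.+1%:R) =
     - ln (2 ^+ i / i.+1%:R) + 2 / p * ln (2 ^+ i / i.+1%:R) :> R by ring.
  by rewrite expRD expRN lnK ?posrE// invf_div.
rewrite /c1 [2 ^+ i.+1]exprS.
rewrite [leRHS](_ : _ = 2 * c * (ln 2 / 4) `^ gamma * i.+1%:R * trunc_level i ^+ 2); last first.
  by field; rewrite gt_eqF.
rewrite ler_wpM2r ?sqr_ge0// ler_pM2l ?ler_nat//.
by rewrite mulr_gt0 ?mulr_gt0 ?powR_gt0// divr_gt0.
Qed.

(** Either [h] is smaller than a negative power of [2 ^ i], and [log (1 / h)] is
    of order [i], or the factor [n * h] exceeds the square of the truncation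
    level by a power of [2 ^ i], as [2 / p + gamma = 1]. *)
Lemma trunc_level_normalizer : exists (C5 : R) (i2 : nat), 0 <= C5 /\
  forall i n h, (i2 <= i)%N -> (2 ^ i <= n)%N -> min_scale c gamma i <= h ->
    i.+1%:R * trunc_level i <= C5 * normalizer n h.
Proof.
have [c1' c10 hc1] := trunc_level_scale.
have [i1 i12 hi1] := loglog_large R.
have [g0 g1] := andP gamma_moment_itv.
pose e := gamma / 2; have e0 : 0 < e by rewrite divr_gt0.
pose A := 8 / (c1' * (e * ln 2)) + 16 / (e * ln 2) ^+ 2.
have A1 : 0 <= 8 / (c1' * (e * ln 2)) by rewrite divr_ge0// !mulr_ge0// ltW.
have A2 : 0 <= 16 / (e * ln 2) ^+ 2 by rewrite divr_ge0// sqr_ge0.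
have A0 : 0 <= A by rewrite addr_ge0.
exists (Num.sqrt A), i1; split; first exact: sqrtr_ge0.
move=> i n h ii1 ni hh.
have i2 : (2 <= i)%N by exact: leq_trans ii1.
have iR : 1 <= i%:R :> R by rewrite ler1n (leq_trans _ i2).
have ll1 := hi1 _ ii1.
have pn : 2 ^+ i <= n%:R :> R by rewrite -natrX ler_nat.
have two0 : 0 < 2 ^+ i :> R by rewrite exprn_gt0.
have n0 : 0 < n%:R :> R by exact: lt_le_trans pn.
have lni : 0 < ln (2 ^+ i) :> R by rewrite ln_pow2 mulr_gt0// (lt_le_trans _ iR).
have lln : 1 <= ln (ln n%:R) :> R.
  apply: (le_trans ll1); have lnn : ln (2 ^+ i) <= ln n%:R :> R by rewrite ler_ln ?posrE.
  by rewrite ler_ln ?posrE// (lt_le_trans lni).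
have h_gt0 : 0 < h.
  by apply: lt_le_trans hh; rewrite mulr_gt0// powR_gt0// divr_gt0// exprn_gt0.
pose M := Num.max (ln h^-1) (ln (ln n%:R)) : R.
have M1 : 1 <= M by rewrite le_max lln orbT.
have t2 := sqr_ge0 (trunc_level i).
rewrite /normalizer -/M -sqrtrM//.
have it0 : 0 <= i.+1%:R * trunc_level i by rewrite mulr_ge0// ltW// trunc_level_gt0.
rewrite -(ger0_norm it0) -sqrtr_sqr; apply: ler_wsqrtr.
have nh0 : 0 <= n%:R * h by rewrite mulr_ge0// ltW.
have i4 : i.+1%:R ^+ 2 <= 4 * i%:R ^+ 2 :> R.
  by rewrite -natr1 !expr2; nra.
rewrite exprMn.
(* The choice [e = gamma / 2] leaves a factor [2 ^ (e * i)] for large [h]. *)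
have [hsmall|hbig] := leP h (expR (- (e * (i%:R * ln 2)))).
  have Mi : e * (i%:R * ln 2) <= M.
    apply: (@le_trans _ _ (ln h^-1)); last by rewrite le_max lexx.
    rewrite -[leLHS]expRK ler_ln ?posrE ?expR_gt0 ?invr_gt0//.
    by rewrite -[leLHS]invrK -expRN lef_pV2 ?posrE ?expR_gt0.
  have nh : c1' * i%:R * trunc_level i ^+ 2 <= 2 * (n%:R * h).
    apply: (le_trans (hc1 i h (ltnW i2) hh)); rewrite exprS -mulrA ler_pM2l// ler_pM2r//.
  apply: (@le_trans _ _ (8 / (c1' * (e * ln 2)) * (n%:R * h * M))); last first.
    by rewrite ler_wpM2r ?lerDl// mulr_ge0// (le_trans _ M1).
  have eln0 : 0 <= e * (i%:R * ln 2).
    by apply: mulr_ge0; [exact: ltW|apply: mulr_ge0 => //; exact: ltW].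
  have lhs0 : 0 <= c1' * i%:R * trunc_level i ^+ 2.
    by apply: mulr_ge0 => //; apply: mulr_ge0 => //; exact: ltW.
  have hprod := ler_pM lhs0 eln0 nh Mi.
  have k0 : 0 < c1' * (e * ln 2) by rewrite mulr_gt0// mulr_gt0.
  rewrite [leRHS]mulrAC ler_pdivlMr//.
  apply: (@le_trans _ _ (4 * i%:R ^+ 2 * trunc_level i ^+ 2 * (c1' * (e * ln 2)))).
    by apply: ler_wpM2r; [exact: ltW|exact: ler_wpM2r].
  rewrite (_ : 4 * i%:R ^+ 2 * trunc_level i ^+ 2 * (c1' * (e * ln 2)) =
    4 * (c1' * i%:R * trunc_level i ^+ 2 * (e * (i%:R * ln 2)))); last by ring.
  rewrite (_ : 8 * (n%:R * h * M) = 4 * (2 * (n%:R * h) * M)); last by ring.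
  by rewrite ler_pM2l.
apply: (@le_trans _ _ (16 / (e * ln 2) ^+ 2 * (n%:R * h * M))); last first.
  by rewrite ler_wpM2r ?lerDr// mulr_ge0// (le_trans _ M1).
have k0 : 0 < (e * ln 2) ^+ 2 by rewrite exprn_gt0// mulr_gt0.
have x0 : 0 <= e * (i%:R * ln 2).
  by apply: mulr_ge0; [exact: ltW|apply: mulr_ge0 => //; exact: ltW].
rewrite [leRHS]mulrAC ler_pdivlMr//.
apply: (@le_trans _ _ (4 * i%:R ^+ 2 * trunc_level i ^+ 2 * (e * ln 2) ^+ 2)).
  by apply: ler_wpM2r; [exact: ltW|exact: ler_wpM2r].
rewrite (_ : 4 * i%:R ^+ 2 * trunc_level i ^+ 2 * (e * ln 2) ^+ 2 =
  4 * ((e * (i%:R * ln 2)) ^+ 2 * trunc_level i ^+ 2)); last by ring.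
rewrite (_ : 16 * (n%:R * h * M) = 4 * (4 * (n%:R * h * M))); last by ring.
rewrite ler_pM2l//.
apply: (@le_trans _ _ (4 * expR (e * (i%:R * ln 2)) * expR (2 / p * (i%:R * ln 2)))).
  by apply: ler_pM; rewrite ?sqr_ge0// ?sqr_le_expR// trunc_level_sqr_le.
rewrite -mulrA ler_pM2l// -expRD.
have -> : e * (i%:R * ln 2) + 2 / p * (i%:R * ln 2) = i%:R * ln 2 - e * (i%:R * ln 2).
  by rewrite /e gammaE; field; rewrite gt_eqF.
rewrite expRD -ln_pow2 lnK ?posrE// ln_pow2.
apply: (@le_trans _ _ (n%:R * h)); last by rewrite ler_peMr.
by apply: ler_pM; rewrite ?expR_ge0 ?(ltW two0)// ltW.
Qed.

End moment_truncation.

(** * Excess over the truncation level *)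

Section excess.
Local Open Scope ereal_scope.
Context (R : realType) dO (Omega : measurableType dO) (P : probability Omega R)
  (r d : nat).
Let T : measurableType _ := ('rV[R]_r * 'rV[R]_d)%type.
Variables (F : 'rV[R]_r -> R) (J' : set 'rV[R]_d).
Hypotheses (mF : measurable_fun setT F) (F_nonneg : forall y, (0 <= F y)%R)
  (mJ' : measurable J').

(** What truncation at [tau] removes from the envelope over [J']. *)
Definition excess (tau : R) (t : T) : R :=
  (F t.1 * (1 - \1_[set y | F y <= tau] t.1) * \1_J' t.2)%R.

Lemma excess_ge0 tau t : (0 <= excess tau t)%R.
Proof.
rewrite /excess !indicE mulr_ge0// mulr_ge0//; by case: (_ \in _); rewrite ?subrr ?subr0.
Qed.

Lemma measurable_excess tau : measurable_fun setT (excess tau).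
Proof.
apply: measurable_funM; last by apply: measurableT_comp => //; exact: measurable_indic.
apply: measurable_funM; first exact: measurableT_comp.
apply: measurable_funB => //; apply: measurableT_comp => //.
exact: measurable_indic (measurable_sublevel mF tau).
Qed.

Variable W : nat -> Omega -> T.
Hypothesis mW : forall i, measurable_fun setT (W i).
Hypothesis W_indep : mutually_independent P W.
Hypothesis W_id : identically_distributed P W.
Variables (p alpha : R).
Hypotheses (p_gt2 : (2 < p)%R) (alpha_ge0 : (0 <= alpha)%R).
Let powerF (t : T) : R := (F t.1 `^ p * \1_J' t.2)%R.
Hypothesis moment : \int[P]_w (powerF (W 0 w))%:E <= alpha%:E.

Let p_gt0 : (0 < p)%R. Proof. by apply: lt_trans p_gt2. Qed.

Let powerF_ge0 t : (0 <= powerF t)%R.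
Proof. by rewrite /powerF mulr_ge0 ?powR_ge0// indicE. Qed.

Let mpowerF : measurable_fun setT powerF.
Proof.
apply: measurable_funM; last by apply: measurableT_comp => //; exact: measurable_indic.
have mFt : measurable_fun setT (fun t : T => F t.1) by exact: measurableT_comp.
have h := measurableT_comp (measurable_powR p) mFt; exact: h.
Qed.

Let tau := trunc_level p.

Let excess_le i t : (excess (tau i) t <= tau i `^ (1 - p) * powerF t)%R.
Proof.
have t0 := trunc_level_gt0 p i.
rewrite /excess /powerF mulrA; apply: ler_wpM2r; first by rewrite indicE.
rewrite indicE; case: (boolP (t.1 \in _)) => [_|].
  by rewrite subrr mulr0 mulr_ge0 ?powR_ge0.
rewrite notin_setE/= => /negP; rewrite -ltNge => tF; rewrite subr0 mulr1.
have F0 : (0 < F t.1)%R by exact: lt_trans tF.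
rewrite [leLHS](_ : _ = F t.1 `^ (1 - p) * F t.1 `^ p)%R; last first.
  by rewrite -powRD ?subrK ?powRr1// (gt_eqF F0) implybT.
apply: ler_wpM2r; rewrite ?powR_ge0//.
rewrite /powR !gt_eqF// ler_expR ler_wnM2l//; first by move: p_gt2; lra.
by rewrite ler_ln ?posrE// ltW.
Qed.

(** Above [tau] the envelope is at most [tau ^ (1 - p) * F ^ p]. *)
Lemma excess_mean i :
  \int[P]_w (excess (tau i) (W 0 w))%:E <= (tau i `^ (1 - p) * alpha)%:E.
Proof.
apply: (@le_trans _ _ (\int[P]_w ((tau i `^ (1 - p))%:E * (powerF (W 0 w))%:E))).
  apply: ge0_le_integral => //.
  - by move=> w _; rewrite lee_fin excess_ge0.
  - by apply/measurable_EFinP; exact: (measurableT_comp (measurable_excess _)).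
  - by apply/measurable_EFinP; apply: measurable_funM => //; exact: measurableT_comp.
  - by move=> w _; rewrite -EFinM lee_fin.
rewrite ge0_integralZl//; first by rewrite EFinM lee_wpmul2l// lee_fin powR_ge0.
- by apply/measurable_EFinP; exact: measurableT_comp.
- by move=> w _; rewrite lee_fin.
- by rewrite lee_fin powR_ge0.
Qed.

Lemma dyadic_sum_le (y : R) N : (0 <= y)%R ->
  (\sum_(i < N) 2 ^+ i.+1 * (2 ^+ i < y)%R%:R <= 4 * y)%R.
Proof.
move=> y0; elim: N => [|N IH]; first by rewrite big_ord0 mulr_ge0.
have [Ny|yN] := ltP (2 ^+ N)%R y; last first.
  by rewrite big_ord_recr/= ltNge yN/= mulr0 addr0.
apply: (@le_trans _ _ (\sum_(i < N.+1) 2 ^+ i.+1))%R.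
  by apply: ler_sum => i _; rewrite -[leRHS]mulr1 ler_pM2l ?exprn_gt0//; case: ltP.
have -> : (\sum_(i < N.+1) 2 ^+ i.+1 = 2 ^+ N.+2 - 2 :> R)%R.
  elim: N.+1 => [|m IHm]; first by rewrite big_ord0 expr1 subrr.
  by rewrite big_ord_recr/= IHm [in RHS]exprS; ring.
rewrite !exprS; lra.
Qed.

Let big i : set Omega := \big[setU/set0]_(l < 2 ^ i.+1) [set w | (2 ^+ i < powerF (W l w))%R].

Let mbig_atom i l : measurable [set w | (2 ^+ i < powerF (W l w))%R].
Proof.
rewrite (_ : [set _ | _] = (fun w => powerF (W l w)) @^-1` `](2 ^+ i)%R, +oo[).
  have m : measurable_fun setT (fun w => powerF (W l w)) by exact: measurableT_comp.
  by rewrite -[X in measurable X]setTI; exact: m.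
by apply/seteqP; split => w /=; rewrite in_itv/= andbT.
Qed.

(** An observation above [2 ^ i] occurs in the block [i] with probability at
    most [2 ^ i.+1 * P (powerF > 2 ^ i)], and these are summable since [powerF]
    is integrable. *)
Let big_rare : {ae P, forall w, exists i1, forall i, (i1 <= i)%N -> ~ big i w}.
Proof.
apply: (@borel_cantelli_ae _ _ _ _ _ (4 * alpha)%R).
  by move=> i; apply: bigsetU_measurable => l _.
move=> N.
have mtail i : measurable_fun setT (fun w => (2 ^+ i < powerF (W 0 w))%R%:R : R).
  rewrite (_ : (fun _ => _) = \1_[set w | (2 ^+ i < powerF (W 0 w))%R]).
    exact: measurable_indic.
  apply/funext => w; rewrite indicE; congr (nat_of_bool _)%:R%R.
  by apply/idP/idP; rewrite inE.
have mpow0 i : measurable [set t : T | (2 ^+ i < powerF t)%R].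
  rewrite (_ : [set _ | _] = powerF @^-1` `](2 ^+ i)%R, +oo[).
    by rewrite -[X in measurable X]setTI; exact: mpowerF.
  by apply/seteqP; split => w /=; rewrite in_itv/= andbT.
apply: (@le_trans _ _ (\sum_(i < N) \int[P]_w (2 ^+ i.+1 * (2 ^+ i < powerF (W 0 w))%R%:R)%:E)).
  apply: lee_sum => i _; apply: (le_trans (measure_bigsetU_le P _ _ (fun l : 'I_(2 ^ i.+1) => mbig_atom i l))).
  rewrite (eq_bigr (fun=> P [set w | (2 ^+ i < powerF (W 0 w))%R])); last first.
    by move=> l _; exact: (W_id l (mpow0 i)).
  under eq_integral do rewrite EFinM.
  rewrite ge0_integralZl//; last first.
    apply/measurable_EFinP; exact: mtail.
  rewrite (_ : \int[P]_w ((2 ^+ i < powerF (W 0 w))%R%:R)%:E = P [set w | (2 ^+ i < powerF (W 0 w))%R]).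
    have : P [set w | (2 ^+ i < powerF (W 0 w))%R] \is a fin_num by rewrite fin_num_measure.
    move=> /fineK <-; rewrite sumEFin -EFinM lee_fin.
    by rewrite big_const_ord iter_addr addr0 -[leLHS]mulr_natl natrX.
  rewrite -[RHS]mul1e -[X in _ = _ * P X]setIT -integral_indic// mul1e.
  apply: eq_integral => w _; rewrite indicE; congr ((nat_of_bool _)%:R%R)%:E.
  by apply/idP/idP; rewrite inE.
rewrite -ge0_integral_sum//; last first.
  by move=> i; apply/measurable_EFinP; apply: measurable_funM => //; exact: mtail.
apply: (@le_trans _ _ (\int[P]_w (4%:E * (powerF (W 0 w))%:E))).
  apply: ge0_le_integral => //.
  - move=> w _; apply: sume_ge0 => i _; rewrite lee_fin mulr_ge0// exprn_ge0//.
  - by apply: emeasurable_sum => i; apply/measurable_EFinP; apply: measurable_funM => //; exact: mtail.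
  - by apply/measurable_EFinP; apply: measurable_funM => //; exact: measurableT_comp.
  - by move=> w _; rewrite sumEFin -EFinM lee_fin dyadic_sum_le.
rewrite ge0_integralZl//; first by rewrite EFinM lee_wpmul2l.
- by apply/measurable_EFinP; exact: measurableT_comp.
- by move=> w _; rewrite lee_fin.
Qed.

Let cap i : R := ((2 ^+ i) `^ p^-1)%R.
Let capped i (t : T) : R := (excess (tau i) t * \1_[set y | F y <= cap i] t.1)%R.
Let level i : R := ((4 * alpha + 8) * (i.+1%:R * tau i))%R.
Let heavy i : set Omega := [set w | (level i < \sum_(l < 2 ^ i.+1) capped i (W l w))%R].

Let mcapped i : measurable_fun setT (capped i).
Proof.
apply: measurable_funM; first exact: measurable_excess.
apply: measurableT_comp => //; exact: measurable_indic (measurable_sublevel mF _).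
Qed.

Let cap_gt0 i : (0 < cap i)%R.
Proof. by rewrite powR_gt0// exprn_gt0. Qed.

Let capped_itv i t : (0 <= capped i t <= cap i)%R.
Proof.
rewrite /capped mulr_ge0 ?excess_ge0 ?indicE//=.
case: (boolP (t.1 \in _)); last by rewrite mulr0 ltW.
rewrite inE/= => Fc; rewrite mulr1 /excess !indicE.
apply: le_trans Fc; rewrite -[leRHS]mulr1 -mulrA ler_wpM2l//.
by case: (_ \in _); case: (_ \in _); rewrite /= ?subrr ?subr0 ?mul0r ?mulr0 ?mul1r.
Qed.

(** Below the cap the exponential inequality applies; the cap is smaller than
    the level by the factor [sqrt i], which makes the probabilities summable. *)
Let heavy_rare : {ae P, forall w, exists i1, forall i, (i1 <= i)%N -> ~ heavy i w}.
Proof.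
apply: (@borel_cantelli_inv_square _ _ _ _ _ 1%R 1).
  move=> i; rewrite (_ : heavy i =
      (fun w => (\sum_(l < 2 ^ i.+1) capped i (W l w))%R) @^-1` `](level i), +oo[).
    have m : measurable_fun setT (fun w => (\sum_(l < 2 ^ i.+1) capped i (W l w))%R).
      by apply: measurable_sum => l; exact: measurableT_comp.
    by rewrite -[X in measurable X]setTI; exact: m.
  by apply/seteqP; split => w /=; rewrite in_itv/= andbT.
move=> i i1.
have hv : \int[P]_w (capped i (W 0 w))%:E <= (tau i `^ (1 - p) * alpha)%:E.
  apply: le_trans (excess_mean i); apply: ge0_le_integral => //.
  - by move=> w _; rewrite lee_fin; have /andP[] := capped_itv i (W 0 w).
  - by apply/measurable_EFinP; exact: (measurableT_comp (mcapped i)).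
  - by apply/measurable_EFinP; exact: (measurableT_comp (measurable_excess _)).
  - move=> w _; rewrite lee_fin /capped -[leRHS]mulr1; apply: ler_wpM2l; first exact: excess_ge0.
    rewrite indicE; case: (_ \in _) => /=; lra. 
apply: (le_trans (chernoff_bounded mW W_indep W_id (level i) (2 ^ i.+1) (mcapped i)
  (cap_gt0 i) (capped_itv i) hv)).
rewrite lee_fin mul1r.
have s0 : (0 < Num.sqrt i.+1%:R :> R)%R by rewrite sqrtr_gt0 ltr0n.
apply: (@le_trans _ _ (expR (- (4 * Num.sqrt i.+1%:R)))%R).
  rewrite ler_expR lerN2 ler_pdivlMr ?mulr_gt0// natrX.
  rewrite (_ : 2 * 2 ^+ i.+1 * (tau i `^ (1 - p) * alpha) =
    2 * alpha * (2 ^+ i.+1 * tau i `^ (1 - p)))%R; last by ring.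
  rewrite trunc_level_mean// /level.
  rewrite (_ : _ - _ = 8 * (i.+1%:R * tau i))%R; last by rewrite /tau; ring.
  rewrite (_ : 4 * _ * _ = 8 * (Num.sqrt i.+1%:R * cap i))%R; last by ring.
  by rewrite ler_pM2l// trunc_level_cap.
apply: (le_trans (expRN_le_fourth s0)).
rewrite (_ : 4 = 2 * 2)%N// exprM sqr_sqrtr//.
rewrite lef_pV2 ?posrE ?exprn_gt0 ?ltr0n//.
by rewrite lerXn2r ?nnegrE// ler_nat.
Qed.

(** Above the cap [2 ^ (i / p)] there is eventually no observation at all;
    below it the exponential inequality for bounded nonnegative summands
    applies. *)
Lemma excess_sum : {ae P, forall w, exists i1, forall i, (i1 <= i)%N ->
  (\sum_(l < 2 ^ i.+1) excess (tau i) (W l w) <= level i)%R}.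
Proof.
apply: filterS2 big_rare heavy_rare => w [i1 h1] [i2 h2].
exists (maxn i1 i2) => i; rewrite geq_max => /andP[ii1 ii2].
have nh := h2 i ii2; rewrite leNgt; apply/negP => h; apply: nh.
apply: (lt_le_trans h); apply: ler_sum => l _.
have nb : ~ (2 ^+ i < powerF (W l w))%R.
  move=> hl; apply: (h1 i ii1).
  by apply: (@mem_bigsetU _ _ _ _ _ l) => //; rewrite mem_index_enum.
rewrite /capped; have [JW|nJ] := pselect (J' (W l w).2); last first.
  by rewrite /excess [\1_J' _]indicE memNset// ?mulr0 ?mul0r.
rewrite [X in (_ <= _ * X)%R]indicE mem_set ?mulr1//=.
move/negP : nb; rewrite -leNgt /powerF indicE mem_set// mulr1 => hF.
have := ge0_ler_powR (_ : 0 <= p^-1)%R.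
move=> /(_ _ (F (W l w).1 `^ p) (2 ^+ i))%R.
rewrite !nnegrE ?invr_ge0 ?powR_ge0 ?exprn_ge0 ?(ltW p_gt0)//.
move=> /(_ isT isT isT hF).
by rewrite -powRrM mulfV ?gt_eqF// powRr1.
Qed.

End excess.

(** * Almost sure bound for an enumerated class *)

Lemma scaled_kernel_supp (R : realType) d (K : 'rV[R]_d -> R) (h h0 : R) x u :
  (forall s, K s != 0 -> forall i, `|s ord0 i| <= 2^-1) -> 0 < h <= h0 ->
  scaled_kernel K h x u != 0 ->
  (forall l, `|u ord0 l - x ord0 l| <= h `^ d%:R^-1 / 2) /\
  `|u - x| <= h0 `^ d%:R^-1 / 2.
Proof.
move=> K_supp /andP[h_gt0 hh0] nz.
have hp : (0 < h `^ d%:R^-1)%R by exact: powR_gt0.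
have cb l : (`|u ord0 l - x ord0 l| <= h `^ d%:R^-1 / 2)%R.
  have := K_supp _ nz l; rewrite !mxE normrM ger0_norm ?invr_ge0 ?(ltW hp)//.
  by rewrite ler_pdivrMl// distrC.
split => //; rewrite mx_norm_le ?divr_ge0 ?powR_ge0// => l.
rewrite !mxE; apply: le_trans (cb l) _.
by rewrite ler_pM2r// ge0_ler_powR ?nnegrE ?invr_ge0 ?(ltW h_gt0)// ltW// (lt_le_trans h_gt0).
Qed.

(** The functions are pointwise limits along the enumeration [phi], the sequence
    of indices depending on the function. Stating the bound block by block lets
    a single exceptional null set and a single [i1] serve all sample sizes,
    bandwidths, points and functions. *)
Definition eventually_bounded (R : realType) dO (Omega : measurableType dO)
    (P : probability Omega R) (r d : nat)
    (W : nat -> Omega -> 'rV[R]_r * 'rV[R]_d) (phi : nat -> 'rV[R]_r -> R)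
    (K : 'rV[R]_d -> R) (I : set 'rV[R]_d) (gamma h0 c E : R) : Prop :=
  {ae P, forall w, exists i1, forall i n h (x : 'rV[R]_d) (f1 : 'rV[R]_r -> R)
    (a : nat -> nat),
    (i1 <= i)%N -> (2 ^ i <= n <= 2 ^ i.+1)%N ->
    c * (ln n%:R / n%:R) `^ gamma <= h <= h0 -> I x ->
    (forall y, phi (a l) y @[l --> \oo] --> f1 y) ->
    `|centered_sum P W (fun t => f1 t.1 * scaled_kernel K h x t.2) n w| <=
     E * normalizer n h}.

Section uniform_class.
Local Open Scope ereal_scope.
Context (R : realType) dO (Omega : measurableType dO) (P : probability Omega R)
  (r d : nat).
Let T : measurableType _ := ('rV[R]_r * 'rV[R]_d)%type.
Variable W : nat -> Omega -> T.
Hypothesis mW : forall i, measurable_fun setT (W i).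
Hypothesis W_indep : mutually_independent P W.
Hypothesis W_id : identically_distributed P W.
Variables (phi : nat -> 'rV[R]_r -> R) (F : 'rV[R]_r -> R).
Variables (k : nat -> 'rV[R]_d -> R) (kappa : R) (K : 'rV[R]_d -> R).
Hypotheses (mphi : forall a, measurable_fun setT (phi a)) (mF : measurable_fun setT F).
Hypothesis mk : forall b, measurable_fun setT (k b).
Hypothesis phi_le : forall a y, (`|phi a y| <= F y)%R.
Hypothesis k_le : forall b x, (`|k b x| <= kappa)%R.
Hypothesis kappa_gt0 : (0 < kappa)%R.
Variables (C1 nu1 C2 nu2 : R).
Hypotheses (C1_ge0 : (0 <= C1)%R) (C2_ge0 : (0 <= C2)%R)
  (nu1_ge0 : (0 <= nu1)%R) (nu2_ge0 : (0 <= nu2)%R).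
Hypothesis phi_entropy : weighted_entropy phi F C1 nu1.
Hypothesis k_entropy : weighted_entropy k (fun=> kappa) C2 nu2.
Hypothesis k_dense : forall h x, (0 < h)%R -> exists b : nat -> nat,
  forall u, k (b l) u @[l --> \oo] --> scaled_kernel K h x u.
Hypothesis K_supp : forall s, K s != 0%R -> forall i, (`|s ord0 i| <= 2^-1)%R.
Variables (h0 c gamma MI : R) (I : set 'rV[R]_d).
Hypotheses (d_gt0 : (0 < d)%N) (h0_gt0 : (0 < h0)%R) (c_gt0 : (0 < c)%R)
  (gamma_itv : (0 < gamma <= 1)%R) (MI_gt0 : (0 < MI)%R).
Hypothesis I_bounded : forall x, I x -> forall l, (`|x ord0 l| <= MI)%R.
Variables (J' : set 'rV[R]_d) (tau : nat -> R) (Vd c1 : R).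
Hypotheses (mJ' : measurable J') (tau_gt0 : forall i, (0 < tau i)%R)
  (Vd_ge0 : (0 <= Vd)%R) (c1_gt0 : (0 < c1)%R).
Hypothesis I_near : forall x u, I x -> (`|u - x| <= h0 `^ d%:R^-1 / 2)%R -> J' u.
Hypothesis second_moment : forall i cen s, (0 <= s)%R ->
  \int[P]_w (F (W 0 w).1 ^+ 2 * cutoff F (tau i) (J' `&` box cen s) (W 0 w))%:E <=
  (Vd * (2 * s) ^+ d)%:E.
Hypothesis scale_tau : forall i h, (1 <= i)%N -> (min_scale c gamma i <= h)%R ->
  (c1 * i%:R * tau i ^+ 2 <= 2 ^+ i.+1 * h)%R.
Variables (rho lev : nat -> R) (C5 : R) (i2 : nat).
Hypothesis excess_rho : forall i,
  \int[P]_w (excess F J' (tau i) (W 0 w))%:E <= (rho i)%:E.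
Hypothesis rho_lev : forall i, (2 ^+ i.+1 * rho i <= lev i)%R.
Hypothesis excess_lev : {ae P, forall w, exists i1, forall i, (i1 <= i)%N ->
  (\sum_(l < 2 ^ i.+1) excess F J' (tau i) (W l w) <= lev i)%R}.
Hypothesis lev_normalizer : forall i n h, (i2 <= i)%N -> (2 ^ i <= n)%N ->
  (min_scale c gamma i <= h)%R -> (lev i <= C5 * normalizer n h)%R.

Let F_nonneg y : (0 <= F y)%R.
Proof. by apply: le_trans (phi_le 0 y); exact: normr_ge0. Qed.

Let mexcess i : measurable_fun setT (fun w => excess F J' (tau i) (W 0 w)).
Proof. by apply: measurableT_comp => //; exact: measurable_excess. Qed.

Let excess_integrable i : P.-integrable setT (fun w => (excess F J' (tau i) (W 0 w))%:E).
Proof.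
apply/integrableP; split; first exact/measurable_EFinP.
under eq_integral do rewrite gee0_abs ?lee_fin ?excess_ge0//.
by apply: le_lt_trans (excess_rho i) _; rewrite ltry.
Qed.

(** The part removed by truncation is estimated without cancellation, by its
    sum and its mean. *)
Let split_bound i n w (f1 f2 : T -> R) :
  measurable_fun setT f1 -> measurable_fun setT f2 ->
  (forall t, `|f1 t| <= kappa * tau i)%R ->
  (forall t, `|f2 t| <= kappa * excess F J' (tau i) t)%R ->
  (n <= 2 ^ i.+1)%N ->
  (\sum_(l < 2 ^ i.+1) excess F J' (tau i) (W l w) <= lev i)%R ->
  (`|centered_sum P W (fun t => f1 t + f2 t) n w| <=
    `|centered_sum P W f1 n w| + 2 * kappa * lev i)%R.
Proof.
move=> mf1 mf2 f1b f2b ni hl.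
have ib1 : P.-integrable setT (fun w => (f1 (W 0 w))%:E).
  apply: (@bounded_integrable _ _ _ P (fun w => f1 (W 0 w)) (kappa * tau i)%R) => //.
  exact: measurableT_comp.
have ie : P.-integrable setT (fun w => (kappa * excess F J' (tau i) (W 0 w))%:E).
  under eq_fun do rewrite EFinM.
  exact: integrableZl.
have ib2 : P.-integrable setT (fun w => (f2 (W 0 w))%:E).
  apply: (le_integrable measurableT _ _ ie).
    by apply/measurable_EFinP; exact: measurableT_comp.
  move=> v _ /=; rewrite lee_fin; apply: le_trans (f2b _) _; exact: ler_norm.
have mi2 : measurable_fun setT (fun w => (f2 (W 0 w))%:E).
  by apply/measurable_EFinP; exact: measurableT_comp.
have meanD : (mean P W (fun t => f1 t + f2 t) = mean P W f1 + mean P W f2)%R.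
  rewrite /mean -fineD; [|exact: integrable_fin_num..].
  by rewrite -integralD//.
have mean2 : (`|mean P W f2| <= kappa * rho i)%R.
  rewrite -lee_fin -abse_EFin /mean fineK; last exact: integrable_fin_num.
  apply: le_trans (le_abse_integral _ measurableT mi2) _.
  apply: (@le_trans _ _ (\int[P]_v (kappa%:E * (excess F J' (tau i) (W 0 v))%:E))).
    apply: ge0_le_integral => //.
    - by exact: measurableT_comp.
    - by apply: measurable_funeM; exact/measurable_EFinP.
    - by move=> v _; rewrite /= lee_fin.
  rewrite ge0_integralZl//; last 3 first.
  - by apply/measurable_EFinP.
  - by move=> v _; rewrite lee_fin excess_ge0.
  - by rewrite lee_fin ltW.
  by rewrite EFinM lee_wpmul2l// lee_fin ltW.
have rho0 : (0 <= rho i)%R.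
  rewrite -lee_fin; apply: le_trans (excess_rho i).
  by apply: integral_ge0 => v _; rewrite lee_fin excess_ge0.
have -> : (centered_sum P W (fun t => f1 t + f2 t) n w =
    centered_sum P W f1 n w + centered_sum P W f2 n w)%R.
  rewrite /centered_sum -big_split/=; apply: eq_bigr => l _.
  by rewrite meanD; ring.
apply: le_trans (ler_normD _ _) _; apply: lerD => //.
apply: le_trans (ler_norm_sum _ _ _) _.
apply: (@le_trans _ _ (\sum_(l < n) (kappa * excess F J' (tau i) (W l w) + kappa * rho i)))%R.
  apply: ler_sum => l _; apply: le_trans (ler_normB _ _) _; exact: lerD.
rewrite big_split/= -mulr_sumr sumr_const card_ord -[(kappa * rho i *+ n)%R]mulr_natl.
have h1 : (\sum_(l < n) excess F J' (tau i) (W l w) <= lev i)%R.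
  apply: le_trans hl.
  rewrite -!(big_mkord xpredT (fun l => excess F J' (tau i) (W l w))).
  rewrite (big_cat_nat _ ni)//= lerDl; apply: sumr_ge0 => l _; exact: excess_ge0.
have h2 : (n%:R * (kappa * rho i) <= kappa * lev i)%R.
  rewrite mulrCA; apply: ler_wpM2l; first exact: ltW.
  apply: le_trans (rho_lev i); apply: ler_wpM2r => //.
  by rewrite -natrX ler_nat.
have h3 := ler_wpM2l (ltW kappa_gt0) h1; apply: (le_trans (lerD h3 h2)).
lra.
Qed.

(** The truncated functions are bounded off the rare sets of the dyadic blocks,
    which occur finitely often; the remainder is bounded by the excess. *)
Lemma class_deviation : exists E : R, (0 <= E)%R /\
  eventually_bounded P W phi K I gamma h0 c E.
Proof.
have [B [Cb [E [i0 [mB PB E_ge0 HB]]]]] := block_deviation mW W_indep W_id mphi mF mk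
  phi_le k_le kappa_gt0 C1_ge0 C2_ge0 nu1_ge0 nu2_ge0 phi_entropy k_entropy d_gt0
  h0_gt0 c_gt0 gamma_itv MI_gt0 mJ' tau_gt0 Vd_ge0 c1_gt0 second_moment scale_tau.
exists (E + 2 * kappa * `|C5|)%R; split.
  by rewrite addr_ge0// mulr_ge0// mulr_ge0// ltW.
have nB := borel_cantelli_inv_square mB PB.
apply: filterS2 nB excess_lev => w [j1 hj1] [j2 hj2].
exists (maxn (maxn i0 i2) (maxn j1 (maxn j2 1))) => i n h x f1 a.
rewrite !geq_max => /andP[/andP[i0i i2i] /and3P[j1i j2i i_gt0]] /[dup] ni /andP[ni1 ni2].
move=> /[dup] hh /andP[h1 h2] Ix af.
have mh : (min_scale c gamma i <= h)%R.
  by apply: min_scale_le ni h1 => //; case/andP : gamma_itv => /ltW.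
have h_gt0 : (0 < h)%R.
  by apply: lt_le_trans mh; exact: min_scale_gt0.
pose S := [set y | (F y <= tau i)%R].
have [b bk] := k_dense x h_gt0.
have mf1 : measurable_fun setT f1.
  by apply: (measurable_fun_cvg (h := fun l => phi (a l))) => // y _; exact: af.
have mf2 : measurable_fun setT (scaled_kernel K h x).
  by apply: (measurable_fun_cvg (h := fun l => k (b l))) => // y _; exact: bk.
have f1_le y : (`|f1 y| <= F y)%R.
  have hc : (fun l => `|phi (a l) y|%R) @ \oo --> `|f1 y|%R by exact: cvg_norm (af y).
  by apply: (cvgr_to_le hc); apply: nearW => l; exact: phi_le.
have f2_le u : (`|scaled_kernel K h x u| <= kappa)%R.
  have hc : (fun l => `|k (b l) u|%R) @ \oo --> `|scaled_kernel K h x u|%R by exact: cvg_norm (bk u).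
  by apply: (cvgr_to_le hc); apply: nearW => l; exact: k_le.
have supp u : scaled_kernel K h x u != 0%R ->
    J' u /\ forall l, (`|u ord0 l - x ord0 l| <= h `^ d%:R^-1 / 2)%R.
  move=> /(scaled_kernel_supp (h0 := h0) K_supp)[|cb near]; first by rewrite h_gt0.
  by split => //; exact: I_near Ix near.
pose g1 (t : T) := (\1_S t.1 * f1 t.1 * scaled_kernel K h x t.2)%R.
pose g2 (t : T) := ((1 - \1_S t.1) * f1 t.1 * scaled_kernel K h x t.2)%R.
have mf1t : measurable_fun setT (fun t : T => f1 t.1) by exact: measurableT_comp.
have mf2t : measurable_fun setT (fun t : T => scaled_kernel K h x t.2) by exact: measurableT_comp.
have mSt : measurable_fun setT (fun t : T => \1_S t.1 : R).
  by apply: measurableT_comp => //; exact: measurable_indic (measurable_sublevel mF _).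
have -> : (fun t : T => f1 t.1 * scaled_kernel K h x t.2)%R = (fun t => g1 t + g2 t)%R.
  by apply/funext => t; rewrite /g1 /g2; ring.
apply: (le_trans (@split_bound i n w g1 g2 _ _ _ _ ni2 (hj2 i j2i))).
- by apply: measurable_funM => //; exact: measurable_funM.
- by apply: measurable_funM => //; apply: measurable_funM => //; exact: measurable_funB.
- move=> t; rewrite /g1 !normrM mulrC; apply: ler_pM => //.
  rewrite indicE; case: (boolP (t.1 \in S)) => [|_].
    by rewrite inE/= normr1 mul1r => ?; exact: le_trans (f1_le _) _.
  by rewrite normr0 mul0r ltW.
- move=> t; rewrite /g2 /excess.
  have [z|/supp[Ju _]] := eqVneq (scaled_kernel K h x t.2) 0%R.
    by rewrite z mulr0 normr0 mulr_ge0 ?(ltW kappa_gt0)//; exact: excess_ge0.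
  rewrite [\1_J' _]indicE mem_set// mulr1 !normrM mulrC.
  apply: ler_pM => //.
  rewrite mulrC; apply: ler_pM => //.
  by rewrite -/S indicE; case: (_ \in S); rewrite ?subrr ?subr0 ?normr0 ?normr1.
rewrite (mulrDl E); apply: lerD.
  by apply: (HB i w n h x f1 (scaled_kernel K h x) a b) => //; [exact: hj1|exact: I_bounded].
rewrite -(mulrA (2 * kappa)%R) ler_wpM2l ?mulr_ge0 ?(ltW kappa_gt0)//.
apply: le_trans (lev_normalizer i2i ni1 mh) _.
by rewrite ler_wpM2r ?sqrtr_ge0// ler_norm.
Qed.

End uniform_class.

(** * Bounded envelopes and envelopes with a moment *)

Section envelope_cases.
Local Open Scope ereal_scope.
Context (R : realType) dO (Omega : measurableType dO) (P : probability Omega R)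
  (r d : nat).
Let T : measurableType _ := ('rV[R]_r * 'rV[R]_d)%type.
Variable W : nat -> Omega -> T.
Hypothesis mW : forall i, measurable_fun setT (W i).
Hypothesis W_indep : mutually_independent P W.
Hypothesis W_id : identically_distributed P W.
Variables (phi : nat -> 'rV[R]_r -> R) (F : 'rV[R]_r -> R).
Variables (k : nat -> 'rV[R]_d -> R) (kappa : R) (K : 'rV[R]_d -> R).
Hypotheses (mphi : forall a, measurable_fun setT (phi a)) (mF : measurable_fun setT F).
Hypothesis mk : forall b, measurable_fun setT (k b).
Hypothesis phi_le : forall a y, (`|phi a y| <= F y)%R.
Hypothesis k_le : forall b x, (`|k b x| <= kappa)%R.
Hypothesis kappa_gt0 : (0 < kappa)%R.
Variables (C1 nu1 C2 nu2 : R).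
Hypotheses (C1_ge0 : (0 <= C1)%R) (C2_ge0 : (0 <= C2)%R)
  (nu1_ge0 : (0 <= nu1)%R) (nu2_ge0 : (0 <= nu2)%R).
Hypothesis phi_entropy : weighted_entropy phi F C1 nu1.
Hypothesis k_entropy : weighted_entropy k (fun=> kappa) C2 nu2.
Hypothesis k_dense : forall h x, (0 < h)%R -> exists b : nat -> nat,
  forall u, k (b l) u @[l --> \oo] --> scaled_kernel K h x u.
Hypothesis K_supp : forall s, K s != 0%R -> forall i, (`|s ord0 i| <= 2^-1)%R.
Variables (h0 c MI : R) (I : set 'rV[R]_d).
Hypotheses (d_gt0 : (0 < d)%N) (h0_gt0 : (0 < h0)%R) (c_gt0 : (0 < c)%R)
  (MI_gt0 : (0 < MI)%R).
Hypothesis I_bounded : forall x, I x -> forall l, (`|x ord0 l| <= MI)%R.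
Variables (J' : set 'rV[R]_d) (Mf : R).
Hypotheses (mJ' : measurable J') (Mf_ge0 : (0 <= Mf)%R).
Hypothesis I_near : forall x u, I x -> (`|u - x| <= h0 `^ d%:R^-1 / 2)%R -> J' u.
Hypothesis cell_le : forall cen s, (0 <= s)%R ->
  P [set w | (J' `&` box cen s) (W 0 w).2] <= (Mf * (2 * s) ^+ d)%:E.

Let F_nonneg y : (0 <= F y)%R.
Proof. by apply: le_trans (phi_le 0 y); exact: normr_ge0. Qed.

Let mpre (B : set 'rV[R]_d) i : measurable B -> measurable [set w | B (W i w).2].
Proof.
move=> mB; have m : measurable_fun setT (fun w => (W i w).2) by exact: measurableT_comp.
by have := m measurableT B mB; rewrite setTI.
Qed.

Let cell_integral (B : set 'rV[R]_d) : measurable B ->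
  \int[P]_w (\1_B (W 0 w).2)%:E = P [set w | B (W 0 w).2].
Proof.
move=> mB; have m := mpre 0 mB; by rewrite -[X in _ = P X]setIT -integral_indic.
Qed.

Let cutoff_le tau (Q : set 'rV[R]_d) (t : T) : (cutoff F tau Q t <= \1_Q t.2)%R.
Proof.
by rewrite /cutoff !indicE; case: (t.1 \in _); case: (t.2 \in _); rewrite ?mul1r ?mul0r.
Qed.

(** Truncation at the bound removes nothing, almost surely, and the constant
    truncation level satisfies the scale condition for every exponent up to
    [1], because [x <= x ^ gamma] for [x <= 1]. *)
Lemma bounded_class_deviation (gamma M : R) : (0 < gamma <= 1)%R -> (0 < M)%R ->
  {ae P, forall w, excess F J' M (W 0 w) = 0%R} ->
  exists E : R, (0 <= E)%R /\ eventually_bounded P W phi K I gamma h0 c E.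
Proof.
move=> gamma_itv M_gt0 no_excess.
have /andP[g0 g1] := gamma_itv.
have ln2_gt0 : (0 < ln 2 :> R)%R by apply: lt_le_trans (ln2_ge_half R).
have mexc i : measurable_fun setT (fun w => excess F J' M (W i w)).
  by apply: measurableT_comp => //; exact: measurable_excess.
have no_excess_all i : {ae P, forall w, excess F J' M (W i w) = 0%R}.
  have m0 : measurable [set t : T | excess F J' M t <> 0%R].
    have := measurable_excess mF mJ' M measurableT (measurableC (measurable_set1 (0 : R)%R)).
    by rewrite setTI.
  have := no_excess; rewrite /almost_everywhere/= => -[N [mN N0 sub]].
  exists [set w | excess F J' M (W i w) <> 0%R]; split => //.
    by have := mW i measurableT m0; rewrite setTI.
  rewrite (W_id i m0); apply: (subset_measure0 _ mN sub N0).
  by have := mW 0 measurableT m0; rewrite setTI.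
apply: (@class_deviation _ _ _ P _ _ W mW W_indep W_id phi F k kappa K mphi mF mk
  phi_le k_le kappa_gt0 C1 nu1 C2 nu2 C1_ge0 C2_ge0 nu1_ge0 nu2_ge0 phi_entropy
  k_entropy k_dense K_supp h0 c gamma MI I d_gt0 h0_gt0 c_gt0 gamma_itv MI_gt0
  I_bounded J' (fun=> M) (M ^+ 2 * Mf)%R (c * ln 2 / M ^+ 2)%R mJ' _ _ _ I_near _ _
  (fun=> 0%R) (fun=> 0%R) 0%R 0%N).
- by [].
- by rewrite mulr_ge0// sqr_ge0.
- by rewrite divr_gt0 ?mulr_gt0 ?exprn_gt0.
- move=> i cen s s0.
  have mB : measurable (J' `&` box cen s) by apply: measurableI => //; exact: measurable_box.
  apply: (@le_trans _ _ (\int[P]_w ((M ^+ 2)%:E * (\1_(J' `&` box cen s) (W 0 w).2)%:E))).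
    apply: ge0_le_integral => //.
    - move=> w _; rewrite lee_fin mulr_ge0 ?sqr_ge0//.
      by case: (cutoff01 F M (J' `&` box cen s) (W 0 w)) => ->.
    - apply/measurable_EFinP; apply: measurable_funM.
        by apply: measurable_funX; apply: measurableT_comp => //; exact: measurableT_comp.
      by apply: measurableT_comp => //; exact: measurable_cutoff.
    - apply/measurable_EFinP; apply: measurable_funM => //.
      by apply: measurableT_comp; [exact: measurable_indic|exact: measurableT_comp].
    - move=> w _; rewrite -EFinM lee_fin /cutoff mulrA; apply: ler_wpM2r; first by rewrite indicE.
      rewrite [leLHS]mulrC indicE; case: (boolP ((W 0 w).1 \in _)).
        rewrite inE/= => FM; rewrite mul1r lerXn2r ?nnegrE//; exact: ltW.
      by rewrite mul0r sqr_ge0.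
  rewrite ge0_integralZl//; last first.
    by rewrite lee_fin sqr_ge0.
    apply/measurable_EFinP; apply: measurableT_comp; first exact: measurable_indic.
    exact: measurableT_comp.
  rewrite cell_integral// -(mulrA (M ^+ 2)%R) [leRHS]EFinM lee_wpmul2l ?lee_fin ?sqr_ge0//.
  exact: cell_le.
- move=> i h i1 hh.
  have i0 : (0 < i%:R :> R)%R by rewrite ltr0n.
  rewrite mulrAC divfK ?gt_eqF ?exprn_gt0//.
  apply: (@le_trans _ _ (2 ^+ i.+1 * min_scale c gamma i)%R); last first.
    by rewrite ler_wpM2l ?exprn_ge0.
  rewrite /min_scale ln_pow2 (mulrCA (2 ^+ i.+1)%R) -(mulrA c) ler_wpM2l ?(ltW c_gt0)//.
  have x1 : (i%:R * ln 2 / 2 ^+ i.+1 <= 1 :> R)%R.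
    rewrite ler_pdivrMr ?exprn_gt0// mul1r -ln_pow2.
    apply: (@le_trans _ _ (2 ^+ i)%R); first by apply: ltW; apply: ln_sublinear; rewrite exprn_gt0.
    by rewrite [leRHS]exprS; have := exprn_ge0 i (ler0n R 2); lra.
  have x0 : (0 < i%:R * ln 2 / 2 ^+ i.+1 :> R)%R by rewrite divr_gt0 ?exprn_gt0 ?mulr_gt0.
  rewrite [leLHS](_ : _ = 2 ^+ i.+1 * (i%:R * ln 2 / 2 ^+ i.+1))%R; last first.
    by field; rewrite expf_neq0.
  rewrite ler_pM2l ?exprn_gt0//.
  by rewrite -[leLHS]powRr1 ?(ltW x0)// ger_powR// x1 x0.
- by move=> i; rewrite (ae_eq_integral (cst 0)) ?integral0//=; [exact/measurable_EFinP| apply: filterS no_excess => w -> ].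
- by move=> i; rewrite mulr0.
- have h : {ae P, forall w, forall l, excess F J' M (W l w) = 0%R}.
    exact/ae_foralln.
  by apply: filterS h => w hw; exists 0%N => i _; rewrite big1.
- by move=> i n h _ _ _; rewrite mul0r.
Qed.

(** The second moment over a cell is controlled through [F ^ 2 <= 1 + F ^ p]. *)
Lemma moment_class_deviation (p alpha : R) : (2 < p)%R -> (0 <= alpha)%R ->
  (forall B, measurable B -> B `<=` J' ->
    \int[P]_w (F (W 0 w).1 `^ p * \1_B (W 0 w).2)%:E <=
    alpha%:E * P [set w | B (W 0 w).2]) ->
  exists E : R, (0 <= E)%R /\ eventually_bounded P W phi K I (1 - 2 / p) h0 c E.
Proof.
move=> p_gt2 alpha_ge0 hB.
have moment : \int[P]_w (F (W 0 w).1 `^ p * \1_J' (W 0 w).2)%:E <= alpha%:E.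
  apply: le_trans (hB _ mJ' _) _ => //.
  rewrite -[leRHS]mule1 lee_wpmul2l ?lee_fin//; exact: probability_le1 (mpre _ _).
have gamma_itv := gamma_moment_itv p_gt2 (erefl (1 - 2 / p)%R).
have [c1 c1_gt0 hc1] := trunc_level_scale p_gt2 c_gt0 (erefl (1 - 2 / p)%R).
have [C5 [i2 [C5_ge0 hC5]]] := trunc_level_normalizer p_gt2 c_gt0 (erefl (1 - 2 / p)%R).
apply: (@class_deviation _ _ _ P _ _ W mW W_indep W_id phi F k kappa K mphi mF mk
  phi_le k_le kappa_gt0 C1 nu1 C2 nu2 C1_ge0 C2_ge0 nu1_ge0 nu2_ge0 phi_entropy
  k_entropy k_dense K_supp h0 c _ MI I d_gt0 h0_gt0 c_gt0 gamma_itv MI_gt0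
  I_bounded J' (trunc_level p) ((1 + alpha) * Mf)%R c1 mJ' _ _ c1_gt0 I_near _ hc1
  (fun i => trunc_level p i `^ (1 - p) * alpha)%R
  (fun i => (4 * alpha + 8) * (i.+1%:R * trunc_level p i))%R ((4 * alpha + 8) * C5)%R i2).
- by move=> i; exact: trunc_level_gt0.
- by rewrite mulr_ge0// addr_ge0.
- move=> i cen s s0.
  have mB : measurable (J' `&` box cen s) by apply: measurableI => //; exact: measurable_box.
  have mFp : measurable_fun setT (fun w => F (W 0 w).1 `^ p : R)%R.
    have mFt : measurable_fun setT (fun w => F (W 0 w).1).
      by apply: measurableT_comp => //; exact: measurableT_comp.
    have h := measurableT_comp (measurable_powR p) mFt; exact: h.
  have mI : measurable_fun setT (fun w => \1_(J' `&` box cen s) (W 0 w).2 : R).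
    by apply: measurableT_comp; [exact: measurable_indic|exact: measurableT_comp].
  apply: (@le_trans _ _ (\int[P]_w ((\1_(J' `&` box cen s) (W 0 w).2)%:E +
      (F (W 0 w).1 `^ p * \1_(J' `&` box cen s) (W 0 w).2)%:E))).
    apply: ge0_le_integral => //.
    - move=> w _; rewrite lee_fin mulr_ge0 ?sqr_ge0//.
      by case: (cutoff01 F (trunc_level p i) (J' `&` box cen s) (W 0 w)) => ->.
    - apply/measurable_EFinP; apply: measurable_funM.
        by apply: measurable_funX; apply: measurableT_comp => //; exact: measurableT_comp.
      by apply: measurableT_comp => //; exact: measurable_cutoff.
    - by apply: emeasurable_funD; apply/measurable_EFinP => //; exact: measurable_funM.
    - move=> w _; rewrite -EFinD lee_fin.
      apply: (@le_trans _ _ (F (W 0 w).1 ^+ 2 * \1_(J' `&` box cen s) (W 0 w).2)%R).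
        by rewrite ler_wpM2l ?sqr_ge0.
      rewrite -[X in (X + _)%R]mul1r -mulrDl; apply: ler_wpM2r; first by rewrite indicE.
      have [F1|F1] := leP (F (W 0 w).1) 1%R.
        apply: (@le_trans _ _ 1%R); first by rewrite exprn_ile1.
        by rewrite lerDl powR_ge0.
      apply: (@le_trans _ _ (F (W 0 w).1 `^ p)%R); last by rewrite lerDr.
      by rewrite -powR_mulrn// ler_powR// ltW.
  have mFI : measurable_fun setT (fun w =>
      (F (W 0 w).1 `^ p * \1_(J' `&` box cen s) (W 0 w).2)%:E : \bar R).
    by apply/measurable_EFinP; exact: measurable_funM.
  have FI0 w : 0 <= (F (W 0 w).1 `^ p * \1_(J' `&` box cen s) (W 0 w).2)%:E :> \bar R.
    by rewrite lee_fin mulr_ge0 ?powR_ge0.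
  have -> := ge0_integralD P measurableT
    (f1 := fun w => (\1_(J' `&` box cen s) (W 0 w).2)%:E)
    (fun w _ => _ : 0 <= (\1_(J' `&` box cen s) (W 0 w).2)%:E :> \bar R)
    (proj2 (measurable_EFinP _ _) mI) (fun w _ => FI0 w) mFI; last by [].
  rewrite cell_integral//.
  have h1 := cell_le cen s0.
  have h2 := hB _ mB (@subIsetl _ _ _).
  apply: (le_trans (leeD h1 (le_trans h2 (lee_wpmul2l _ h1)))).
    by rewrite lee_fin.
  by rewrite -EFinM -EFinD lee_fin le_eqVlt; apply/orP; left; apply/eqP; ring.
- by move=> i; exact: excess_mean.
- move=> i; rewrite mulrA trunc_level_mean//.
  rewrite [leLHS](_ : _ = 2 * alpha * (i.+1%:R * trunc_level p i))%R; last by ring.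
  rewrite ler_wpM2r ?mulr_ge0 ?(ltW (trunc_level_gt0 _ _))//; lra.
- by have := excess_sum mF F_nonneg mJ' mW W_indep W_id p_gt2 moment.
- move=> i n h hi hn hh; rewrite -mulrA ler_wpM2l//; last exact: hC5.
  by rewrite addr_ge0// mulr_ge0.
Qed.

End envelope_cases.

(** * Enumerations, relatively compact families and kernels *)

(** Numbers that do not code a member of the countable subclass are sent to a
    fixed member. *)
Lemma pointwise_enumeration (R : realType) (T : Type) (G : set (T -> R)) :
  pointwise_measurable G -> G !=set0 ->
  exists e : nat -> T -> R, (forall n, G (e n)) /\
    forall g, G g -> exists a : nat -> nat, forall t, e (a l) t @[l --> \oo] --> g t.
Proof.
move=> [G0 [cG0 GG0 hG]] [g0 Gg0].
have [f finj] := countable_injP _ cG0.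
have [u [G0u _]] := hG _ Gg0.
have ex n : exists g, G0 g /\ ((exists g', G0 g' /\ f g' = n) -> f g = n).
  have [[g' [G0g' <-]]|nex] := pselect (exists g', G0 g' /\ f g' = n).
    by exists g'.
  by exists (u 0%N); split => // h.
have [e eP] := choice ex; exists e; split => [n|g Gg].
  by apply: GG0; case: (eP n).
have [v [G0v vg]] := hG _ Gg; exists (fun l => f (v l)) => t.
rewrite (_ : (fun l => _) = v ^~ t); first exact: vg.
apply/funext => l; congr (_ t); have [G0e he] := eP (f (v l)).
by apply: finj; rewrite ?inE//; apply: he; exists (v l).
Qed.

(** Around every point of the closure all functions are within [2] of one
    continuous member of the family, which is bounded on [I]; compactness of
    the closure makes the bound uniform. *)
Lemma precompact_bounded (R : realType) d (J I : set 'rV[R]_d)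
    (C : set {uniform` J -> R}) :
  compact I -> I `<=` J -> (forall g, C g -> {within J, continuous g}) ->
  precompact C -> exists2 M : R, 0 <= M & forall g x, C g -> I x -> `|g x| <= M.
Proof.
move=> cI IJ hC; rewrite precompactE => /compact_near_coveringP cov.
pose bound (M : R) (g : {uniform` J -> R}) := forall x, I x -> `|g x| <= M.
have near_g g : closure C g ->
    \forall g' \near g & M \near (+oo : set_system R), bound M g'.
  move=> Cg.
  pose E := [set p : R * R | ball p.1 1 p.2].
  have nE (g' : {uniform` J -> R}) : nbhs g' [set h | forall y, J y -> E (g' y, h y)].
    by apply/uniform_nbhs; exists E; split => //; rewrite -entourage_ballE; exists 1 => /=.
  have [g1 [Cg1 g1g]] := Cg _ (nE g).
  have /compact_bounded[M1 [_ hM1]] :=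
    continuous_compact (continuous_subspaceW IJ (hC _ Cg1)) cI.
  pose M2 := Num.max M1 0 + 1.
  have g1M x : I x -> `|g1 x| <= M2.
    move=> Ix; apply: hM1; last by exists x.
    by rewrite ltr_pwDr// le_max lexx.
  exists ([set g' | forall y, J y -> E (g y, g' y)], [set M | M2 + 2 <= M]).
    by split; [exact: nE|exact: (nbhs_pinfty_ge (num_real _))].
  move=> [g' M] [/= gg' hM] x Ix; apply: le_trans hM.
  have h1 := g1g x (IJ x Ix); have h2 := gg' x (IJ x Ix).
  rewrite /E/= -ball_normE/= in h1; rewrite /E/= -ball_normE/= in h2.
  have -> : g' x = g1 x + (g x - g1 x) - (g x - g' x) by ring.
  apply: le_trans (ler_normB _ _) _; apply: le_trans (lerD (ler_normD _ _) (lexx _)) _.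
  by have := g1M x Ix; lra.
have /= := cov R (+oo : set_system R) bound _ near_g.
move=> h; have [M [M0 hM]] : exists M : R, 0 <= M /\ closure C `<=` bound M.
  near (+oo : set_system R) => M; exists M; split; near: M; first exact: (nbhs_pinfty_ge (num_real _)).
  exact: h.
by exists M => // g x Cg Ix; apply: hM => //; exact: subset_closure.
Unshelve. all: by end_near. Qed.

Section kernel.
Context (R : realType) (d : nat).
Variables (K : 'rV[R]_d -> R) (kappa : R).
Hypothesis K_sup : ereal_sup (range (fun s => `|K s|%:E)) = kappa%:E.

Lemma kernel_le s : `|K s| <= kappa.
Proof. by rewrite -lee_fin -K_sup; apply: ereal_sup_ubound; exists s. Qed.

Lemma kernel_sup_gt0 : (\int[lebesgue_rV R d]_s (K s)%:E = 1)%E -> 0 < kappa.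
Proof.
move=> h; rewrite ltNge; apply/negP => k0.
have K0 s : K s = 0.
  by apply/eqP; rewrite -normr_le0; exact: le_trans (kernel_le s) _.
move: h; under eq_integral do rewrite K0.
by rewrite integral0 => /eqP; rewrite eqe eq_sym oner_eq0.
Qed.

Lemma measurable_scaled_kernel h x : measurable_fun setT K ->
  measurable_fun setT (scaled_kernel K h x).
Proof.
move=> mK; apply: measurableT_comp => //; apply: measurable_fun_rVP => i.
under eq_fun do rewrite !mxE.
apply: measurable_funM => //; apply: measurable_funB => //.
exact: measurable_coord.
Qed.

End kernel.

(** * Shifted samples and expectations *)

Section shifted_sample.
Local Open Scope ereal_scope.
Context (R : realType) dO (Omega : measurableType dO) (P : probability Omega R)
  d (T : measurableType d).
Variable Z : nat -> Omega -> T.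
Hypothesis Z_indep : mutually_independent P Z.
Hypothesis Z_id : identically_distributed P Z.

Lemma mutually_independent_shift : mutually_independent P (fun i => Z i.+1).
Proof.
move=> s A us mA.
have us' : uniq (map succn s) by rewrite map_inj_uniq//; exact: succn_inj.
have := Z_indep us' (fun i => mA i.-1); rewrite big_map => <-.
congr (P _); apply/seteqP; split => w /= h i.
  by move=> /= /mapP[j js ->]; exact: h.
by move=> /= si; have /= := h i.+1; apply; rewrite mem_map//; exact: succn_inj.
Qed.

Lemma identically_distributed_shift : identically_distributed P (fun i => Z i.+1).
Proof. by move=> i A mA; rewrite Z_id// [RHS]Z_id. Qed.

End shifted_sample.

Section centered_sums.
Local Open Scope ereal_scope.
Context (R : realType) dO (Omega : measurableType dO) (P : probability Omega R)
  (r d : nat).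
Let T : measurableType _ := ('rV[R]_r * 'rV[R]_d)%type.
Variable W : nat -> Omega -> T.
Hypothesis mW : forall i, measurable_fun setT (W i).
Hypothesis W_id : identically_distributed P W.

Lemma integrable_iid (g : T -> R) i : measurable_fun setT g ->
  P.-integrable setT (fun w => (g (W 0 w))%:E) ->
  P.-integrable setT (fun w => (g (W i w))%:E).
Proof.
move=> mg /integrableP[_ ig]; apply/integrableP; split.
  by apply/measurable_EFinP; exact: measurableT_comp.
apply: le_lt_trans ig; rewrite le_eqVlt; apply/orP; left; apply/eqP.
apply: (ge0_integral_iid mW W_id (f := fun t => `|(g t)%:E|)) => //.
by apply: measurableT_comp => //; exact/measurable_EFinP.
Qed.

Lemma integral_iid (g : T -> R) i : measurable_fun setT g ->
  \int[P]_w (g (W i w))%:E = \int[P]_w (g (W 0 w))%:E.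
Proof.
move=> mg; have mg' : measurable_fun setT (EFin \o g) by exact/measurable_EFinP.
rewrite integralE [RHS]integralE; congr (_ - _).
  transitivity (\int[P]_w (EFin \o g)^\+ (W i w)); first by apply: eq_integral => w _; rewrite ?funeposE ?funenegE.
  rewrite (ge0_integral_iid mW W_id i (measurable_funepos mg')); first by apply: eq_integral => w _; rewrite ?funeposE ?funenegE.
  by move=> t; exact: funepos_ge0.
transitivity (\int[P]_w (EFin \o g)^\- (W i w)); first by apply: eq_integral => w _; rewrite ?funeposE ?funenegE.
rewrite (ge0_integral_iid mW W_id i (measurable_funeneg mg')); first by apply: eq_integral => w _; rewrite ?funeposE ?funenegE.
by move=> t; exact: funeneg_ge0.
Qed.

Lemma centered_sum_expectation (g : T -> R) n w : measurable_fun setT g ->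
  P.-integrable setT (fun w => (g (W 0 w))%:E) ->
  (\sum_(i < n) g (W i w))%:E - \int[P]_v (\sum_(i < n) g (W i v))%:E =
  (centered_sum P W g n w)%:E.
Proof.
move=> mg ig; under eq_integral do rewrite -sumEFin.
rewrite integral_sum//; last by move=> i; exact: integrable_iid.
rewrite (eq_bigr (fun=> \int[P]_v (g (W 0 v))%:E)); last by move=> i _; exact: integral_iid.
rewrite -(fineK (integrable_fin_num measurableT ig)) sumEFin -EFinB.
by rewrite /centered_sum sumrB.
Qed.

Lemma centered_sum_linear (g1 g2 : T -> R) (a b : R) n w :
  P.-integrable setT (fun w => (g1 (W 0 w))%:E) ->
  P.-integrable setT (fun w => (g2 (W 0 w))%:E) ->
  (centered_sum P W (fun t => a * g1 t + b * g2 t) n w =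
    a * centered_sum P W g1 n w + b * centered_sum P W g2 n w)%R.
Proof.
move=> i1 i2.
have meanD : (mean P W (fun t => a * g1 t + b * g2 t) = a * mean P W g1 + b * mean P W g2)%R.
  rewrite /mean.
  under eq_integral do rewrite EFinD !EFinM.
  rewrite integralD//; [|exact: integrableZl..].
  rewrite !integralZl// fineD ?fin_numM ?integrable_fin_num//.
  by rewrite !fineM ?integrable_fin_num.
rewrite /centered_sum !mulr_sumr -big_split/=; apply: eq_bigr => l _.
by rewrite meanD; ring.
Qed.

End centered_sums.

Lemma limn_esup_lt (R : realType) (u : nat -> \bar R) (D : R) N :
  (forall n, (N <= n)%N -> (u n <= D%:E)%E) -> (limn_esup u < +oo)%E.
Proof.
move=> h; apply: (@le_lt_trans _ _ D%:E); last exact: ltry.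
apply: (@le_trans _ _ (ereal_sup (u @` [set n | (N <= n)%N]))).
  by apply: ereal_inf_lbound; exists [set n | (N <= n)%N] => //; exists N.
by apply: ge_ereal_sup => _ [n /= Nn <-]; exact: h.
Qed.

(** * Conditions on the envelope *)

Section envelope_moment.
Local Open Scope ereal_scope.
Context (R : realType) dO (Omega : measurableType dO) (P : probability Omega R)
  (r d : nat).
Let T : measurableType _ := ('rV[R]_r * 'rV[R]_d)%type.

(** Both moment conditions, localized to [J']. The exponent is free in the first
    alternative, so that the constant class is covered in either case. In the
    second one the conditional moment is integrated over subsets of [J'], in the
    form that bounds second moments over small cubes. *)
Definition envelope_moment (W : Omega -> T) (F : 'rV[R]_r -> R)
    (J' : set 'rV[R]_d) (gamma : R) : Prop :=
  ((0 < gamma <= 1)%R /\ exists2 M : R, (0 < M)%R &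
     {ae P, forall w, excess F J' M (W w) = 0%R}) \/
  (exists p alpha : R, [/\ (2 < p)%R, (0 <= alpha)%R, gamma = (1 - 2 / p)%R &
     forall B, measurable B -> B `<=` J' ->
       \int[P]_w (F (W w).1 `^ p * \1_B (W w).2)%:E <=
       alpha%:E * P [set w | B (W w).2]]).

Section local_moment.
Variable W : Omega -> T.
Variables (F : 'rV[R]_r -> R) (J' : set 'rV[R]_d).
Hypotheses (mW : measurable_fun setT W) (mF : measurable_fun setT F)
  (F_nonneg : forall y, (0 <= F y)%R) (mJ' : measurable J').

(** Over [J'], almost surely [F] is at most a constant, or at most [1 + F ^ p]. *)
Lemma envelope_moment_integrable gamma : envelope_moment W F J' gamma ->
  P.-integrable setT (fun w => (F (W w).1 * \1_J' (W w).2)%:E).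
Proof.
have mF1 : measurable_fun setT (fun w => F (W w).1).
  by apply: measurableT_comp => //; exact: measurableT_comp.
have mJ1 : measurable_fun setT (fun w => \1_J' (W w).2 : R).
  by apply: measurableT_comp; [exact: measurable_indic|exact: measurableT_comp].
have mFJ : measurable_fun setT (fun w => (F (W w).1 * \1_J' (W w).2)%R).
  exact: measurable_funM.
have FJ0 w : (0 <= F (W w).1 * \1_J' (W w).2)%R by rewrite mulr_ge0// indicE.
move=> h; apply/integrableP; split; first exact/measurable_EFinP.
under eq_integral do rewrite gee0_abs ?lee_fin//.
case: h => [[_ [M M0 hM]]|[p [alpha [p2 a0 _ hB]]]].
- apply: (@le_lt_trans _ _ (\int[P]_w M%:E)).
    apply: ae_ge0_le_integral => //.
    + by move=> w _; rewrite lee_fin.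
    + exact/measurable_EFinP.
    + by move=> w _; rewrite lee_fin ltW.
    + apply: filterS hM => w hw _; rewrite lee_fin.
      have [FM|FM] := leP (F (W w).1) M.
        by rewrite -[leRHS]mulr1; apply: ler_pM => //; rewrite indicE//; case: (_ \in _).
      move: hw; rewrite /excess [X in (1 - X)%R]indicE memNset ?subr0 ?mulr1; last first.
        by apply/negP; rewrite -ltNge.
      by move=> ->; exact: ltW.
  by rewrite integral_cst// [X in _ * X]probability_setT mule1 ltry.
- have mFp : measurable_fun setT (fun w => F (W w).1 `^ p : R)%R.
    have h := measurableT_comp (measurable_powR p) mF1; exact: h.
  apply: (@le_lt_trans _ _ (\int[P]_w (1%:E + (F (W w).1 `^ p * \1_J' (W w).2)%:E))).
    apply: ge0_le_integral => //.
    + by move=> w _; rewrite lee_fin.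
    + exact/measurable_EFinP.
    + by apply: emeasurable_funD => //; apply/measurable_EFinP; exact: measurable_funM.
    + move=> w _; rewrite -EFinD lee_fin indicE.
      case: (_ \in _); rewrite ?mulr0 ?addr0// !mulr1.
      have [F1|F1] := leP (F (W w).1) 1%R; first by rewrite (le_trans F1)// lerDl powR_ge0.
      apply: (@le_trans _ _ (F (W w).1 `^ p)%R); last by rewrite lerDr.
      by rewrite -[leLHS]powRr1// ler_powR// ltW//; lra.
  have m2 : measurable_fun setT (fun w => (F (W w).1 `^ p * \1_J' (W w).2)%:E : \bar R).
    by apply/measurable_EFinP; exact: measurable_funM.
  have p0 w : 0 <= (F (W w).1 `^ p * \1_J' (W w).2)%:E :> \bar R.
    by rewrite lee_fin mulr_ge0 ?powR_ge0// indicE.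
  rewrite ge0_integralD//.
  rewrite integral_cst// [X in _ * X]probability_setT mule1 lte_add_pinfty ?ltry//.
  apply: le_lt_trans (hB _ mJ' _) _ => //.
  rewrite lte_mul_pinfty ?lee_fin//.
  have mX : measurable [set w | J' (W w).2].
    have m : measurable_fun setT (fun w => (W w).2) by exact: measurableT_comp.
    by have := m measurableT _ mJ'; rewrite setTI.
  exact: le_lt_trans (probability_le1 P mX) (ltry 1%R).
Qed.

(** The law of the sample point decides the moment condition, and the
    conditional moment controls the moments over small cells. *)
Lemma envelope_momentP (Z : Omega -> T) (J : set 'rV[R]_d) gamma :
  measurable_fun setT Z ->
  (forall A, measurable A -> P (W @^-1` A) = P (Z @^-1` A)) ->
  J' `<=` J ->
  ((exists2 M : R, (0 < M)%R & {ae P, forall w, (F (Z w).1 * \1_J (Z w).2 <= M)%R})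
     /\ gamma = 1%R) \/
  (exists p : R, [/\ (2 < p)%R,
    (exists2 g : 'rV[R]_d -> \bar R,
       cond_expectation_version P (fun w => (F (Z w).1 `^ p)%:E) (fun w => (Z w).2) g &
       ereal_sup [set g z | z in J] < +oo)
   & gamma = (1 - 2 / p)%R]) ->
  envelope_moment W F J' gamma.
Proof.
move=> mZ WZ JJ [[[M M0 hM] ->]|[p [p2 [g [mg g0 gE] gsup] ->]]].
- left; split; first by rewrite ltr01 lexx.
  exists M => //.
  have m0 : measurable [set t : T | excess F J' M t <> 0%R].
    have := measurable_excess mF mJ' M measurableT (measurableC (measurable_set1 (0 : R)%R)).
    by rewrite setTI.
  have mpre (V : Omega -> T) : measurable_fun setT V ->
      measurable [set w | excess F J' M (V w) <> 0%R].
    by move=> mV; have := mV measurableT _ m0; rewrite setTI.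
  case: hM => N [mN N0 sub].
  exists [set w | excess F J' M (W w) <> 0%R]; split => //; first exact: mpre.
  rewrite (WZ _ m0); apply: (subset_measure0 _ mN _ N0); first exact: mpre.
  move=> w /= nz; apply: sub => /= h; apply: nz; rewrite /excess.
  have [JZ|nJ] := pselect (J' (Z w).2); last by rewrite [\1_J' _]indicE memNset// mulr0.
  move: h; rewrite indicE mem_set ?mulr1; last exact: JJ.
  by move=> FM; rewrite [X in (1 - X)%R]indicE mem_set// subrr mulr0 mul0r.
- right; exists p, (Num.max 0 (fine (ereal_sup [set g z | z in J])))%R; split => //.
    by rewrite le_max lexx.
  move=> B mB BJ'.
  have mB' (V : Omega -> T) : measurable_fun setT V -> measurable [set w | B (V w).2].
    move=> mV; have m : measurable_fun setT (fun w => (V w).2) by exact: measurableT_comp.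
    by have := m measurableT _ mB; rewrite setTI.
  have mh : measurable_fun setT (fun t : T => (F t.1 `^ p * \1_B t.2)%:E : \bar R).
    apply/measurable_EFinP; apply: measurable_funM; last first.
      by apply: measurableT_comp => //; exact: measurable_indic.
    have mFt : measurable_fun setT (fun t : T => F t.1) by exact: measurableT_comp.
    have h := measurableT_comp (measurable_powR p) mFt; exact: h.
  have h0 (t : T) : 0 <= (F t.1 `^ p * \1_B t.2)%:E :> \bar R.
    by rewrite lee_fin mulr_ge0 ?powR_ge0// indicE.
  rewrite (ge0_integral_iid (Z := fun i => if i is 0%N then Z else W) (f := fun t => (F t.1 `^ p * \1_B t.2)%:E) _ _ 1%N)//; last 2 first.
  - by case.
  - by case=> [|i] A mA//; exact: WZ.
  have -> : P [set w | B (W w).2] = P [set w | B (Z w).2].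
    have mB2 : measurable [set t : T | B t.2].
      by have := @measurable_snd _ _ 'rV[R]_r 'rV[R]_d measurableT _ mB; rewrite setTI.
    exact: WZ mB2.
  rewrite (_ : \int[P]_w _ = \int[P]_(w in (fun w => (Z w).2) @^-1` B) (F (Z w).1 `^ p)%:E); last first.
    rewrite [RHS]integral_mkcond; apply: eq_integral => w _.
    rewrite patchE indicE; have [BZ|nB] := pselect (B (Z w).2).
      by rewrite !mem_set// mulr1.
    by rewrite !memNset// mulr0.
  rewrite gE//.
  apply: (@le_trans _ _ (\int[P]_(w in (fun w => (Z w).2) @^-1` B)
     (Num.max 0 (fine (ereal_sup [set g z | z in J])))%R%:E)).
    apply: ge0_le_integral => //.
    + exact: mB'.
    + by apply: measurableT_comp => //; apply: measurable_funTS; exact: measurableT_comp.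
    + move=> w /= Bw; have Jw := JJ _ (BJ' _ Bw).
      have gs : g (Z w).2 <= ereal_sup [set g z | z in J].
        by apply: ereal_sup_ubound; exists (Z w).2.
      apply: (le_trans gs); rewrite -[leLHS]fineK; first by rewrite lee_fin le_max lexx orbT.
      by rewrite ge0_fin_numE// (le_trans _ gs).
  by rewrite integral_cst//; exact: mB'.
Qed.

End local_moment.
End envelope_moment.

(** * Pointwise measurable classes *)

Definition eventually_class_bounded (R : realType) dO (Omega : measurableType dO)
    (P : probability Omega R) (r d : nat)
    (W : nat -> Omega -> 'rV[R]_r * 'rV[R]_d) (Phi : set ('rV[R]_r -> R))
    (K : 'rV[R]_d -> R) (I : set 'rV[R]_d) (gamma h0 c E : R) : Prop :=
  {ae P, forall w, exists i1, forall i n h (x : 'rV[R]_d) (phi : 'rV[R]_r -> R),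
    (i1 <= i)%N -> (2 ^ i <= n <= 2 ^ i.+1)%N ->
    c * (ln n%:R / n%:R) `^ gamma <= h <= h0 -> I x -> Phi phi ->
    `|centered_sum P W (fun t => phi t.1 * scaled_kernel K h x t.2) n w| <=
     E * normalizer n h}.

Section class_of_functions.
Local Open Scope ereal_scope.
Context (R : realType) dO (Omega : measurableType dO) (P : probability Omega R)
  (r d : nat).
Let T : measurableType _ := ('rV[R]_r * 'rV[R]_d)%type.
Variable W : nat -> Omega -> T.
Hypothesis mW : forall i, measurable_fun setT (W i).
Hypothesis W_indep : mutually_independent P W.
Hypothesis W_id : identically_distributed P W.
Variables (K : 'rV[R]_d -> R) (kappa : R).
Hypothesis mK : measurable_fun setT K.
Hypothesis K_supp : forall s, K s != 0%R -> forall i, (`|s ord0 i| <= 2^-1)%R.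
Hypothesis K_le : forall s, (`|K s| <= kappa)%R.
Hypothesis kappa_gt0 : (0 < kappa)%R.
Hypothesis K_entropy : uniform_entropy_condition (kernel_class K) (cst kappa).
Hypothesis K_pm : pointwise_measurable (kernel_class K).
Variables (h0 c MI : R) (I : set 'rV[R]_d).
Hypotheses (d_gt0 : (0 < d)%N) (h0_gt0 : (0 < h0)%R) (c_gt0 : (0 < c)%R)
  (MI_gt0 : (0 < MI)%R).
Hypothesis I_bounded : forall x, I x -> forall l, (`|x ord0 l| <= MI)%R.
Variables (J' : set 'rV[R]_d) (Mf : R).
Hypotheses (mJ' : measurable J') (Mf_ge0 : (0 <= Mf)%R).
Hypothesis I_near : forall x u, I x -> (`|u - x| <= h0 `^ d%:R^-1 / 2)%R -> J' u.
Hypothesis cell_le : forall cen s, (0 <= s)%R ->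
  P [set w | (J' `&` box cen s) (W 0 w).2] <= (Mf * (2 * s) ^+ d)%:E.

Let kernel_enumeration : exists (k : nat -> 'rV[R]_d -> R) (C nu : R),
  [/\ (forall b, measurable_fun setT (k b)), (forall b x, `|k b x| <= kappa)%R,
      (0 <= C)%R /\ (0 <= nu)%R, weighted_entropy k (fun=> kappa) C nu &
      forall h x, (0 < h)%R -> exists b : nat -> nat,
        forall u, k (b l) u @[l --> \oo] --> scaled_kernel K h x u].
Proof.
have KC : kernel_class K !=set0.
  by exists (scaled_kernel K 1%R 0%R); exists 1%R, 0%R; rewrite ltr01.
have [k [kK kd]] := pointwise_enumeration K_pm KC.
have mkc g : kernel_class K g -> measurable_fun setT g.
  by move=> [h [x [_ ->]]]; exact: measurable_scaled_kernel.
have kle g x : kernel_class K g -> (`|g x| <= cst kappa x)%R.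
  by move=> [h [y [_ ->]]]; exact: K_le.
have [C [nu [C0 nu0 hC]]] := uniform_weighted_entropy mkc (measurable_cst kappa) kle kK K_entropy.
exists k, C, nu; split => //.
- by move=> b; exact: mkc.
- by move=> b x; exact: kle.
- by split; exact: ltW.
- by move=> h x h1; apply: kd; exists h, x.
Qed.

Lemma class_bounded (Phi : set ('rV[R]_r -> R)) (F : 'rV[R]_r -> R) (gamma : R) :
  (forall phi, Phi phi -> measurable_fun setT phi) -> measurable_fun setT F ->
  (forall phi y, Phi phi -> (`|phi y| <= F y)%R) ->
  uniform_entropy_condition Phi F -> pointwise_measurable Phi ->
  Phi !=set0 -> envelope_moment P (W 0) F J' gamma ->
  exists E : R, (0 <= E)%R /\ eventually_class_bounded P W Phi K I gamma h0 c E.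
Proof.
move=> mPhi mF F_env Phi_entropy Phi_pm Phi0 hm.
have [k [C2 [nu2 [mk k_le [C2_ge0 nu2_ge0] k_entropy k_dense]]]] := kernel_enumeration.
have [phi [phiP phid]] := pointwise_enumeration Phi_pm Phi0.
have [C1 [nu1 [C1_gt0 nu1_gt0 phi_entropy]]] :=
  uniform_weighted_entropy mPhi mF F_env phiP Phi_entropy.
have mphi a : measurable_fun setT (phi a) by exact: mPhi.
have phi_le a y : (`|phi a y| <= F y)%R by exact: F_env.
suff [E [E0 hE]] : exists E : R, (0 <= E)%R /\ eventually_bounded P W phi K I gamma h0 c E.
  exists E; split => //; apply: filterS hE => w [i1 h1].
  exists i1 => i n h x f ii1 ni hh Ix /phid[a fa]; exact: (h1 i n h x f a).
case: hm => [[gamma_itv [M M_gt0 hM]]|[p [alpha [p2 a0 -> hB]]]].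
- exact: (bounded_class_deviation mW W_indep W_id mphi mF mk phi_le k_le kappa_gt0
    (ltW C1_gt0) C2_ge0 (ltW nu1_gt0) nu2_ge0 phi_entropy k_entropy k_dense K_supp
    d_gt0 h0_gt0 c_gt0 MI_gt0 I_bounded mJ' Mf_ge0 I_near cell_le gamma_itv M_gt0 hM).
- exact: (moment_class_deviation mW W_indep W_id mphi mF mk phi_le k_le kappa_gt0
    (ltW C1_gt0) C2_ge0 (ltW nu1_gt0) nu2_ge0 phi_entropy k_entropy k_dense K_supp
    d_gt0 h0_gt0 c_gt0 MI_gt0 I_bounded mJ' Mf_ge0 I_near cell_le p2 a0 hB).
Qed.

(** This class takes care of the terms with the coefficients [dphi]. *)
Lemma constant_class_bounded (gamma : R) : (0 < gamma <= 1)%R ->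
  exists E : R, (0 <= E)%R /\ eventually_class_bounded P W [set cst 1%R] K I gamma h0 c E.
Proof.
move=> gamma_itv.
have [k [C2 [nu2 [mk k_le [C2_ge0 nu2_ge0] k_entropy k_dense]]]] := kernel_enumeration.
have no_excess : {ae P, forall w, excess (fun _ : 'rV[R]_r => 1%R) J' 1%R (W 0 w) = 0%R}.
  by apply: aeW => w; rewrite /excess [X in (1 - X)%R]indicE mem_set/= ?subrr ?mulr0 ?mul0r.
have := bounded_class_deviation (phi := fun _ _ => 1%R) (F := fun=> 1%R)
  mW W_indep W_id (fun _ => measurable_cst _) (measurable_cst _)
  mk (fun _ _ => _) k_le kappa_gt0 ler01 C2_ge0 ler01 nu2_ge0
  (@weighted_entropy1 R _) k_entropy k_dense K_supp
  d_gt0 h0_gt0 c_gt0 MI_gt0 I_bounded mJ' Mf_ge0 I_near cell_le gamma_itv ltr01 no_excess.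
case=> [_ _|E [E0 hE]]; first by rewrite normr1.
exists E; split => //; apply: filterS hE => w [i1 h1].
exists i1 => i n h x f ii1 ni hh Ix ->.
by apply: (h1 i n h x (cst 1%R) id) => // y; exact: cvg_cst.
Qed.

End class_of_functions.

(** * Uniformity in the bandwidth *)

Lemma density_box_le (R : realType) dO (Omega : measurableType dO)
    (P : probability Omega R) d (X : Omega -> 'rV[R]_d) (f : 'rV[R]_d -> R)
    (J' : set 'rV[R]_d) (Mf : R) cen s :
  has_lebesgue_density P X f -> measurable J' -> 0 <= Mf ->
  (forall x, J' x -> f x <= Mf) -> 0 <= s ->
  (P (X @^-1` (J' `&` box cen s)) <= (Mf * (2 * s) ^+ d)%:E)%E.
Proof.
move=> [mf f0 fP] mJ' Mf0 fM s0.
have mb := @measurable_box R d cen s.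
have mB : measurable (J' `&` box cen s) by exact: measurableI.
rewrite fP//; apply: (@le_trans _ _ (\int[lebesgue_rV R d]_(x in J' `&` box cen s) Mf%:E)%E).
  apply: ge0_le_integral => //.
  - by move=> x _; rewrite lee_fin.
  - by apply/measurable_EFinP; exact: measurable_funTS.
  - by move=> x [Jx _]; rewrite lee_fin fM.
rewrite integral_cst// EFinM lee_wpmul2l ?lee_fin//.
by rewrite -(lebesgue_box cen s0) le_measure ?inE//; exact: subIsetr.
Qed.

Lemma powR_root_lt (R : realType) (h0 eta : R) d : (0 < d)%N -> 0 < eta ->
  0 < h0 < (2 * eta) ^+ d -> h0 `^ d%:R^-1 < 2 * eta.
Proof.
move=> d0 e0 /andP[h00 h].
have dR : 0 < d%:R :> R by rewrite ltr0n.
have e2 : 0 < 2 * eta by rewrite mulr_gt0.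
have := @gt0_ltr_powR R d%:R^-1; rewrite invr_gt0 => /(_ dR h0 ((2 * eta) ^+ d)).
rewrite !nnegrE (ltW h00) exprn_ge0 ?(ltW e2)// => /(_ isT isT h).
by rewrite -powR_mulrn ?(ltW e2)// -powRrM mulfV ?gt_eqF// powRr1 ?(ltW e2).
Qed.

(** For fixed [x] the coefficients are numbers, and centering is linear. *)
Lemma omega_sum_centered (R : realType) dO (Omega : measurableType dO)
    (P : probability Omega R) (r d : nat)
    (Z : nat -> Omega -> 'rV[R]_r * 'rV[R]_d)
    (K : 'rV[R]_d -> R) cphi dphi (phi : 'rV[R]_r -> R) n h x w :
  (forall i, measurable_fun setT (Z i)) -> identically_distributed P Z ->
  let g1 t := phi t.1 * scaled_kernel K h x t.2 in
  let g2 t := cst 1 t.1 * scaled_kernel K h x t.2 in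
  measurable_fun setT g1 -> measurable_fun setT g2 ->
  P.-integrable setT (fun w => (g1 (Z 1%N w))%:E) ->
  P.-integrable setT (fun w => (g2 (Z 1%N w))%:E) ->
  ((omega_sum Z K cphi dphi phi n h x w)%:E -
    'E_P[omega_sum Z K cphi dphi phi n h x])%E =
  (cphi phi x * centered_sum P (fun i => Z i.+1) g1 n w +
   dphi phi x * centered_sum P (fun i => Z i.+1) g2 n w)%:E.
Proof.
move=> mZ Z_id g1 g2 mg1 mg2 i1 i2.
have W_id := identically_distributed_shift Z_id.
pose g t := cphi phi x * g1 t + dphi phi x * g2 t.
have mg : measurable_fun setT g.
  by apply: measurable_funD; exact: measurable_funM.
have ig : P.-integrable setT (fun w => (g (Z 1%N w))%:E).
  rewrite /g; under eq_fun do rewrite EFinD !EFinM.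
  by apply: integrableD => //; exact: integrableZl.
have omegaE v : omega_sum Z K cphi dphi phi n h x v = \sum_(i < n) g (Z i.+1 v).
  rewrite /omega_sum big_add1/= big_mkord; apply: eq_bigr => i _.
  by rewrite /g /g1 /g2 /=; ring.
rewrite unlock omegaE; under eq_integral do rewrite omegaE.
rewrite (centered_sum_expectation (fun i => mZ i.+1) W_id n w mg ig).
by rewrite -(centered_sum_linear _ _ _ _ i1 i2).
Qed.

Theorem theorem4 (R : realType) (dO : measure_display)
    (Omega : measurableType dO) (P : probability Omega R)
    (r d : nat) (r_ge1 : (1 <= r)%N) (d_ge1 : (1 <= d)%N)
    (* Z 0 = (Y, X) and Z i = (Y_i, X_i) for i >= 1 *)
    (Z : nat -> {RV P >-> ('rV[R]_r * 'rV[R]_d)%type})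
    (Z_indep : mutually_independent P (fun i => Z i : Omega -> _))
    (Z_id : identically_distributed P (fun i => Z i : Omega -> _))
    (f : 'rV[R]_d -> R)
    (X_density : has_lebesgue_density P (fun w => (Z 0%N w).2) f)
    (I : set 'rV[R]_d) (I_compact : compact I)
    (eta : R) (eta_itv : 0 < eta < 1)
    (J : set 'rV[R]_d) (J_def : J = closed_neighborhood I eta)
    (K : 'rV[R]_d -> R) (K_meas : measurable_fun setT K)
    (K_supp : forall s, K s != 0 -> forall i, `|s ord0 i| <= 2^-1)
    (kappa : R) (K_sup : ereal_sup (range (fun s => `|K s|%:E)) = kappa%:E)
    (K_int : (\int[lebesgue_rV R d]_s (K s)%:E = 1)%E)
    (K_entropy : uniform_entropy_condition (kernel_class K) (cst kappa))
    (K_pm : pointwise_measurable (kernel_class K))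
    (Phi : set ('rV[R]_r -> R))
    (Phi_meas : forall phi, Phi phi -> measurable_fun setT phi)
    (F : 'rV[R]_r -> R) (F_meas : measurable_fun setT F)
    (F_env : forall phi y, Phi phi -> `|phi y| <= F y)
    (Phi_entropy : uniform_entropy_condition Phi F)
    (Phi_pm : pointwise_measurable Phi)
    (cphi dphi : ('rV[R]_r -> R) -> 'rV[R]_d -> R)
    (cphi_cont : forall phi, Phi phi -> {within J, continuous (cphi phi)})
    (dphi_cont : forall phi, Phi phi -> {within J, continuous (dphi phi)})
    (C_relcompact :
      precompact ([set cphi phi | phi in Phi] : set {uniform` J -> R}))
    (D_relcompact :
      precompact ([set dphi phi | phi in Phi] : set {uniform` J -> R}))
    (f_cont : {within J, continuous f})
    (f_gt0 : forall x, J x -> 0 < f x)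
    (gamma : R)
    (moment :
      ((exists2 M : R, 0 < M &
          {ae P, forall w, F (Z 0%N w).1 * \1_J (Z 0%N w).2 <= M})
       /\ gamma = 1) \/
      (exists p : R, [/\ 2 < p,
          (exists2 g : 'rV[R]_d -> \bar R,
             cond_expectation_version P (fun w => (F (Z 0%N w).1 `^ p)%:E)
               (fun w => (Z 0%N w).2) g &
             (ereal_sup [set g z | z in J] < +oo)%E)
        & gamma = 1 - 2 / p]))
    (c h0 : R) (c_gt0 : 0 < c) (h0_itv : 0 < h0 < (2 * eta) ^+ d) :
  {ae P, forall w,
    (limn_esup (fun n =>
       uniform_deviation P Z K cphi dphi I Phi gamma h0 c n w) < +oo)%E}.
Proof.
have [eta_gt0 _] := andP eta_itv; have [h0_gt0 _] := andP h0_itv.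
pose Z' i : Omega -> _ := Z i; pose W i : Omega -> _ := Z i.+1.
have mZ i : measurable_fun setT (Z' i) by exact: measurable_funPT.
have mW i : measurable_fun setT (W i) by exact: mZ.
have W_indep : mutually_independent P W by exact: mutually_independent_shift Z_indep.
have W_id : identically_distributed P W by exact: identically_distributed_shift Z_id.
have root_lt := powR_root_lt d_ge1 eta_gt0 h0_itv.
have root_ge0 : 0 <= h0 `^ d%:R^-1 by exact: powR_ge0.
have eps_itv : 0 < eta - h0 `^ d%:R^-1 / 2 <= eta by apply/andP; split; lra.
(* Kernels at points of [I] live in [J'], where the density is bounded. *)
have [J' [mJ' cJ' J'_sub J'_near]] := box_cover I_compact eps_itv.
rewrite -J_def in J'_sub.
have I_near x u : I x -> `|u - x| <= h0 `^ d%:R^-1 / 2 -> J' u.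
  by move=> Ix ux; apply: (J'_near x) => //; move: ux; lra.
have IJ : I `<=` J.
  by move=> x Ix; rewrite J_def; exists x; rewrite ?subrr ?normr0 ?ltW.
have [MI MI_gt0 I_bounded] := compact_coordinates_bounded I_compact.
have [Mf Mf_gt0 f_le] := continuous_compact_le f_cont cJ' J'_sub.
have cell_le cen s : 0 <= s ->
    (P [set w | (J' `&` box cen s) (W 0%N w).2] <= (Mf * (2 * s) ^+ d)%:E)%E.
  move=> s0; apply: le_trans (density_box_le cen X_density mJ' (ltW Mf_gt0) f_le s0).
  have mB : measurable [set t : 'rV[R]_r * 'rV[R]_d | (J' `&` box cen s) t.2].
    have := @measurable_snd _ _ 'rV[R]_r 'rV[R]_d measurableT (J' `&` box cen s).
    by rewrite setTI; apply; apply: measurableI => //; exact: measurable_box.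
  by have := Z_id 1%N _ mB => /= ->.
have kappa_gt0 := kernel_sup_gt0 K_sup K_int.
have K_le := kernel_le K_sup.
have gamma_itv : 0 < gamma <= 1.
  case: moment => [[_ ->]|[p [p2 _ ->]]]; first by rewrite ltr01 lexx.
  exact: (gamma_moment_itv p2 (erefl (1 - 2 / p))).
have [E2 [E2_ge0 hE2]] := constant_class_bounded mW W_indep W_id K_meas K_supp
  K_le kappa_gt0 K_entropy K_pm d_ge1 h0_gt0 c_gt0 MI_gt0 (fun x Ix l => I_bounded x l Ix) mJ' (ltW Mf_gt0)
  I_near cell_le gamma_itv.
have F_nonneg : Phi !=set0 -> forall y, 0 <= F y.
  by move=> [phi Pphi] y; apply: le_trans (F_env phi y Pphi).
have hmom : Phi !=set0 -> envelope_moment P (W 0%N) F J' gamma.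
  move=> Phi0.
  have WZ A : measurable A -> P (W 0%N @^-1` A) = P (Z' 0%N @^-1` A) by exact: Z_id.
  exact: (envelope_momentP (mW 0%N) F_meas mJ' (mZ 0%N) WZ J'_sub moment).
have [E1 [E1_ge0 hE1]] : exists E : R, 0 <= E /\
    eventually_class_bounded P W Phi K I gamma h0 c E.
  have [Phi0|Phi0] := pselect (Phi !=set0); last first.
    (* Nothing is known about [F] when [Phi] is empty. *)
    exists 0; split => //; apply: aeW => w; exists 0%N => i n h x phi _ _ _ _ Pphi.
    by case: Phi0; exists phi.
  exact: (class_bounded mW W_indep W_id K_meas K_supp
    K_le kappa_gt0 K_entropy K_pm d_ge1 h0_gt0 c_gt0 MI_gt0 (fun x Ix l => I_bounded x l Ix) mJ' (ltW Mf_gt0)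
    I_near cell_le Phi_meas F_meas F_env Phi_entropy Phi_pm Phi0 (hmom Phi0)).
have [Mc Mc_ge0 c_le] : exists2 M, 0 <= M & forall g x,
    [set cphi phi | phi in Phi] g -> I x -> `|g x| <= M.
  by apply: precompact_bounded I_compact IJ _ C_relcompact => _ [phi /cphi_cont h <-].
have [Md Md_ge0 d_le] : exists2 M, 0 <= M & forall g x,
    [set dphi phi | phi in Phi] g -> I x -> `|g x| <= M.
  by apply: precompact_bounded I_compact IJ _ D_relcompact => _ [phi /dphi_cont h <-].
apply: filterS2 hE1 hE2 => w [i1 h1] [i2 h2].
pose D := Mc * E1 + Md * E2; pose N := maxn i1 (maxn i2 1).
have D_ge0 : 0 <= D by rewrite addr_ge0// mulr_ge0.
apply: (@limn_esup_lt _ _ D (2 ^ N)) => n Nn.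
have n_gt0 : (0 < n)%N by apply: leq_trans Nn; rewrite expn_gt0.
pose i := trunc_log 2 n.
have ni : (2 ^ i <= n <= 2 ^ i.+1)%N.
  by have /andP[-> /ltnW ->] := trunc_log_bounds (isT : (1 < 2)%N) n_gt0.
have Ni : (N <= i)%N by apply: trunc_log_max.
move: (Ni); rewrite !geq_max => /and3P[i1i i2i i_gt0].
apply: ge_ereal_sup => _ [h /= hh <-].
have [ch hh0] := andP hh.
have h_gt0 : 0 < h.
  apply: lt_le_trans (min_scale_gt0 gamma c_gt0 i_gt0) _.
  by apply: min_scale_le ni ch => //; case/andP : gamma_itv => /ltW.
have a0 : 0 <= normalizer n h by exact: sqrtr_ge0.
(* The normalization may vanish, in which case its inverse is [0]. *)
suff S : (ereal_sup [set centered_sup_norm P Z K cphi dphi I phi n h w | phi in Phi] <=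
    (D * normalizer n h)%:E)%E.
  apply: (@le_trans _ _ ((D * normalizer n h)%:E * (normalizer n h)^-1%:E)%E).
    by apply: lee_wpmul2r => //; rewrite lee_fin invr_ge0.
  rewrite -EFinM lee_fin -mulrA ler_piMr//.
  have [->|nz] := eqVneq (normalizer n h) 0; first by rewrite mul0r.
  by rewrite mulfV.
apply: ge_ereal_sup => _ [phi Pphi <-]; apply: ge_ereal_sup => _ [x Ix <-].
have mk := measurable_scaled_kernel h x K_meas.
have mk2 : measurable_fun setT (fun t : 'rV[R]_r * 'rV[R]_d => scaled_kernel K h x t.2).
  exact: measurableT_comp.
have mphi2 : measurable_fun setT (fun t : 'rV[R]_r * 'rV[R]_d => phi t.1).
  by apply: measurableT_comp => //; exact: Phi_meas.
have mg1 : measurable_fun setT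
    (fun t : 'rV[R]_r * 'rV[R]_d => phi t.1 * scaled_kernel K h x t.2).
  exact: measurable_funM.
have mg2 : measurable_fun setT
    (fun t : 'rV[R]_r * 'rV[R]_d => cst 1 t.1 * scaled_kernel K h x t.2).
  exact: measurable_funM.
have Phi0 : Phi !=set0 by exists phi.
have k_le u : `|scaled_kernel K h x u| <= kappa * \1_J' u.
  have [->|/(scaled_kernel_supp (h0 := h0) K_supp)[|_ near]] := eqVneq (scaled_kernel K h x u) 0.
  - by rewrite normr0 mulr_ge0 ?indicE ?(ltW kappa_gt0).
  - by rewrite h_gt0.
  by rewrite indicE mem_set ?mulr1 ?K_le//; exact: I_near Ix near.
rewrite (@omega_sum_centered _ _ _ P _ _ Z' K cphi dphi phi n h x w mZ Z_id).
- rewrite lee_fin; apply: le_trans (ler_normD _ _) _; rewrite mulrDl !normrM -!mulrA.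
  apply: lerD; apply: ler_pM => //.
  + by apply: c_le => //; exists phi.
  + exact: (h1 i n h x phi).
  + by apply: d_le => //; exists phi.
  + exact: (h2 i n h x (cst 1)).
- exact: mg1.
- exact: mg2.
- have iF := envelope_moment_integrable (mW 0%N) F_meas (F_nonneg Phi0) mJ' (hmom Phi0).
  apply: (le_integrable measurableT _ _ (integrableZl measurableT kappa iF)).
    by apply/measurable_EFinP; exact: (measurableT_comp mg1 (mZ 1%N)).
  move=> v _; rewrite -EFinM /= lee_fin; apply: le_trans (ler_norm _).
  by rewrite normrM mulrCA; apply: ler_pM => //; exact: F_env.
- apply: (@bounded_integrable _ _ _ P (fun v => cst 1 (Z' 1%N v).1 * scaled_kernel K h x (Z' 1%N v).2) kappa).
    exact: (measurableT_comp mg2 (mZ 1%N)).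
  by move=> v; rewrite mul1r; exact: K_le.
Qed.
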